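(* Consider the convex-constrained problem (P) of the context, and suppose that the general assumptions and the convex-constraint assumptions of the context hold. Run the iPPP method of the context with Option I and with parameters $$\gamma_k=\gamma>\rho_0,\qquad \beta_k=\beta\sqrt{k+1},\qquad \hat\varepsilon_k=\frac{1}{\beta_k(k+1)},\qquad k\ge 0,$$ where $\beta>0$ and $\gamma$ are constants. Let $M_y=M_y(\gamma)$, $M_\lambda=M_\lambda(\gamma)$ and $$\mathcal{C}_1=2B_{f_0}+2G+\frac{\beta}{2}\|\mathbf{A}\bar{\mathbf{x}}^{(0)}-\mathbf{b}\|^2+\frac{\beta}{2}\big\|[\mathbf{f}(\bar{\mathbf{x}}^{(0)})]_+\big\|^2+\frac{3}{\beta}\left(2D+M_y^2+M_\lambda^2\right).$$ Given $\varepsilon>0$, let $$K=\left\lceil \max\left\{\frac{6}{\beta\varepsilon},\ \frac{4}{\varepsilon^2}\left[\sqrt{2\gamma\mathcal{C}_1}+\frac{4\sqrt{D+M_y^2+M_\lambda^2}}{\beta}+\frac{8(D+M_y^2+M_\lambda^2)}{\beta}\right]^2\right\}\right\rceil=O(1/\varepsilon^2).$$ Then $\bar{\mathbf{x}}^{(R_K)}$ is an $\varepsilon$-stationary point of (P), and the total complexity to produce $\bar{\mathbf{x}}^{(R_K)}$, i.e. the total number of proximal gradient steps performed in the $K$ calls ($k=0,\dots,K-1$) of the inner solver AdapAPG, is $\tilde O\left(\varepsilon^{-5/2}\right)$.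
   Context: Notation: $\|\cdot\|$ is the Euclidean norm; $[\mathbf{a}]_+=\max\{\mathbf{0},\mathbf{a}\}$ componentwise; $J_{\mathbf{f}}$ is the Jacobian; $\partial g$ is the convex subdifferential; $\mathrm{prox}_h(\mathbf{x})=\arg\min_{\mathbf{z}}\{h(\mathbf{z})+\frac12\|\mathbf{z}-\mathbf{x}\|^2\}$; $\tilde O$ suppresses logarithmic factors (in $1/\varepsilon$), and constants in $O,\tilde O$ may depend on the problem data and fixed algorithm parameters but not on $\varepsilon$. Problem (P): $\min_{\mathbf{x}\in\mathbb{R}^d} f_0(\mathbf{x})+g(\mathbf{x})$ s.t. $\mathbf{A}\mathbf{x}=\mathbf{b}$, $\mathbf{f}(\mathbf{x})\le\mathbf{0}$, with $\mathbf{f}=[f_1,\dots,f_m]$, $\mathbf{A}\in\mathbb{R}^{n\times d}$ of full row rank, $\mathbf{b}\in\mathbb{R}^n$; put $\mathbf{c}(\mathbf{x})=\mathbf{A}\mathbf{x}-\mathbf{b}$ (so $J_{\mathbf{c}}=\mathbf{A}$). The $f_i:\mathbb{R}^d\to\mathbb{R}$ are continuously differentiable and $g:\mathbb{R}^d\to\mathbb{R}\cup\{+\infty\}$ is proper, lower semicontinuous and convex. General assumptions: (A) $f_i$ is $L_{f_i}$-smooth for $i=0,\dots,m$, where $h$ is $L$-smooth if it is differentiable and $h(\mathbf{x})\le h(\mathbf{x}')+\langle\nabla h(\mathbf{x}'),\mathbf{x}-\mathbf{x}'\rangle+\frac L2\|\mathbf{x}-\mathbf{x}'\|^2$ for all $\mathbf{x},\mathbf{x}'\in\mathbb{R}^d$;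 (B) $\mathcal{X}=\mathrm{dom}(g)$ is compact with diameter $D$; (C) there are constants $G,M$ such that $|g(\mathbf{x})|\le G$, $\partial g(\mathbf{x})\ne\emptyset$ and $\partial g(\mathbf{x})\subseteq\mathcal{N}_{\mathcal{X}}(\mathbf{x})+\{\mathbf{v}:\|\mathbf{v}\|\le M\}$ for all $\mathbf{x}\in\mathcal{X}$, $\mathcal{N}_{\mathcal X}$ being the normal cone; (D) $\mathrm{prox}_g$ is easily computable. Constants $B_{f_i}$ satisfy $\max\{|f_i(\mathbf{x})|,\|\nabla f_i(\mathbf{x})\|\}\le B_{f_i}$ on $\mathcal{X}$, $i=0,\dots,m$. Convex-constraint assumptions: $f_0$ is $\rho_0$-weakly convex with $\rho_0\ge0$ (i.e. $f_0+\frac{\rho_0}{2}\|\cdot\|^2$ is convex), $f_1,\dots,f_m$ are convex, and there exists $\mathbf{x}_{\mathrm{feas}}\in\mathrm{int}(\mathcal{X})$ with $\mathbf{A}\mathbf{x}_{\mathrm{feas}}=\mathbf{b}$ and $\mathbf{f}(\mathbf{x}_{\mathrm{feas}})<\mathbf{0}$. Constants: with $Q(\gamma)=D(B_{f_0}+\gamma D+M)$, $$M_\lambda(\gamma)=\frac{Q(\gamma)}{\min_{i}|f_i(\mathbf{x}_{\mathrm{feas}})|},\quad M_y(\gamma)=\frac{Q(\gamma)\sqrt{\lambda_{\max}(\mathbf{A}\mathbf{A}^\top)}}{\lambda_{\min}(\mathbf{A}\mathbf{A}^\top)}\left(\frac1D+\frac{1}{\mathrm{dist}(\mathbf{x}_{\mathrm{feas}},\partial\mathcal{X})}+\frac{\max_{i}B_{f_i}}{\min_{i}|f_i(\mathbf{x}_{\mathrm{feas}})|}\right),$$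 with $i$ ranging over $1,\dots,m$ and $\partial\mathcal X$ the boundary of $\mathcal X$. $\varepsilon$-stationary point: $\bar{\mathbf{x}}$ for which there exist $\bar{\boldsymbol\xi}\in\partial g(\bar{\mathbf{x}})$, $\bar{\boldsymbol\lambda}\in\mathbb{R}^m_+$, $\bar{\mathbf{y}}\in\mathbb{R}^n$ with $\bar\lambda_i=0$ whenever $f_i(\bar{\mathbf{x}})<0$, and $\|\nabla f_0(\bar{\mathbf{x}})+J_{\mathbf{f}}(\bar{\mathbf{x}})^\top\bar{\boldsymbol\lambda}+J_{\mathbf{c}}(\bar{\mathbf{x}})^\top\bar{\mathbf{y}}+\bar{\boldsymbol\xi}\|\le\varepsilon$, $\sqrt{\|\mathbf{c}(\bar{\mathbf{x}})\|^2+\|[\mathbf{f}(\bar{\mathbf{x}})]_+\|^2}\le\varepsilon$, $\sum_{i=1}^m|\bar\lambda_if_i(\bar{\mathbf{x}})|\le\varepsilon$. iPPP method: given $\bar{\mathbf{x}}^{(0)}\in\mathcal{X}$, $M^{\rm ini},\mu^{\rm ini}>0$ and sequences $\gamma_k,\beta_k,\hat\varepsilon_k>0$, set $\hat M=M^{\rm ini}$, $\hat\mu=\mu^{\rm ini}$. For $k=0,1,\dots$: let $\phi_k(\mathbf{x})=f_0(\mathbf{x})+\frac{\gamma_k}{2}\|\mathbf{x}-\bar{\mathbf{x}}^{(k)}\|^2+\frac{\beta_k}{2}\big(\|\mathbf{c}(\mathbf{x})\|^2+\|[\mathbf{f}(\mathbf{x})]_+\|^2\big)$; set $\{\bar{\mathbf{x}}^{(k+1)},\hat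 M,\hat\mu\}\gets\mathrm{AdapAPG}(\phi_k,g,\bar{\mathbf{x}}^{(k)},\hat M,\hat\mu,\hat\varepsilon_k)$; set $\bar{\mathbf{y}}^{(k+1)}=\beta_k\mathbf{c}(\bar{\mathbf{x}}^{(k+1)})$, $\bar{\boldsymbol\lambda}^{(k+1)}=\beta_k[\mathbf{f}(\bar{\mathbf{x}}^{(k+1)})]_+$; $\mathbf{S}_{k+1}=\mathrm{dist}\big(\nabla f_0(\bar{\mathbf{x}}^{(k+1)})+J_{\mathbf{f}}(\bar{\mathbf{x}}^{(k+1)})^\top\bar{\boldsymbol\lambda}^{(k+1)}+J_{\mathbf{c}}(\bar{\mathbf{x}}^{(k+1)})^\top\bar{\mathbf{y}}^{(k+1)},-\partial g(\bar{\mathbf{x}}^{(k+1)})\big)$, $\mathbf{F}_{k+1}=\sqrt{\|\mathbf{c}(\bar{\mathbf{x}}^{(k+1)})\|^2+\|[\mathbf{f}(\bar{\mathbf{x}}^{(k+1)})]_+\|^2}$, $\mathbf{C}_{k+1}=\sum_{i=1}^m|\bar\lambda_i^{(k+1)}f_i(\bar{\mathbf{x}}^{(k+1)})|$. Option I: $R_{k+1}\in\arg\min_{1\le l\le k+1}\max\{\mathbf{S}_l,\mathbf{F}_l,\mathbf{C}_l\}$. Inner solver. For $F=\phi+r$ ($\phi$ differentiable, $r$ proper lsc convex) and $L>0$ let $\psi_L(\mathbf{w};\mathbf{x})=\phi(\mathbf{w})+\nabla\phi(\mathbf{w})^\top(\mathbf{x}-\mathbf{w})+\frac L2\|\mathbf{x}-\mathbf{w}\|^2+r(\mathbf{x})$;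 a proximal gradient step is an evaluation of $T_L(\mathbf{w})=\arg\min_{\mathbf{x}}\psi_L(\mathbf{w};\mathbf{x})$; let $S_L(\mathbf{w})=\|\nabla\phi(T_L(\mathbf{w}))-\nabla\phi(\mathbf{w})\|/\|T_L(\mathbf{w})-\mathbf{w}\|$ and $\omega(\mathbf{x})=\min_{\boldsymbol\xi\in\partial r(\mathbf{x})}\|\nabla\phi(\mathbf{x})+\boldsymbol\xi\|$. Fix $\gamma_{\rm inc}>1$. LineSearch$(\phi,r,\mathbf{x}^{(t)},L_t)$: for $L=L_t,L_t\gamma_{\rm inc},L_t\gamma_{\rm inc}^2,\dots$ set $\mathbf{x}^{(t+1)}=T_L(\mathbf{x}^{(t)})$ until $F(\mathbf{x}^{(t+1)})\le\psi_L(\mathbf{x}^{(t)};\mathbf{x}^{(t+1)})$; return $\mathbf{x}^{(t+1)}$, $M_t=L$, $\mathbf{p}^{(t)}=M_t(\mathbf{x}^{(t)}-\mathbf{x}^{(t+1)})$, $S_t=S_L(\mathbf{x}^{(t)})$. AccelLineSearch$(\phi,r,\mathbf{x}^{(t)},\mathbf{x}^{(t-1)},L_t,\mu,\alpha_{t-1})$: for $L=L_t,L_t\gamma_{\rm inc},\dots$ set $\alpha_t=\sqrt{\mu/L}$, $\mathbf{w}^{(t)}=\mathbf{x}^{(t)}+\frac{\alpha_t(1-\alpha_{t-1})}{\alpha_{t-1}(1+\alpha_t)}(\mathbf{x}^{(t)}-\mathbf{x}^{(t-1)})$, $\mathbf{x}^{(t+1)}=T_L(\mathbf{w}^{(t)})$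 until $F(\mathbf{x}^{(t+1)})\le\psi_L(\mathbf{w}^{(t)};\mathbf{x}^{(t+1)})$; return $\mathbf{x}^{(t+1)}$, $M_t=L$, $\alpha_t$, $\mathbf{p}^{(t)}=M_t(\mathbf{w}^{(t)}-\mathbf{x}^{(t+1)})$, $S_t=S_L(\mathbf{w}^{(t)})$. AdapAPG$(\phi,r,\mathbf{x}^{\rm ini},L_{\rm ini},\mu_0,\hat\varepsilon)$: with constants $L_{\min}\ge\mu_0$, $\gamma_{\rm dec}\ge1$, $\gamma_{\rm sc}>1$, $\theta_{\rm sc}\in(0,1)$, get $\{\mathbf{x}^{(0)},M_{-1},\mathbf{p}^{(-1)},S_{-1}\}$ from LineSearch$(\phi,r,\mathbf{x}^{\rm ini},L_{\rm ini})$; set $\mathbf{x}^{(-1)}=\mathbf{x}^{(0)}$, $L_0=M_{-1}$, $\mu=\mu_0$, $\alpha_{-1}=1$, $\tau_0=1$, $t=0$. Repeat: call AccelLineSearch$(\phi,r,\mathbf{x}^{(t)},\mathbf{x}^{(t-1)},L_t,\mu,\alpha_{t-1})$; set $\tau_{t+1}=\tau_t(1-\alpha_t)$; if $\|\mathbf{p}^{(t)}\|\le\theta_{\rm sc}\|\mathbf{p}^{(-1)}\|$, set $\mathbf{x}^{(0)}=\mathbf{x}^{(-1)}=\mathbf{x}^{(t+1)}$, $L_0=M_t$, $\mathbf{p}^{(-1)}=\mathbf{p}^{(t)}$, $M_{-1}=M_t$, $S_{-1}=S_t$, $t=0$; else if $2\sqrt{2\tau_t}\frac{M_t}{\mu}\big(1+\frac{S_{-1}}{M_{-1}}\big)\le\theta_{\rm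 sc}$, set $\mu=\mu/\gamma_{\rm sc}$, $t=0$; else set $L_{t+1}=\max\{L_{\min},M_t/\gamma_{\rm dec}\}$, $t=t+1$. Stop when the point $\mathbf{x}^{(t+1)}$ most recently computed by AccelLineSearch satisfies $\omega(\mathbf{x}^{(t+1)})\le\hat\varepsilon$; return that point, the last $M_t$, and $\mu$. *)

(* Defs.v *)
From HB Require Import structures.
From mathcomp Require Import all_boot all_order all_algebra.
From mathcomp Require Import all_classical all_reals all_analysis.

Set Implicit Arguments.
Unset Strict Implicit.
Unset Printing Implicit Defensive.

Import Order.TTheory GRing.Theory Num.Theory.
Import numFieldNormedType.Exports.

Local Open Scope classical_set_scope.
Local Open Scope ring_scope.

Section Euclid.
Context {R : realType} {d : nat}.
Implicit Types (x y v : 'cV[R]_d) (X : set 'cV[R]_d).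

Definition dot x y : R := \sum_(i < d) x i 0 * y i 0.

(* The library norm on matrices is the sup norm; it defines the same topology
   but is not the Euclidean norm. *)
Definition enorm x : R := Num.sqrt (dot x x).

Definition grad (h : 'cV[R]_d -> R) x : 'cV[R]_d :=
  \col_(i < d) 'D_(delta_mx i 0) h x.

Definition jac m (F : 'I_m -> 'cV[R]_d -> R) x : 'M[R]_(m, d) :=
  \matrix_(i < m, j < d) 'D_(delta_mx j 0) (F i) x.

Definition C1 (h : 'cV[R]_d -> R) :=
  (forall x, differentiable h x) /\ continuous (grad h).

Definition smooth (L : R) (h : 'cV[R]_d -> R) :=
  (forall x, differentiable h x) /\
  forall x x', h x <= h x' + dot (grad h x') (x - x')
                      + L / 2 * enorm (x - x') ^+ 2.

Definition weakly_convex (rho : R) (h : 'cV[R]_d -> R) :=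
  convex_function setT (fun x => h x + rho / 2 * enorm x ^+ 2).

Definition eproper (r : 'cV[R]_d -> \bar R) :=
  (forall x, r x != -oo%E) /\ exists x, (r x < +oo)%E.

(* The library convention 0 * +oo = 0 makes the cases t = 0, 1 trivial. *)
Definition econvex (r : 'cV[R]_d -> \bar R) :=
  forall x y (t : R), 0 <= t <= 1 ->
    (r (t *: x + (1 - t) *: y)%R <= t%:E * r x + (1 - t)%R%:E * r y)%E.

Definition edom (r : 'cV[R]_d -> \bar R) : set 'cV[R]_d :=
  [set x | (r x < +oo)%E].

Definition subdiff (r : 'cV[R]_d -> \bar R) x : set 'cV[R]_d :=
  [set xi | forall z, (r x + (dot xi (z - x)%R)%:E <= r z)%E].

Definition normal_cone X x : set 'cV[R]_d :=
  [set v | forall z, X z -> dot v (z - x) <= 0].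

Definition diameter X : R :=
  sup [set enorm (xy.1 - xy.2) | xy in X `*` X].

Definition boundary X : set 'cV[R]_d := closure X `\` X°.

Definition dist x X : R := inf [set enorm (x - y) | y in X].

End Euclid.

Definition lambda_max {R : realType} {n : nat} (S : 'M[R]_n) : R :=
  sup [set a | eigenvalue S a].

Definition lambda_min {R : realType} {n : nat} (S : 'M[R]_n) : R :=
  inf [set a | eigenvalue S a].

Record problem (R : realType) (d n m : nat) := Problem {
  f0 : 'cV[R]_d -> R;
  fc : 'I_m -> 'cV[R]_d -> R;
  g : 'cV[R]_d -> \bar R;
  A : 'M[R]_(n, d);
  b : 'cV[R]_n }.

Section Problem.
Context {R : realType} {d n m : nat} (P : problem R d n m).
Implicit Types (x xi : 'cV[R]_d) (lam : 'cV[R]_m) (y : 'cV[R]_n).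

Definition dom_g := edom (g P).

Definition cons_eq x : 'cV[R]_n := A P *m x - b P.

Definition cons_plus x : 'cV[R]_m := \col_(i < m) Num.max 0 (fc P i x).

Definition well_posed :=
  [/\ C1 (f0 P), (forall i, C1 (fc P i)),
      [/\ eproper (g P), lower_semicontinuous (g P) & econvex (g P)]
    & row_free (A P)].

Definition general_assumptions (Lf0 : R) (Lf : 'I_m -> R) (G M : R) :=
  [/\ smooth Lf0 (f0 P) /\ (forall i, smooth (Lf i) (fc P i)),
      compact dom_g
    & forall x, dom_g x ->
        [/\ (`|g P x| <= G%:E)%E, subdiff (g P) x !=set0
          & subdiff (g P) x `<=`
              [set u + v | u in normal_cone dom_g x & v in [set v | enorm v <= M]]]].

Definition data_bounds (Bf0 : R) (Bf : 'I_m -> R) :=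
  forall x, dom_g x ->
    Num.max `|f0 P x| (enorm (grad (f0 P) x)) <= Bf0 /\
    forall i, Num.max `|fc P i x| (enorm (grad (fc P i) x)) <= Bf i.

Definition convex_constraint_assumptions (rho0 : R) (xfeas : 'cV[R]_d) :=
  [/\ 0 <= rho0 /\ weakly_convex rho0 (f0 P),
      (forall i, convex_function setT (fc P i))
    & [/\ (dom_g° : set _) xfeas, A P *m xfeas = b P
        & forall i, fc P i xfeas < 0]].

(* For m = 0 (resp. n = 0) the conventions inf set0 = sup set0 = 0 and x / 0 = 0
   make Mlam (resp. My below) equal to 0, the bound for an empty multiplier. *)
Definition min_slack xfeas : R := inf (range (fun i : 'I_m => `|fc P i xfeas|)).

Definition Qconst (Bf0 M gam : R) : R :=
  diameter dom_g * (Bf0 + gam * diameter dom_g + M).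

Definition Mlam (Bf0 M : R) xfeas (gam : R) : R :=
  Qconst Bf0 M gam / min_slack xfeas.

Definition My (Bf0 : R) (Bf : 'I_m -> R) (M : R) xfeas (gam : R) : R :=
  Qconst Bf0 M gam * Num.sqrt (lambda_max (A P *m (A P)^T))
    / lambda_min (A P *m (A P)^T)
  * ((diameter dom_g)^-1 + (dist xfeas (boundary dom_g))^-1
     + sup (range Bf) / min_slack xfeas).

Definition lagr_grad x lam y : 'cV[R]_d :=
  grad (f0 P) x + (jac (fc P) x)^T *m lam + (A P)^T *m y.

Definition infeas x : R :=
  Num.sqrt (enorm (cons_eq x) ^+ 2 + enorm (cons_plus x) ^+ 2).

Definition compl x lam : R := \sum_(i < m) `|lam i 0 * fc P i x|.

Definition stationary (eps : R) x :=
  exists xi lam y,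
    [/\ subdiff (g P) x xi,
        (forall i, 0 <= lam i 0) /\ (forall i, fc P i x < 0 -> lam i 0 = 0),
        enorm (lagr_grad x lam y + xi) <= eps,
        infeas x <= eps
      & compl x lam <= eps].

End Problem.

Record apg_params (R : realType) := ApgParams {
  gam_inc : R; gam_dec : R; gam_sc : R; th_sc : R; L_min : R }.

Definition apg_params_ok (R : realType) (prm : apg_params R) :=
  [/\ 1 < gam_inc prm, 1 <= gam_dec prm, 1 < gam_sc prm & 0 < th_sc prm < 1].

(* Base data of the current stage (x^(0), L_0, p^(-1), M_{-1}, S_{-1}), the
   estimate mu, and the loop variables at the current t:
   x^(t), x^(t-1), L_t, alpha_{t-1}, tau_t. *)
Record apg_state (R : realType) (d : nat) := ApgState {
  st_x0 : 'cV[R]_d; st_L0 : R; st_p0 : 'cV[R]_d; st_M0 : R; st_S0 : R;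
  st_mu : R;
  st_x : 'cV[R]_d; st_xp : 'cV[R]_d; st_L : R; st_al : R; st_tau : R }.

Section AdapAPG.
Context {R : realType} {d : nat}.
Variables (prm : apg_params R) (phi : 'cV[R]_d -> R) (r : 'cV[R]_d -> \bar R).
Implicit Types (x w p : 'cV[R]_d) (L mu al : R) (st : apg_state R d).

Definition psi L w x : \bar R :=
  ((phi w + dot (grad phi w) (x - w) + L / 2 * enorm (x - w) ^+ 2)%:E + r x)%E.

(* The minimizer of psi L w, chosen by the library's choice operator (the
   minimizer exists and is unique when r is proper, lsc and convex and L > 0). *)
Definition prox_step L w : 'cV[R]_d :=
  xget 0 [set x | forall z, (psi L w x <= psi L w z)%E].

(* Division by zero yields 0, so the ratio is 0 when prox_step L w = w. *)
Definition Sratio L w : R :=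
  enorm (grad phi (prox_step L w) - grad phi w) / enorm (prox_step L w - w).

(* The infimum is over a nonempty set whenever r is subdifferentiable at x. *)
Definition omega x : R :=
  inf [set enorm (grad phi x + xi) | xi in subdiff r x].

Definition decrease_ok L w :=
  ((phi (prox_step L w))%:E + r (prox_step L w) <= psi L w (prox_step L w))%E.

Definition trial L (j : nat) : R := L * gam_inc prm ^+ j.

(* A search with trial values L, L gam_inc, L gam_inc^2, ... ends with the trial
   of index j; it evaluates the proximal gradient step j.+1 times. *)
Definition first_accepted (acc : R -> Prop) L (j : nat) :=
  acc (trial L j) /\ forall i, (i < j)%N -> ~ acc (trial L i).

Definition line_search x L (j : nat) :=
  first_accepted (fun L' => decrease_ok L' x) L j.

Definition accel_alpha st L : R := Num.sqrt (st_mu st / L).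

Definition accel_w st L : 'cV[R]_d :=
  let al := accel_alpha st L in
  st_x st + (al * (1 - st_al st) / (st_al st * (1 + al))) *: (st_x st - st_xp st).

Definition accel_line_search st (j : nat) :=
  first_accepted (fun L => decrease_ok L (accel_w st L)) (st_L st) j.

Definition stage_start x0 L0 p0 M0 S0 mu : apg_state R d :=
  ApgState x0 L0 p0 M0 S0 mu x0 x0 L0 1 1.

Definition accel_M st j : R := trial (st_L st) j.

Definition accel_x st j : 'cV[R]_d :=
  prox_step (accel_M st j) (accel_w st (accel_M st j)).

(* The state after one pass through the loop body in which the accelerated line
   search accepted its trial of index j. Num.sqrt vanishes on negative numbers;
   tau_t < 0 can only arise when the first accepted L of a stage is below mu. *)
Definition apg_next st (j : nat) : apg_state R d :=
  let Mt := accel_M st j in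
  let al := accel_alpha st Mt in
  let w := accel_w st Mt in
  let x' := accel_x st j in
  let p := Mt *: (w - x') in
  let S := Sratio Mt w in
  if enorm p <= th_sc prm * enorm (st_p0 st) then
    stage_start x' Mt p Mt S (st_mu st)
  else if 2 * Num.sqrt (2 * st_tau st) * (Mt / st_mu st)
            * (1 + st_S0 st / st_M0 st) <= th_sc prm then
    stage_start (st_x0 st) (st_L0 st) (st_p0 st) (st_M0 st) (st_S0 st)
      (st_mu st / gam_sc prm)
  else
    ApgState (st_x0 st) (st_L0 st) (st_p0 st) (st_M0 st) (st_S0 st) (st_mu st)
      x' (st_x st) (Num.max (L_min prm) (Mt / gam_dec prm)) al
      (st_tau st * (1 - al)).

(* apg_loop epsh st x L mu c: from state st the loop terminates, returns the
   point x, the last accepted L and mu, and evaluates c proximal gradient steps.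
   The stopping test is made at the end of the loop body, after mu is updated.
   The relation is inductive, so that it holds only of terminating executions. *)
Inductive apg_loop (epsh : R) :
    apg_state R d -> 'cV[R]_d -> R -> R -> nat -> Prop :=
| apg_stop st j :
    accel_line_search st j -> omega (accel_x st j) <= epsh ->
    apg_loop epsh st (accel_x st j) (accel_M st j) (st_mu (apg_next st j)) j.+1
| apg_continue st j x L mu c :
    accel_line_search st j -> epsh < omega (accel_x st j) ->
    apg_loop epsh (apg_next st j) x L mu c ->
    apg_loop epsh st x L mu (j.+1 + c)%N.

Definition apg_init xini M0 mu0 : apg_state R d :=
  let x0 := prox_step M0 xini in
  stage_start x0 M0 (M0 *: (xini - x0)) M0 (Sratio M0 xini) mu0.

Definition adap_apg xini Lini mu0 epsh x L mu (cost : nat) :=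
  exists j c, [/\ line_search xini Lini j,
                  apg_loop epsh (apg_init xini (trial Lini j) mu0) x L mu c
                & cost = (j.+1 + c)%N].

End AdapAPG.

(* xbar k, Mhat k, muhat k are the values at the start of iteration k; nprox k is
   the number of proximal gradient steps of the k-th inner call; Rsel k is R_k. *)
Record ippp_trace (R : realType) (d : nat) := IpppTrace {
  xbar : nat -> 'cV[R]_d; Mhat : nat -> R; muhat : nat -> R;
  nprox : nat -> nat; Rsel : nat -> nat }.

Section Ippp.
Context {R : realType} {d n m : nat} (P : problem R d n m) (prm : apg_params R).
Variables (x0 : 'cV[R]_d) (Mini muini : R) (gam beta epsh : nat -> R).
Implicit Types (tr : ippp_trace R d).

Definition ippp_phi tr k (x : 'cV[R]_d) : R :=
  f0 P x + gam k / 2 * enorm (x - xbar tr k) ^+ 2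
  + beta k / 2 * (enorm (cons_eq P x) ^+ 2 + enorm (cons_plus P x) ^+ 2).

Definition ybar tr k : 'cV[R]_n := beta k.-1 *: cons_eq P (xbar tr k).

Definition lambar tr k : 'cV[R]_m := beta k.-1 *: cons_plus P (xbar tr k).

Definition Sres tr k : R :=
  dist (lagr_grad P (xbar tr k) (lambar tr k) (ybar tr k))
       [set - xi | xi in subdiff (g P) (xbar tr k)].

Definition Fres tr k : R := infeas P (xbar tr k).

Definition Cres tr k : R := compl P (xbar tr k) (lambar tr k).

Definition residual tr k : R :=
  Num.max (Sres tr k) (Num.max (Fres tr k) (Cres tr k)).

Definition ippp_run tr :=
  [/\ [/\ xbar tr 0%N = x0, Mhat tr 0%N = Mini & muhat tr 0%N = muini],
      (forall k, adap_apg prm (ippp_phi tr k) (g P)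
         (xbar tr k) (Mhat tr k) (muhat tr k) (epsh k)
         (xbar tr k.+1) (Mhat tr k.+1) (muhat tr k.+1) (nprox tr k))
    & forall k, (1 <= Rsel tr k.+1 <= k.+1)%N /\
        forall l, (1 <= l <= k.+1)%N ->
          residual tr (Rsel tr k.+1) <= residual tr l].

End Ippp.

Section Constants.
Context {R : realType} {d n m : nat} (P : problem R d n m).
Variables (Bf0 : R) (Bf : 'I_m -> R) (G M : R) (xfeas x0 : 'cV[R]_d).
Variables (gam beta : R).

Local Notation D := (diameter (dom_g P)).
Local Notation Myg := (My P Bf0 Bf M xfeas gam).
Local Notation Mlg := (Mlam P Bf0 M xfeas gam).

Definition calC1 : R :=
  2 * Bf0 + 2 * G + beta / 2 * enorm (A P *m x0 - b P) ^+ 2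
  + beta / 2 * enorm (cons_plus P x0) ^+ 2
  + 3 / beta * (2 * D + Myg ^+ 2 + Mlg ^+ 2).

Definition Kbound (eps : R) : R :=
  Num.max (6 / (beta * eps))
    (4 / eps ^+ 2 *
      (Num.sqrt (2 * gam * calC1)
       + 4 * Num.sqrt (D + Myg ^+ 2 + Mlg ^+ 2) / beta
       + 8 * (D + Myg ^+ 2 + Mlg ^+ 2) / beta) ^+ 2).

(* Kbound eps > 0 for eps > 0, so the absolute value only casts int to nat. *)
Definition Kiter (eps : R) : nat := absz (Num.ceil (Kbound eps)).

End Constants.

(* T(eps) is O~(eps^(-a)) as eps -> 0+. *)
Definition soft_bigO {R : realType} (T : R -> R) (a : R) :=
  exists p : nat, T =O_ (0^'+) (fun eps : R => eps `^ (- a) * ln eps^-1 ^+ p).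

(* Main.v *)
Require Import Defs.
From mathcomp Require Import all_boot all_order all_algebra.
From mathcomp Require Import all_classical all_reals all_analysis.
From mathcomp Require Import ring lra.
Set Implicit Arguments.
Unset Strict Implicit.
Unset Printing Implicit Defensive.
Import Order.TTheory GRing.Theory Num.Theory.
Import numFieldNormedType.Exports.
Local Open Scope classical_set_scope.
Local Open Scope ring_scope.

(** Write phi_k for the k-th penalized objective, F(x) for the infeasibility
    measure and V for the square root of M_y^2 + M_lambda^2. Three facts carry
    the proof.

    Bounded multipliers. Freeze a centre x_k and let z minimize phi_k + g with
    the weight beta_k replaced by an arbitrary B. The vectors B c(z) and
    B [f(z)]_+ act as multipliers at z. Testing the optimality condition of z
    against the Slater point bounds them by M_y and M_lambda, uniformly in B
    ([y_bound], [lam_bound]); the bound on B c(z) also needs a bound on normal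
    vectors ([normal_cone_bound]) and the smallest eigenvalue of A A^T
    ([adjoint_lower_bound]). Weak duality with these multipliers, followed by
    B -> +oo, shows that every e-minimizer x of phi_k + g satisfies
    beta_k / 2 * F(x)^2 <= V * F(x) + e ([approx_infeas]). No multiplier of the
    constrained problem itself has to exist. The accuracy of the inner solver
    makes beta_k * e at most D / (k + 1), so F(x_(k+1)) = O(1 / beta_k)
    ([infeas_decay]).

    Descent. Comparing x_(k+1) with x_k in phi_k gives a decrease of f0 + g of
    gamma / 2 * |x_(k+1) - x_k|^2, up to the accuracy and to the increments
    (beta_(k+1) - beta_k) * F(x_(k+1))^2 = O(k^(-3/2)), which are summable. Hence
    the squared steps have sum at most 2 C_1 / gamma ([step_sum_sqr]). By
    Cauchy-Schwarz the sum of the first K residuals is O(sqrt K), so the smallest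
    one is below epsilon once K is of order epsilon^(-2) ([best_residual_lt]).

    Inner complexity. Since gamma > rho_0, phi_k is strongly convex with a modulus
    independent of k, while its curvature L_k is of order sqrt k. An accelerated
    step contracts a potential by the factor 1 - sqrt (mu / L_k)
    ([potential_decrease]), so a stage has at most
    O(sqrt L_k * log k) = O(k^(1/4) * log k) steps, and there are O(log k) stages.
    Summing k^(1/4) over K = O(epsilon^(-2)) calls gives epsilon^(-5/2) up to
    logarithms ([inner_calls], [soft_bigO_cost]). Two points need care. The
    gradient of [f]_+^2 need not be globally Lipschitz, so smoothness is used only
    between the bounded extrapolations that the line search can visit and dom g
    ([penalty_smooth_on]). And the contraction holds only while mu is at most the
    modulus of strong convexity; mu is divided by gam_sc only when it exceeds that
    modulus ([reduction_mu]), which bounds the number of reductions. *)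

(** * Euclidean space and gradients *)

Section EuclideanSpace.
Context {R : realType} {d : nat}.
Implicit Types (x y z v w : 'cV[R]_d) (a : R).

Lemma dotC x y : dot x y = dot y x.
Proof. by apply: eq_bigr => i _; rewrite mulrC. Qed.

Lemma dotDl x y z : dot (x + y) z = dot x z + dot y z.
Proof. by rewrite -big_split; apply: eq_bigr => i _; rewrite mxE mulrDl. Qed.

Lemma dotZl a x y : dot (a *: x) y = a * dot x y.
Proof. by rewrite mulr_sumr; apply: eq_bigr => i _; rewrite mxE mulrA. Qed.

Lemma dotDr x y z : dot z (x + y) = dot z x + dot z y.
Proof. by rewrite dotC dotDl !(dotC z). Qed.

Lemma dotZr a x y : dot x (a *: y) = a * dot x y.
Proof. by rewrite dotC dotZl dotC. Qed.

Lemma dotNl x y : dot (- x) y = - dot x y.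
Proof. by rewrite -scaleN1r dotZl mulN1r. Qed.

Lemma dotNr x y : dot x (- y) = - dot x y.
Proof. by rewrite dotC dotNl dotC. Qed.

Lemma dotBl x y z : dot (x - y) z = dot x z - dot y z.
Proof. by rewrite dotDl dotNl. Qed.

Lemma dotBr x y z : dot z (x - y) = dot z x - dot z y.
Proof. by rewrite dotDr dotNr. Qed.

Lemma dot0l x : dot 0 x = 0.
Proof. by rewrite -(scale0r 0) dotZl mul0r. Qed.

Lemma dot0r x : dot x 0 = 0.
Proof. by rewrite dotC dot0l. Qed.

Definition dotE := (dotDl, dotDr, dotNl, dotNr, dotZl, dotZr, dot0l, dot0r).

Lemma dot_suml I (r : seq I) (p : pred I) (F : I -> 'cV[R]_d) x :
  dot (\sum_(i <- r | p i) F i) x = \sum_(i <- r | p i) dot (F i) x.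
Proof.
by elim/big_rec2 : _ => [|i u v _ <-]; rewrite ?dot0l ?dotDl.
Qed.

Lemma dot_ge0 x : 0 <= dot x x.
Proof. by apply: sumr_ge0 => i _; rewrite -expr2 sqr_ge0. Qed.

Lemma enorm_ge0 x : 0 <= enorm x.
Proof. exact: sqrtr_ge0. Qed.

Lemma enorm_sqr x : enorm x ^+ 2 = dot x x.
Proof. by rewrite sqr_sqrtr // dot_ge0. Qed.

Lemma dot_eq0 x : dot x x = 0 -> x = 0.
Proof.
move=> /eqP; rewrite psumr_eq0 => [/allP h|i _]; last by rewrite -expr2 sqr_ge0.
apply/colP => i; rewrite mxE; apply/eqP.
by have := h i (mem_index_enum i); rewrite mulf_eq0 orbb.
Qed.

Lemma enorm_eq0 x : enorm x = 0 -> x = 0.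
Proof. by move=> h; apply: dot_eq0; rewrite -enorm_sqr h expr0n. Qed.

Lemma enorm0 : enorm (0 : 'cV[R]_d) = 0.
Proof. by rewrite /enorm dot0l sqrtr0. Qed.

Lemma enormZ a x : enorm (a *: x) = `|a| * enorm x.
Proof. by rewrite /enorm !dotE mulrA -expr2 sqrtrM ?sqr_ge0// sqrtr_sqr. Qed.

Lemma enormN x : enorm (- x) = enorm x.
Proof. by rewrite -scaleN1r enormZ normrN1 mul1r. Qed.

Lemma enorm_distC x y : enorm (x - y) = enorm (y - x).
Proof. by rewrite -enormN opprB. Qed.

Lemma Cauchy_Schwarz x y : dot x y <= enorm x * enorm y.
Proof.
have [/enorm_eq0 ->|y0] := eqVneq (enorm y) 0; first by rewrite dot0r enorm0 mulr0.
have h := dot_ge0 (enorm y ^+ 2 *: x - dot x y *: y).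
rewrite leNgt; apply/negP => lt.
have yp : 0 < enorm y by rewrite lt_neqAle eq_sym y0 enorm_ge0.
have x0 := enorm_ge0 x.
have lt2 : (enorm x * enorm y) ^+ 2 < dot x y ^+ 2.
  rewrite ltr_pXn2r// nnegrE; first by rewrite mulr_ge0// ltW.
  by rewrite (le_trans _ (ltW lt))// mulr_ge0// ltW.
move: h; rewrite !dotE (dotC y x) -!enorm_sqr.
rewrite [X in 0 <= X -> _](_ : _ = enorm y ^+ 2 * ((enorm x * enorm y) ^+ 2 - dot x y ^+ 2)).
  by rewrite pmulr_rge0 ?exprn_gt0// subr_ge0 leNgt lt2.
by ring.
Qed.

Lemma Cauchy_Schwarz_abs x y : `|dot x y| <= enorm x * enorm y.
Proof.
rewrite ler_norml Cauchy_Schwarz andbT lerNl -dotNl -[enorm x]enormN.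
exact: Cauchy_Schwarz.
Qed.

Lemma enorm_sqrD x y : enorm (x + y) ^+ 2 = enorm x ^+ 2 + 2 * dot x y + enorm y ^+ 2.
Proof. by rewrite !enorm_sqr !dotE (dotC y x); ring. Qed.

Lemma ler_enormD x y : enorm (x + y) <= enorm x + enorm y.
Proof.
rewrite -(@ler_pXn2r _ 2)// ?nnegrE ?addr_ge0 ?enorm_ge0// enorm_sqrD sqrrD.
by have := Cauchy_Schwarz x y; lra.
Qed.

Lemma ler_enormB x y : enorm (x - y) <= enorm x + enorm y.
Proof. by rewrite -[enorm y]enormN ler_enormD. Qed.

Lemma ler_enorm_dist z x y : enorm (x - y) <= enorm (x - z) + enorm (z - y).
Proof. by rewrite -[x - y](subrKA z) ler_enormD. Qed.

Lemma ler_enorm_sum I (r : seq I) (p : pred I) (F : I -> 'cV[R]_d) :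
  enorm (\sum_(i <- r | p i) F i) <= \sum_(i <- r | p i) enorm (F i).
Proof.
elim/big_rec2 : _ => [|i u v _ h]; first by rewrite enorm0.
by apply: le_trans (ler_enormD _ _) _; rewrite lerD2l.
Qed.

Lemma coord_enorm x i : `|x i 0| <= enorm x.
Proof.
rewrite -(@ler_pXn2r _ 2)// ?nnegrE ?enorm_ge0// enorm_sqr real_normK ?num_real//.
rewrite /dot (bigD1 i)//= -expr2 lerDl.
by apply: sumr_ge0 => j _; rewrite -expr2 sqr_ge0.
Qed.

Lemma mx_norm_le_enorm x : `|x| <= enorm x.
Proof.
rewrite [leLHS]/Num.Def.normr /= mx_normrE; apply/bigmax_leP; split; first exact: enorm_ge0.
by move=> [i j] _ /=; rewrite ord1 coord_enorm.
Qed.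

Lemma enorm_le_mx_norm x : enorm x <= d%:R * `|x|.
Proof.
have coord i : `|x i 0| <= `|x|.
  by rewrite [leRHS]/Num.Def.normr /= mx_normrE; apply/bigmax_geP; right; exists (i, 0).
rewrite -(@ler_pXn2r _ 2)// ?nnegrE ?enorm_ge0// ?mulr_ge0// enorm_sqr.
apply: (@le_trans _ _ (\sum_(i < d) `|x| ^+ 2)).
  apply: ler_sum => i _; rewrite -expr2 -(real_normK (num_real (x i 0))).
  by rewrite ler_pXn2r// nnegrE.
rewrite sumr_const card_ord exprMn -[leLHS]mulr_natl ler_wpM2r ?sqr_ge0//.
by rewrite -natrX ler_nat; case: (d) => // k; rewrite expnS expn1 leq_pmulr.
Qed.

(** The library topology on column vectors is that of the sup norm, which is
    equivalent to the Euclidean norm; neighbourhoods are converted here once. *)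
Lemma nbhs_enormP x (U : set 'cV[R]_d) :
  nbhs x U <-> exists2 e, 0 < e & forall y, enorm (y - x) < e -> U y.
Proof.
split=> [/nbhs_ballP[e /= e0 eU]|[e e0 eU]].
  exists e => // y yx; apply: eU; rewrite -ball_normE /= distrC.
  exact: le_lt_trans (mx_norm_le_enorm _) yx.
apply/nbhs_ballP; exists (e / (d%:R + 1)); first by rewrite /= divr_gt0// ltr_wpDl.
move=> y; rewrite -ball_normE /= distrC => yx; apply: eU.
apply: le_lt_trans (enorm_le_mx_norm _) _.
have d1 : 0 < d%:R + 1 :> R by rewrite ltr_wpDl.
apply: (@le_lt_trans _ _ ((d%:R + 1) * `|y - x|)).
  by rewrite ler_wpM2r// lerDl.
by rewrite mulrC -ltr_pdivlMr.
Qed.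

Lemma dot_trmx (m : nat) (B : 'M[R]_(m, d)) (u : 'cV[R]_m) x :
  dot (B^T *m u) x = dot u (B *m x).
Proof.
rewrite /dot; under eq_bigr => i _ do rewrite mxE mulr_suml.
rewrite exchange_big /=; apply: eq_bigr => j _; rewrite mxE mulr_sumr.
by apply: eq_bigr => i _; rewrite mxE; ring.
Qed.

End EuclideanSpace.

(** Cauchy-Schwarz row by row; only the existence of a constant matters here. *)
Lemma enorm_mulmx (R : realType) (d m : nat) (B : 'M[R]_(m, d)) :
  exists2 c, 0 <= c & forall x : 'cV[R]_d, enorm (B *m x) <= c * enorm x.
Proof.
exists (\sum_(i < m) enorm (row i B)^T) => [|x]; first by apply: sumr_ge0 => i _; exact: enorm_ge0.
have -> : B *m x = \sum_i dot (row i B)^T x *: delta_mx i 0.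
  apply/colP => j; rewrite summxE (bigD1 j)//= !mxE !eqxx mulr1 [X in _ + X]big1 ?addr0.
    by apply: eq_bigr => i _; rewrite !mxE.
  by move=> i ij; rewrite !mxE eq_sym (negbTE ij) mulr0.
apply: le_trans (ler_enorm_sum _ _ _) _; rewrite mulr_suml; apply: ler_sum => i _.
rewrite enormZ [X in _ * X](_ : _ = 1) ?mulr1; first exact: Cauchy_Schwarz_abs.
rewrite /enorm /dot (bigD1 i)//= !mxE !eqxx mulr1 big1 ?addr0 ?sqrtr1// => j ij.
by rewrite !mxE (negbTE ij) mulr0.
Qed.

Section QuadraticGradient.
Context {R : realType} {d : nat}.
Implicit Types (x y z v w : 'cV[R]_d) (h : 'cV[R]_d -> R).

(** Second-order expansion at x. It is enough to identify the partial derivatives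
    that make up [grad], and unlike differentiability it is inherited in one line
    by the squared positive part of a smooth function. *)
Definition quad_grad h x (q : 'cV[R]_d) :=
  exists C, forall v, enorm v <= 1 -> `|h (x + v) - h x - dot q v| <= C * enorm v ^+ 2.

Lemma quad_grad_derive h x q v : quad_grad h x q -> 'D_v h x = dot q v.
Proof.
move=> [C hC]; apply: (@cvg_lim R) => //; apply/cvgrPdist_le => /= e e0.
set c := `|C| * enorm v ^+ 2.
have c0 : 0 <= c by rewrite mulr_ge0 ?sqr_ge0.
have v0 := enorm_ge0 v.
pose del := Num.min (e / (c + 1)) (enorm v + 1)^-1.
have del0 : 0 < del.
  by rewrite lt_min divr_gt0 ?invr_gt0 ?ltr_wpDl.
exists del => //= t; rewrite /ball_ /= sub0r normrN => tdel t0.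
have tv : `|t| * enorm v <= 1.
  move: tdel; rewrite lt_min => /andP[_ tv].
  have := ltW tv; rewrite -[_^-1]mul1r ler_pdivlMr ?ltr_wpDl//; have := normr_ge0 t; nra.
have c1 : 0 < c + 1 by rewrite ltr_wpDl.
have te : `|t| * c <= e.
  have /ltW te : `|t| < e / (c + 1) by apply: lt_le_trans tdel _; rewrite ge_min lexx.
  have te2 : `|t| * (c + 1) <= e by rewrite -ler_pdivlMr.
  by apply: le_trans te2; rewrite ler_wpM2l// lerDl.
have /= := hC (t *: v); rewrite !enormZ => /(_ tv); rewrite dotZr => H.
have -> : dot q v - t^-1 *: (h (t *: v + x) - h x) = - (t^-1 * (h (x + t *: v) - h x - t * dot q v)).
  by rewrite /GRing.scale /= [t *: v + x]addrC; field.
rewrite normrN normrM normfV ler_pdivrMl ?normr_gt0//.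
apply: le_trans H _; rewrite exprMn mulrCA expr2 -mulrA ler_wpM2l//.
by apply: le_trans te; rewrite ler_wpM2l// ler_wpM2r ?sqr_ge0// ler_norm.
Qed.

Lemma quad_grad_grad h x q : quad_grad h x q -> grad h x = q.
Proof.
move=> hq; apply/colP => i; rewrite mxE (quad_grad_derive _ hq) dotC.
rewrite /dot (bigD1 i)//= !mxE !eqxx mul1r big1 ?addr0// => j ij.
by rewrite !mxE (negbTE ij) mul0r.
Qed.

Lemma differentiable_derive h x v : differentiable h x -> 'D_v h x = dot (grad h x) v.
Proof.
move=> dh; rewrite deriveE//.
have {1}-> : v = \sum_i v i 0 *: delta_mx i 0.
  apply/colP => j; rewrite summxE (bigD1 j)//= !mxE !eqxx mulr1 big1 ?addr0// => i ij.
  by rewrite !mxE eq_sym (negbTE ij) mulr0.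
rewrite linear_sum; apply: eq_bigr => i _.
by rewrite linearZ /= mxE deriveE// mulrC.
Qed.

End QuadraticGradient.

(** * Quadratic bounds and proximal steps *)

Section QuadraticBounds.
Context {R : realType} {d : nat}.
Implicit Types (x y z v w : 'cV[R]_d) (h : 'cV[R]_d -> R) (q : 'cV[R]_d -> 'cV[R]_d)
  (mu L rho t C : R).

Definition lower_quad (mu : R) h q :=
  forall x z, h x + dot (q x) (z - x) + mu / 2 * enorm (z - x) ^+ 2 <= h z.

Definition upper_quad (L : R) h q :=
  forall x z, h z <= h x + dot (q x) (z - x) + L / 2 * enorm (z - x) ^+ 2.

Lemma lower_quad_le mu mu' h q : mu' <= mu -> lower_quad mu h q -> lower_quad mu' h q.
Proof.
move=> le hl x z; apply: le_trans (hl x z); rewrite lerD2l.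
by have := sqr_ge0 (enorm (z - x)); nra.
Qed.

Lemma upper_quad_le L L' h q : L <= L' -> upper_quad L h q -> upper_quad L' h q.
Proof.
move=> le hu x z; apply: le_trans (hu x z) _; rewrite lerD2l.
by have := sqr_ge0 (enorm (z - x)); nra.
Qed.

Lemma quad_grad_bounds mu L h q x :
  lower_quad mu h q -> upper_quad L h q -> quad_grad h x (q x).
Proof.
move=> hl hu; exists (`|mu| + `|L|) => v _.
have := hl x (x + v); have := hu x (x + v).
rewrite (addrC x v) addrK => u l.
have v0 := sqr_ge0 (enorm v).
have := ler_norm (- mu); have := ler_norm L.
have := normr_ge0 mu; have := normr_ge0 L; rewrite normrN => a b c e.
by rewrite ler_norml; apply/andP; split; nra.
Qed.

(** A chord inequality, divided by t, turns into a tangent inequality as t -> 0;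
    the error rho / 2 * t * enorm (z - x) ^+ 2 left by the quadratic term vanishes. *)
Lemma chord_lower_quad rho h :
  (forall x, differentiable h x) ->
  (forall x z t, 0 <= t <= 1 ->
     h (x + t *: (z - x)) <= h x + t * (h z - h x)
       + rho / 2 * (t * (1 - t)) * enorm (z - x) ^+ 2) ->
  lower_quad (- rho) h (grad h).
Proof.
move=> dh ch x z; rewrite -differentiable_derive//.
set v := z - x; set D := 'D_v h x.
suff : D <= h z - h x + `|rho| / 2 * 0 + rho / 2 * enorm v ^+ 2 by lra.
have /(@derivableP _ _ _ _ _ _) : derivable h x v by exact: diff_derivable.
move=> [/[swap] _ dv].
have {}dv : (fun t : R => t^-1 *: ((h \o shift x) (t *: v) - h x)) @ 0^' --> D by [].
apply/ler_addgt0Pr => e e0.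
have c0 : 0 <= `|rho| / 2 * enorm v ^+ 2 by rewrite mulr_ge0 ?sqr_ge0 ?divr_ge0.
set c := `|rho| / 2 * enorm v ^+ 2 in c0.
move/cvgrPdist_le : dv => /(_ (e / 2) (divr_gt0 e0 (ltr0Sn _ 1))) [del /= del0 hdel].
pose t := Num.min (Num.min (del / 2) 1) (e / 2 / (c + 1)).
have c1 : 0 < c + 1 by rewrite ltr_wpDl.
have t0 : 0 < t by rewrite !lt_min !divr_gt0//= ltr01.
have tdel : t < del.
  rewrite /t !gt_min; apply/orP; left; apply/orP; left; lra.
have t1 : t <= 1 by rewrite !ge_min lexx orbT.
have tc : t * c <= e / 2.
  have : t * (c + 1) <= e / 2 by rewrite -ler_pdivlMr// ge_min lexx orbT.
  by nra.
have := hdel t; rewrite /ball_ /= sub0r normrN gtr0_norm// => /(_ tdel (lt0r_neq0 t0)).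
rewrite ler_norml => /andP[_ ub].
have := ch x z t; rewrite t1 ltW// => /(_ isT).
rewrite -/v [x + _]addrC => cht.
have ub2 : t^-1 *: (h (t *: v + x) - h x) <= h z - h x + rho / 2 * (1 - t) * enorm v ^+ 2.
  rewrite /GRing.scale /= ler_pdivrMl//.
  have E : t * (h z - h x + rho / 2 * (1 - t) * enorm v ^+ 2) =
    t * (h z - h x) + rho / 2 * (t * (1 - t)) * enorm v ^+ 2 by ring.
  by rewrite E; lra.
have : - (rho / 2 * t * enorm v ^+ 2) <= t * c.
  rewrite /c; have := ler_norm (- rho); rewrite normrN; have := sqr_ge0 (enorm v) => a b.
  have rr : 0 <= `|rho| + rho by lra.
  have : 0 <= t * (`|rho| + rho) * enorm v ^+ 2.
    by apply: mulr_ge0 => //; apply: mulr_ge0 => //; exact: ltW.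
  by nra.
by lra.
Qed.

Lemma convex_functionE h x z t : convex_function setT h -> 0 <= t <= 1 ->
  h (x + t *: (z - x)) <= h x + t * (h z - h x).
Proof.
move=> ch /andP[t0 t1].
have := ch (Itv01 t0 t1) z x; rewrite !inE => /(_ Logic.I Logic.I).
rewrite /conv /=.
rewrite [X in h X](_ : _ = x + t *: (z - x)); last first.
  by apply/colP => i; rewrite !mxE /= /unstable.onem; ring.
move=> H; have {}H : h (x + t *: (z - x)) <= t * h z + (1 - t) * h x := H.
by apply: le_trans H _; lra.
Qed.

Lemma convex_lower_quad h :
  (forall x, differentiable h x) -> convex_function setT h -> lower_quad 0 h (grad h).
Proof.
move=> dh ch; rewrite -oppr0; apply: chord_lower_quad => // x z t t01.
by rewrite mul0r !mul0r addr0 convex_functionE.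
Qed.

(** Adding rho / 2 * enorm x ^+ 2 turns the convexity chord into a chord for h
    with a quadratic error, since t * z^2 + (1 - t) * x^2 exceeds the square of the
    mean by t * (1 - t) * (z - x)^2. *)
Lemma weakly_convex_lower_quad rho h :
  (forall x, differentiable h x) -> weakly_convex rho h -> lower_quad (- rho) h (grad h).
Proof.
move=> dh ch; apply: chord_lower_quad => // x z t t01.
have /= := convex_functionE x z ch t01.
have -> : enorm z ^+ 2 = enorm x ^+ 2 + 2 * dot x (z - x) + enorm (z - x) ^+ 2.
  by rewrite -enorm_sqrD addrC subrK.
rewrite enorm_sqrD enormZ exprMn real_normK ?num_real// dotZr.
by move: (enorm _) (enorm _) (dot _ _) => a b c; lra.
Qed.

(** Baillon-Haddad: minimizing the upper bound at y along q y - q x and comparing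
    with the tangent at x gains (2 L)^-1 times the squared gradient gap. The two
    symmetric inequalities add up to cocoercivity, and Cauchy-Schwarz concludes. *)
Lemma cocoercive_lipschitz L h q : 0 < L ->
  lower_quad 0 h q -> upper_quad L h q ->
  forall x y, enorm (q x - q y) <= L * enorm (x - y).
Proof.
move=> L0 hl hu x y.
have half (a b : 'cV[R]_d) : h a + dot (q a) (b - a) + (2 * L)^-1 * enorm (q b - q a) ^+ 2 <= h b.
  set u := q b - q a.
  have := hu b (b - L^-1 *: u); have := hl a (b - L^-1 *: u).
  rewrite mul0r mul0r addr0.
  have -> : b - L^-1 *: u - b = - (L^-1 *: u) by rewrite addrAC subrr add0r.
  rewrite enormN enormZ.
  have -> : b - L^-1 *: u - a = (b - a) - L^-1 *: u by rewrite addrAC.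
  rewrite exprMn real_normK ?num_real// dotNr [dot (q a) (_ - L^-1 *: u)]dotBr !dotZr.
  have -> : dot (q b) u = dot (q a) u + enorm u ^+ 2.
    by rewrite enorm_sqr -dotDl; congr dot; rewrite /u addrC subrK.
  move=> l1 l2.
  have E : L / 2 * (L^-1 ^+ 2 * enorm u ^+ 2) = (2 * L)^-1 * enorm u ^+ 2 by field; rewrite gt_eqF.
  have E2 : L^-1 * (dot (q a) u + enorm u ^+ 2) = L^-1 * dot (q a) u + 2 * ((2 * L)^-1 * enorm u ^+ 2) by field; rewrite gt_eqF.
  by move: l1 l2; rewrite E E2; lra.
have := half x y; have := half y x.
rewrite (enorm_distC (q y)) -(opprB y x) dotNr => h1 h2.
have : L^-1 * enorm (q x - q y) ^+ 2 <= dot (q x - q y) (x - y).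
  have E : L^-1 * enorm (q x - q y) ^+ 2 = 2 * ((2 * L)^-1 * enorm (q x - q y) ^+ 2) by field; rewrite gt_eqF.
  by move: h1 h2; rewrite E -(opprB y x) dotNr dotBl; lra.
move=> /le_trans/(_ (Cauchy_Schwarz _ _)).
have [->|n0] := eqVneq (enorm (q x - q y)) 0.
  by rewrite mulr_ge0 ?enorm_ge0// ltW.
have np : 0 < enorm (q x - q y) by rewrite lt_neqAle eq_sym n0 enorm_ge0.
by rewrite opprB expr2 mulrCA ler_pM2l// ler_pdivrMl.
Qed.

(** The function h + rho / 2 * enorm x ^+ 2 is convex with curvature L + rho, so the
    previous lemma applies to it. The extra 1 keeps its constant positive. *)
Lemma weak_lipschitz L rho h q : 0 <= L -> 0 <= rho ->
  lower_quad (- rho) h q -> upper_quad L h q ->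
  forall x y, enorm (q x - q y) <= (L + 1 + 2 * rho) * enorm (x - y).
Proof.
move=> L0 r0 hl hu x y.
have E (a b : 'cV[R]_d) : enorm b ^+ 2 = enorm a ^+ 2 + 2 * dot a (b - a) + enorm (b - a) ^+ 2.
  by rewrite -enorm_sqrD addrC subrK.
have := @cocoercive_lipschitz (L + 1 + rho) (fun x => h x + rho / 2 * enorm x ^+ 2)
  (fun x => q x + rho *: x).
move=> /(_ _ _ _ x y) H.
have {H} : enorm (q x + rho *: x - (q y + rho *: y)) <= (L + 1 + rho) * enorm (x - y).
  apply: H; first by lra.
    move=> a b; have := hl a b; rewrite (E a b) dotDl dotZl; lra.
  move=> a b; have := hu a b; rewrite (E a b) dotDl dotZl.
  by have := sqr_ge0 (enorm (b - a)); lra.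
have -> : q x - q y = (q x + rho *: x - (q y + rho *: y)) - rho *: (x - y).
  by rewrite scalerBr; apply/colP => i; rewrite !mxE; ring.
move=> H; apply: le_trans (ler_enormB _ _) _; rewrite enormZ ger0_norm//; lra.
Qed.

End QuadraticBounds.

Section ProximalCalculus.
Context {R : realType} {d : nat}.
Variables (r : 'cV[R]_d -> \bar R) (G : R).
Hypotheses (rNoo : forall x, r x != -oo%E) (rlsc : lower_semicontinuous r)
  (rconv : econvex r) (rcompact : compact (edom r))
  (rG : forall x, edom r x -> (`|r x| <= G%:E)%E).
Implicit Types (x y z v w : 'cV[R]_d) (h : 'cV[R]_d -> R) (q : 'cV[R]_d -> 'cV[R]_d)
  (mu L rho t C : R).

Lemma edom_fineK x : edom r x -> (fine (r x))%:E = r x.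
Proof. by move=> rx; rewrite fineK// fin_numE rNoo/= lt_eqF. Qed.

Lemma notin_edom x : ~ edom r x -> r x = +oo%E.
Proof. by move=> /negP; rewrite -leNgt leye_eq => /eqP. Qed.

Lemma edom_convex x y t : edom r x -> edom r y -> 0 <= t <= 1 ->
  edom r (x + t *: (y - x)) /\
  fine (r (x + t *: (y - x))) <= fine (r x) + t * (fine (r y) - fine (r x)).
Proof.
move=> rx ry t01; have := rconv y x t01.
have -> : t *: y + (1 - t) *: x = x + t *: (y - x).
  by apply/colP => i; rewrite !mxE; ring.
rewrite -(edom_fineK rx) -(edom_fineK ry) -!EFinM -EFinD => H.
have dx : edom r (x + t *: (y - x)) by apply: le_lt_trans H _; rewrite ltry.
split=> //; move: H; rewrite -(edom_fineK dx) lee_fin => H.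
by apply: le_trans H _; rewrite /=; lra.
Qed.

Lemma edom_bounded : exists2 D, 0 <= D & forall x y, edom r x -> edom r y -> enorm (x - y) <= D.
Proof.
have [B [Br hB]] := compact_bounded rcompact.
have hB1 x : edom r x -> `|x| <= `|B| + 1.
  by move=> rx; apply: hB => //; apply: le_lt_trans (ler_norm _) _; rewrite ltrDl.
exists (d%:R * (`|B| + 1) + d%:R * (`|B| + 1)).
  by rewrite addr_ge0// mulr_ge0// addr_ge0.
move=> x y rx ry; apply: le_trans (ler_enormB _ _) _.
by rewrite lerD// (le_trans (enorm_le_mx_norm _))// ler_wpM2l// hB1.
Qed.

Lemma fine_edom_ge x : edom r x -> - G <= fine (r x).
Proof.
by move=> rx; have := rG rx; rewrite -(edom_fineK rx) /= lee_fin ler_norml => /andP[].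
Qed.

(** Weierstrass. The lower quadratic bound plays the part of continuity of h: it
    bounds the objective below on the bounded domain, and at a cluster point p of a
    minimizing sequence it makes h lower semicontinuous. *)
Lemma argmin_exists mu h q x0 : edom r x0 -> lower_quad mu h q ->
  exists2 x, edom r x & forall z, edom r z -> h x + fine (r x) <= h z + fine (r z).
Proof.
move=> rx0 hl; have [D D0 hD] := edom_bounded.
pose H (z : 'cV[R]_d) : R := h z + fine (r z).
pose S := [set H z | z in edom r].
have hinf : has_inf S.
  split; first by exists (H x0), x0.
  exists (h x0 - enorm (q x0) * D - `|mu| / 2 * D ^+ 2 - G) => _ [z rz <-].
  have := hl x0 z; have := Cauchy_Schwarz_abs (q x0) (z - x0).
  rewrite ler_norml => /andP[cs _].
  have zD := hD _ _ rz rx0; have := fine_edom_ge rz; rewrite /H => g.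
  have : enorm (q x0) * enorm (z - x0) <= enorm (q x0) * D by rewrite ler_wpM2l ?enorm_ge0.
  have : - (`|mu| / 2 * D ^+ 2) <= mu / 2 * enorm (z - x0) ^+ 2.
    have e0 := enorm_ge0 (z - x0).
    have : enorm (z - x0) ^+ 2 <= D ^+ 2 by rewrite ler_pXn2r// nnegrE.
    have := sqr_ge0 (enorm (z - x0)); have := ler_norm (- mu); rewrite normrN => a b c.
    have : 0 <= `|mu| by [].
    by nra.
  by lra.
have /choice[u hu] : forall n : nat, exists z, edom r z /\ H z < inf S + n.+1%:R^-1.
  move=> n; have n0 : 0 < n.+1%:R^-1 :> R by rewrite invr_gt0.
  by have [_ [z rz <-] hz] := inf_adherent n0 hinf; exists z.
have [p [rp clp]] : edom r `&` cluster (u @ \oo) !=set0.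
  by apply: rcompact; exists 0%N => // n _; exact: (hu n).1.
exists p => // z rz.
apply: le_trans (_ : inf S <= _); last by apply: ge_inf; [exact: hinf.2|exists z].
rewrite leNgt; apply/negP => lt.
pose del := (H p - inf S) / 3.
have del0 : 0 < del by rewrite divr_gt0// subr_gt0.
have [V1 nV1 hV1] : exists2 V, nbhs p V & forall y, V y -> ((fine (r p) - del)%:E < r y)%E.
  by apply: rlsc; rewrite -[ltRHS](edom_fineK rp) lte_fin ltrBlDr ltrDl.
(* Within distance 1 of p, h falls below h p by at most c times the distance. *)
pose c := enorm (q p) + `|mu| / 2 + 1.
have c0 : 0 < c by rewrite ltr_wpDl// addr_ge0 ?enorm_ge0// divr_ge0.
pose V2 := [set y : 'cV[R]_d | enorm (y - p) < Num.min 1 (del / c)].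
have nV2 : nbhs p V2.
  by apply/nbhs_enormP; exists (Num.min 1 (del / c)) => //; rewrite lt_min ltr01 divr_gt0.
have [N hN] : exists N : nat, N.+1%:R^-1 < del.
  have [N _ hN] := near_infty_natSinv_lt (PosNum del0).
  by exists N; exact: (hN N (leqnn N)).
have FA : (u @ \oo) [set y | exists2 n, (N <= n)%N & y = u n].
  by exists N => // n /= Nn; exists n.
have [_ [[n Nn ->] [v1 v2]]] := clp _ _ FA (filterI nV1 nV2).
have [run hun] := hu n.
have : n.+1%:R^-1 <= N.+1%:R^-1 :> R by rewrite lef_pV2 ?posrE// ler_nat.
have := hV1 _ v1; rewrite -(edom_fineK run) lte_fin.
move: v2; rewrite /V2 /= lt_min => /andP[un1 und].
have := hl p (u n); have := Cauchy_Schwarz_abs (q p) (u n - p); rewrite ler_norml => /andP[cs _].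
have e0 := enorm_ge0 (u n - p).
move: und; rewrite ltr_pdivlMr// => und.
have : - (`|mu| / 2 * enorm (u n - p)) <= mu / 2 * enorm (u n - p) ^+ 2.
  have : enorm (u n - p) ^+ 2 <= enorm (u n - p) by rewrite expr2 ler_piMl// ltW.
  have := sqr_ge0 (enorm (u n - p)); have := ler_norm (- mu); rewrite normrN => a b e.
  have : 0 <= `|mu| by [].
  by nra.
have HE : h p + fine (r p) = inf S + 3 * del by rewrite /del /H; field.
have cE : enorm (u n - p) * c = enorm (q p) * enorm (u n - p) + `|mu| / 2 * enorm (u n - p) + enorm (u n - p).
  by rewrite /c; ring.
move=> m1 m2 m3 m4; rewrite /H in hun.
suff : del < del by rewrite ltxx.
move: m1 m2 m3 m4 hun hN cs e0 und HE; rewrite cE.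
by move: n.+1%:R^-1 N.+1%:R^-1 => a b; lra.
Qed.

Lemma subdiff_fineP x xi : edom r x ->
  (forall z, edom r z -> fine (r x) + dot xi (z - x) <= fine (r z)) <-> subdiff r x xi.
Proof.
move=> rx; split=> [H z|H z rz]; last first.
  by have := H z; rewrite -(edom_fineK rx) -(edom_fineK rz) -EFinD lee_fin.
have [rz|/notin_edom ->] := pselect (edom r z); last by rewrite leey.
by rewrite -(edom_fineK rx) -(edom_fineK rz) -EFinD lee_fin H.
Qed.

(** Only a quadratic upper bound on h at the minimizer x enters. Moving from x to
    x + t (z - x) changes h by t <q, z - x> + O(t^2) and r by at most
    t (r z - r x); divide by t and let t -> 0. *)
Lemma argmin_subdiff C h x (q : 'cV[R]_d) : edom r x ->
  (forall z, edom r z -> h x + fine (r x) <= h z + fine (r z)) ->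
  (forall z, edom r z -> h z <= h x + dot q (z - x) + C / 2 * enorm (z - x) ^+ 2) ->
  subdiff r x (- q).
Proof.
move=> rx hmin hup; apply/subdiff_fineP => // z rz; rewrite dotNl.
apply/ler_addgt0Pr => e e0.
set c := `|C| / 2 * enorm (z - x) ^+ 2.
have c0 : 0 <= c by rewrite mulr_ge0 ?sqr_ge0 ?divr_ge0.
have c1 : 0 < c + 1 by rewrite ltr_wpDl.
pose t := Num.min 1 (e / (c + 1)).
have t0 : 0 < t by rewrite lt_min ltr01 divr_gt0.
have t1 : t <= 1 by rewrite ge_min lexx.
have tc : t * c <= e.
  have : t * (c + 1) <= e by rewrite -ler_pdivlMr// ge_min lexx orbT.
  by nra.
have [|rt ht] := @edom_convex x z t rx rz; first by rewrite t1 ltW.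
have := hmin _ rt; have := hup _ rt.
rewrite [x + _]addrC addrK enormZ gtr0_norm// exprMn dotZr => h1 h2.
have h3 : C / 2 * (t ^+ 2 * enorm (z - x) ^+ 2) <= t * (t * c).
  rewrite /c; have : C <= `|C| by exact: ler_norm.
  have : 0 <= t ^+ 2 * enorm (z - x) ^+ 2 by rewrite mulr_ge0 ?sqr_ge0.
  by nra.
rewrite addrC in ht.
have : 0 <= t * (dot q (z - x) + e + fine (r z) - fine (r x)).
  have : t * (t * c) <= t * e by rewrite ler_wpM2l// ltW.
  by move: h1 h2 h3 ht; move: (enorm _) (fine _) (fine _) (h _) => *; nra.
by rewrite pmulr_rge0//; lra.
Qed.

(** The objective of the proximal step is a quadratic with curvature L plus r, so
    the step is attained, and its optimality condition is explicit. *)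
Lemma prox_stepP phi L w x0 : edom r x0 -> 0 < L ->
  edom r (prox_step phi r L w) /\
  subdiff r (prox_step phi r L w) (L *: (w - prox_step phi r L w) - grad phi w).
Proof.
move=> rx0 L0.
pose h (z : 'cV[R]_d) : R := phi w + dot (grad phi w) (z - w) + L / 2 * enorm (z - w) ^+ 2.
pose q (z : 'cV[R]_d) : 'cV[R]_d := grad phi w + L *: (z - w).
have hE (x z : 'cV[R]_d) : h z = h x + dot (q x) (z - x) + L / 2 * enorm (z - x) ^+ 2.
  rewrite /h /q.
  have -> : z - w = (x - w) + (z - x) by rewrite [RHS]addrC subrKA.
  move: (x - w) (z - x) (grad phi w) => a b c.
  by rewrite enorm_sqrD dotDr dotDl dotZl; field.
have [p rp hp] : exists2 x, edom r x & forall z, edom r z -> h x + fine (r x) <= h z + fine (r z).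
  by apply: (@argmin_exists L h q x0) => // x z; rewrite -hE.
have ex : exists x, [set x | forall z, (psi phi r L w x <= psi phi r L w z)%E] x.
  exists p => z; rewrite /psi -/(h p) -/(h z).
  have [rz|/notin_edom ->] := pselect (edom r z); last by rewrite addey ?leey.
  by rewrite -(edom_fineK rp) -(edom_fineK rz) -!EFinD lee_fin hp.
have := xgetPex 0 ex; rewrite -/(prox_step phi r L w); set x := prox_step _ _ _ _ => hx.
have rx : edom r x.
  apply: contrapT => /notin_edom rx; have := hx p.
  by rewrite /psi rx addey// -(edom_fineK rp) -EFinD leye_eq.
have hmin z : edom r z -> h x + fine (r x) <= h z + fine (r z).
  move=> rz; have := hx z.
  by rewrite /psi -(edom_fineK rx) -(edom_fineK rz) -!EFinD lee_fin.
split=> //.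
have -> : L *: (w - x) - grad phi w = - q x.
  by rewrite /q opprD addrC -scalerN opprB.
by apply: (@argmin_subdiff L h) => // z _; rewrite -hE.
Qed.

End ProximalCalculus.

(** * Complexity of the adaptive accelerated solver *)

Section AcceleratedStep.
Context {R : realType} {d : nat}.
Implicit Types (x v w e u : 'cV[R]_d).

(** One step of accelerated gradient for the weights al with mu = M * al ^+ 2.
    The two hypotheses are the proximal descent inequality at the current point x
    and at the minimizer xs. Take (1 - al) times the first plus al times the second:
    w was chosen so that the inner products cancel against the expansion of the new
    momentum point x + al^-1 (x' - x). *)
Lemma potential_decrease (mu M al Fx Fs Fn : R) (x v w x' xs : 'cV[R]_d) :
  0 < al <= 1 -> 0 <= mu -> mu = M * al ^+ 2 -> (1 + al) *: w = x + al *: v ->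
  Fn + dot (M *: (w - x')) (x - x') - M / 2 * enorm (x' - w) ^+ 2
    + mu / 2 * enorm (x - w) ^+ 2 <= Fx ->
  Fn + dot (M *: (w - x')) (xs - x') - M / 2 * enorm (x' - w) ^+ 2
    + mu / 2 * enorm (xs - w) ^+ 2 <= Fs ->
  Fn - Fs + mu / 2 * enorm (x + al^-1 *: (x' - x) - xs) ^+ 2 <=
  (1 - al) * (Fx - Fs + mu / 2 * enorm (v - xs) ^+ 2).
Proof.
move=> /andP[al0 al1] mu0 muE wE.
have M0 : 0 <= M by move: mu0; rewrite muE pmulr_lge0// exprn_gt0.
pose e : 'cV[R]_d := w - xs; pose del : 'cV[R]_d := v - w; pose u : 'cV[R]_d := w - x'.
have xE : x = w - al *: del.
  by apply/colP => i; have /colP/(_ i) := wE; rewrite /del !mxE; lra.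
have E1 : x - x' = u - al *: del by rewrite xE /u addrAC.
have E2 : x' - w = - u by rewrite /u opprB.
have E3 : x - w = - (al *: del) by rewrite xE addrAC subrr add0r.
have E4 : xs - x' = u - e by rewrite /u /e opprB [RHS]addrC subrKA.
have E5 : xs - w = - e by rewrite /e opprB.
have E6 : x + al^-1 *: (x' - x) - xs = e + (1 - al) *: del - al^-1 *: u.
  have -> : x' - x = al *: del - u by rewrite -[LHS]opprB E1 opprB.
  rewrite scalerBr scalerA mulVf ?gt_eqF// scale1r xE /e.
  by apply/colP => i; rewrite !mxE; ring.
have E7 : v - xs = e + del by rewrite /e /del [RHS]addrC subrKA.
have E0 : w - x' = u by [].
clearbody e del u.
have E8 : mu / 2 * enorm (e + (1 - al) *: del - al^-1 *: u) ^+ 2 =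
    mu / 2 * (dot e e + 2 * (1 - al) * dot e del + (1 - al) ^+ 2 * dot del del)
    - M * al * dot e u - M * al * (1 - al) * dot del u + M / 2 * dot u u.
  rewrite enorm_sqr !dotE (dotC u e) (dotC u del) (dotC del e) muE.
  by field; rewrite gt_eqF.
rewrite E0 E1 E2 E3 E4 E5 E6 E7 E8 !enormN enormZ exprMn real_normK ?num_real//.
rewrite !enorm_sqr !dotE (dotC u e) (dotC u del) (dotC del e).
move: (dot e e) (dot del del) (dot u u) (dot e del) (dot e u) (dot del u) (dot_ge0 del).
move=> ee dd uu ed eu du; rewrite -/(0 <= dd) => dd0 I1 I2.
have a1 : 0 <= 1 - al by lra.
have J1 := ler_wpM2l a1 I1.
have J2 := ler_wpM2l (ltW al0) I2.
have S : 0 <= mu / 2 * ((1 - al) * (al ^+ 2 + al) * dd).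
  by rewrite mulr_ge0// ?divr_ge0// mulr_ge0// mulr_ge0// addr_ge0 ?sqr_ge0// ltW.
by lra.
Qed.

End AcceleratedStep.

(** Dropping one unit of the major counter and resetting the minor one to T
    lowers the combined counter. *)
Lemma lex_total (n T : nat) : ((n * T.+1 + T).+1 = n.+1 * T.+1)%N.
Proof. by rewrite mulSn addSn addnC. Qed.

Section AdaptiveSolver.
Context {R : realType} {d : nat}.
Variables (prm : apg_params R) (phi : 'cV[R]_d -> R) (r : 'cV[R]_d -> \bar R).
Variables (G ms Lam Mlow Mup mulow : R).
Implicit Types (x y z v w p xi : 'cV[R]_d) (L M mu al eps : R) (st : apg_state R d).

(** The points at which the accelerated line search evaluates the gradient. They
    can leave the domain, but only by a bounded multiple of a difference of two
    domain points, so smoothness is required on this set and not everywhere. *)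
Definition extrapolations (X : set 'cV[R]_d) (c : R) : set 'cV[R]_d :=
  [set w | exists x y (s : R), [/\ X x, X y, `|s| <= c & w = x + s *: (x - y)]].

Lemma extrapolations_refl (X : set 'cV[R]_d) (c : R) x : 0 <= c -> X x -> extrapolations X c x.
Proof. by move=> c0 Xx; exists x, x, 0; rewrite normr0 scale0r addr0. Qed.

Local Notation X := (edom r).
Local Notation W := (extrapolations X (gam_dec prm)).
Local Notation T L w := (prox_step phi r L w).
Local Notation F z := (phi z + fine (r z)).

Hypotheses (prm_ok : apg_params_ok prm) (rNoo : forall x, r x != -oo%E)
  (rlsc : lower_semicontinuous r) (rconv : econvex r) (rcompact : compact X)
  (rG : forall x, X x -> (`|r x| <= G%:E)%E).
Hypotheses (ms_gt0 : 0 < ms) (Lam_ge0 : 0 <= Lam)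
  (phi_lower : lower_quad ms phi (grad phi))
  (phi_upper : forall w z, W w -> X z ->
     phi z <= phi w + dot (grad phi w) (z - w) + Lam / 2 * enorm (z - w) ^+ 2)
  (phi_lip : forall w z, W w -> X z ->
     enorm (grad phi z - grad phi w) <= Lam * enorm (z - w)).

Lemma gam_dec_ge0 : 0 <= gam_dec prm.
Proof. by case: prm_ok => _ h _ _; apply: le_trans h; exact: ler01. Qed.

Lemma W_dom x : X x -> W x.
Proof. exact/extrapolations_refl/gam_dec_ge0. Qed.

Lemma dom_of_W w : W w -> exists x, X x.
Proof. by move=> [x [_ [_ [Xx _ _ _]]]]; exists x. Qed.

Lemma prox_dom L w : W w -> 0 < L -> X (T L w).
Proof.
by move=> /dom_of_W[x0 Xx0] L0; have [] := prox_stepP rNoo rlsc rconv rcompact rG phi w Xx0 L0.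
Qed.

Lemma prox_subdiff L w : W w -> 0 < L ->
  subdiff r (T L w) (L *: (w - T L w) - grad phi w).
Proof.
by move=> /dom_of_W[x0 Xx0] L0; have [] := prox_stepP rNoo rlsc rconv rcompact rG phi w Xx0 L0.
Qed.

Lemma decrease_okP L w : W w -> 0 < L -> decrease_ok phi r L w <->
  phi (T L w) <= phi w + dot (grad phi w) (T L w - w) + L / 2 * enorm (T L w - w) ^+ 2.
Proof.
move=> Ww L0; rewrite /decrease_ok /psi -(edom_fineK rNoo (prox_dom Ww L0)).
by rewrite -!EFinD lee_fin lerD2r.
Qed.

Lemma decrease_ok_large L w : W w -> 0 < L -> Lam <= L -> decrease_ok phi r L w.
Proof.
move=> Ww L0 LamL; apply/decrease_okP => //.
apply: le_trans (phi_upper Ww (prox_dom Ww L0)) _; rewrite lerD2l.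
by rewrite ler_wpM2r ?sqr_ge0// ler_wpM2r.
Qed.

(** Sum of three inequalities: the accepted decrease test, strong convexity of phi
    at w, and the subgradient of r produced by the proximal step. *)
Lemma prox_descent L w z : W w -> 0 < L -> decrease_ok phi r L w -> X z ->
  F (T L w) + dot (L *: (w - T L w)) (z - T L w) - L / 2 * enorm (T L w - w) ^+ 2
    + ms / 2 * enorm (z - w) ^+ 2 <= F z.
Proof.
move=> Ww L0 /(decrease_okP Ww L0) dec Xz.
have /(subdiff_fineP rNoo _ (prox_dom Ww L0)) /(_ z Xz) := prox_subdiff Ww L0.
have := phi_lower w z; move: dec.
have -> : z - T L w = (z - w) - (T L w - w) by rewrite opprB addrA subrK.
rewrite [dot (L *: (w - T L w) - _) _]dotBl [dot (grad _ _) (_ - (_ - _))]dotBr.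
by move: (dot (L *: _) _) (enorm (z - w)) (enorm (_ - w)) => a b c; lra.
Qed.

Lemma Sratio_ge0 L w : 0 <= Sratio phi r L w.
Proof. by rewrite divr_ge0 ?enorm_ge0. Qed.

Lemma Sratio_le L w : W w -> 0 < L -> Sratio phi r L w <= Lam.
Proof.
move=> Ww L0; rewrite /Sratio.
have := phi_lip Ww (prox_dom Ww L0).
have [->|n0] := eqVneq (enorm (T L w - w)) 0; first by move=> _; rewrite invr0 mulr0.
by rewrite ler_pdivrMr// lt_neqAle eq_sym n0 enorm_ge0.
Qed.

(** The subgradient of r given by the step leaves the gradient mapping plus the
    change of the gradient of phi along the step; the latter is what [Sratio]
    measures relative to the length of the step. *)
Lemma prox_residual L w : W w -> 0 < L ->
  exists2 xi, subdiff r (T L w) xi &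
    enorm (grad phi (T L w) + xi)
      <= (1 + Sratio phi r L w / L) * enorm (L *: (w - T L w)).
Proof.
move=> Ww L0; exists (L *: (w - T L w) - grad phi w); first exact: prox_subdiff.
rewrite addrCA; apply: le_trans (ler_enormD _ _) _.
rewrite mulrDl mul1r lerD2l enormZ gtr0_norm// mulrA divfK ?gt_eqF//.
rewrite (enorm_distC w) /Sratio.
have := phi_lip Ww (prox_dom Ww L0).
have [->|n0] := eqVneq (enorm (T L w - w)) 0; first by rewrite !mulr0.
by rewrite divfK.
Qed.

Lemma omega_le x xi : subdiff r x xi -> omega phi r x <= enorm (grad phi x + xi).
Proof.
move=> hxi; apply: ge_inf; last by exists xi.
by exists 0 => _ [v _ <-]; exact: enorm_ge0.
Qed.

Lemma gam_inc_gt1 : 1 < gam_inc prm. Proof. by case: prm_ok. Qed.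

Lemma trial_ge L j : 0 < L -> L <= trial prm L j.
Proof.
by move=> L0; rewrite /trial ler_peMr ?(ltW L0)// exprn_ege1// (ltW gam_inc_gt1).
Qed.

(** Trial values grow geometrically, and every value above the curvature Lam is
    accepted. *)
Lemma search_exists (w : R -> 'cV[R]_d) L : 0 < L ->
  (forall L', L <= L' -> W (w L')) ->
  exists j, first_accepted prm (fun L' => decrease_ok phi r L' (w L')) L j.
Proof.
move=> L0 hw.
have [j0 hj0] : exists j, `[< decrease_ok phi r (trial prm L j) (w (trial prm L j)) >].
  have [j hj] : exists j, Lam <= trial prm L j.
    have g1 := gam_inc_gt1.
    pose j := Num.Def.archi_bound (Lam / (L * (gam_inc prm - 1))).
    exists j; rewrite /trial.
    have Bern k : 1 + k%:R * (gam_inc prm - 1) <= gam_inc prm ^+ k.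
      elim: k => [|k IH]; first by rewrite mul0r addr0 expr0.
      rewrite exprS -natr1; have k0 : 0 <= k%:R :> R by [].
      have : 0 <= k%:R * (gam_inc prm - 1) * (gam_inc prm - 1).
        by rewrite !mulr_ge0// subr_ge0 ltW.
      nra.
    have c0 : 0 < L * (gam_inc prm - 1) by rewrite mulr_gt0// subr_gt0.
    have := @archi_boundP R (Lam / (L * (gam_inc prm - 1))) (divr_ge0 Lam_ge0 (ltW c0)).
    rewrite -/j ltr_pdivrMr// => h; apply: le_trans (ltW h) _.
    rewrite mulrCA ler_wpM2l ?(ltW L0)//; apply: le_trans (ltW _) (Bern j).
    by rewrite ltrDr.
  exists j; apply/asboolP/decrease_ok_large => //.
    by apply: hw; exact: trial_ge.
  by apply: lt_le_trans (trial_ge _ L0).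
have ex : exists j, `[< decrease_ok phi r (trial prm L j) (w (trial prm L j)) >] by exists j0.
exists (ex_minn ex); case: ex_minnP => j /asboolP hj jmin; split=> // i ij /asboolP hi.
by have := jmin _ hi; rewrite leqNgt ij.
Qed.

(** If the first trial is refused, the last refused trial is below Lam, hence the
    accepted one is below gam_inc * Lam. *)
Lemma search_le (w : R -> 'cV[R]_d) L j : 0 < L ->
  (forall L', L <= L' -> W (w L')) ->
  first_accepted prm (fun L' => decrease_ok phi r L' (w L')) L j ->
  trial prm L j <= Num.max L (gam_inc prm * Lam).
Proof.
move=> L0 hw [_ hmin]; case: j hmin => [|j] hmin.
  by rewrite /trial expr0 mulr1 le_max lexx.
have tj0 : 0 < trial prm L j by apply: lt_le_trans (trial_ge _ L0).
have lt : trial prm L j < Lam.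
  rewrite ltNge; apply/negP => le; apply: (hmin j) => //.
  by apply: decrease_ok_large => //; apply: hw; exact: trial_ge.
rewrite le_max; apply/orP; right; rewrite /trial exprS mulrCA ler_wpM2l ?(ltW lt)//.
  by rewrite (le_trans ler01)// ltW// gam_inc_gt1.
Qed.

Hypotheses (Mlow_gt0 : 0 < Mlow) (Mlow_le : Mlow <= L_min prm)
  (Mup_ge : L_min prm <= Mup) (Mup_Lam : gam_inc prm * Lam <= Mup)
  (mulow_gt0 : 0 < mulow) (mulow_le : mulow <= ms / gam_sc prm).
Variable xs : 'cV[R]_d.
Hypotheses (xs_dom : X xs) (xs_min : forall z, X z -> F xs <= F z).

Lemma quadratic_growth z : X z -> F xs + ms / 2 * enorm (z - xs) ^+ 2 <= F z.
Proof.
move=> Xz.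
have /(subdiff_fineP rNoo _ xs_dom) /(_ z Xz) : subdiff r xs (- grad phi xs).
  apply: (argmin_subdiff rNoo rconv xs_dom xs_min (C := Lam)) => u Xu.
  by apply: phi_upper => //; exact: W_dom.
rewrite dotNl; have := phi_lower xs z; lra.
Qed.

(** Strong convexity at x with a subgradient of norm at most B, together with
    quadratic growth around xs, bounds both the gap and the distance to xs. *)
Lemma initial_potential mu x xi B : 0 < mu <= ms -> X x -> subdiff r x xi ->
  enorm (grad phi x + xi) <= B ->
  F x - F xs + mu / 2 * enorm (x - xs) ^+ 2 <= B ^+ 2 / mu.
Proof.
move=> /andP[mu0 mums] Xx /(subdiff_fineP rNoo _ Xx) /(_ xs xs_dom) sub hB.
have low := phi_lower x xs; have grow := quadratic_growth Xx.
have cs := Cauchy_Schwarz (grad phi x + xi) (x - xs).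
move: sub low; rewrite (enorm_distC xs) -(opprB x xs) !dotNr => sub low.
have n0 := enorm_ge0 (x - xs).
have cs2 : dot (grad phi x) (x - xs) + dot xi (x - xs) <= B * enorm (x - xs).
  by rewrite -dotDl; apply: le_trans cs _; rewrite ler_wpM2r.
have B0 : 0 <= B by apply: le_trans hB; exact: enorm_ge0.
have n2 := sqr_ge0 (enorm (x - xs)).
have m1 : mu * enorm (x - xs) ^+ 2 <= ms * enorm (x - xs) ^+ 2 by rewrite ler_wpM2r.
have e1 : mu * enorm (x - xs) <= B.
  have : mu * enorm (x - xs) ^+ 2 <= B * enorm (x - xs) by lra.
  have [->|ne0] := eqVneq (enorm (x - xs)) 0; first by move=> _; rewrite mulr0.
  by rewrite expr2 mulrA ler_pM2r// lt_neqAle eq_sym ne0.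
have e2 : enorm (x - xs) <= B / mu by rewrite ler_pdivlMr// mulrC.
have : B * enorm (x - xs) <= B ^+ 2 / mu by rewrite expr2 -mulrA ler_wpM2l.
by lra.
Qed.

(** Bounds the distance of 0 to the subdifferential of phi + r at the base point
    of the stage, in terms of the gradient mapping that produced this point. *)
Definition base_bound st : R := (1 + st_S0 st / st_M0 st) * enorm (st_p0 st).

(** The point v of the potential: w is the mean of x and v with weights
    1 / (1 + al) and al / (1 + al). *)
Definition momentum st : 'cV[R]_d := st_xp st + (st_al st)^-1 *: (st_x st - st_xp st).

Definition potential st : R :=
  F (st_x st) - F xs + st_mu st / 2 * enorm (momentum st - xs) ^+ 2.

(** What every state reached by the solver satisfies. The field [inv_extra] is what keeps
    extrapolations bounded when gam_dec lets L shrink from one step to the next.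
    The last field, the linear convergence of the stage, is conditional: nothing is
    known while mu exceeds the modulus of strong convexity. *)
Record solver_inv st : Prop := SolverInv {
  inv_x : X (st_x st); inv_xp : X (st_xp st); inv_x0 : X (st_x0 st);
  inv_L : Mlow <= st_L st <= Mup;
  inv_L0 : Mlow <= st_L0 st <= Mup;
  inv_M0 : Mlow <= st_M0 st <= Mup;
  inv_mu : mulow <= st_mu st <= L_min prm;
  inv_al : 0 < st_al st;
  inv_extra : st_x st = st_xp st \/
    st_mu st <= gam_dec prm ^+ 2 * st_al st ^+ 2 * st_L st;
  inv_S0 : 0 <= st_S0 st <= Lam;
  inv_base : exists2 xi, subdiff r (st_x0 st) xi &
    enorm (grad phi (st_x0 st) + xi) <= base_bound st;
  inv_pot : st_mu st <= ms ->
    [/\ 0 <= st_tau st, st_al st <= 1 &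
        potential st <= st_tau st * (base_bound st ^+ 2 / st_mu st)] }.

Lemma inv_mu_gt0 st : solver_inv st -> 0 < st_mu st.
Proof. by move=> /inv_mu /andP[h _]; apply: lt_le_trans h. Qed.

Lemma inv_L_gt0 st : solver_inv st -> 0 < st_L st.
Proof. by move=> /inv_L /andP[h _]; apply: lt_le_trans h. Qed.

Lemma stage_start_inv x L p S mu :
  X x -> Mlow <= L <= Mup -> mulow <= mu <= L_min prm -> 0 <= S <= Lam ->
  (exists2 xi, subdiff r x xi & enorm (grad phi x + xi) <= (1 + S / L) * enorm p) ->
  solver_inv (stage_start x L p L S mu).
Proof.
move=> Xx hL hmu hS [xi hxi hn].
have mu0 : 0 < mu by case/andP: hmu => h _; apply: lt_le_trans h.
split=> //=; first by left.
  by exists xi.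
move=> mums; split=> //.
rewrite /potential /momentum /base_bound /= mul1r invr1 scale1r subrr addr0.
by apply: initial_potential hn => //; rewrite mu0.
Qed.

(** With a the previous weight, al <= gam_dec * a because L loses at most a factor
    gam_dec per step. The extrapolation coefficient is then at most gam_dec, also
    when a > 1, which happens if the accepted L is below mu. *)
Lemma accel_w_extrapolated st L : solver_inv st -> st_L st <= L -> W (accel_w st L).
Proof.
move=> inv LL; have al0 := inv_al inv; have mu0 := inv_mu_gt0 inv; have L0 := inv_L_gt0 inv.
rewrite /accel_w; have [->|hmu] := inv_extra inv.
  rewrite subrr scaler0 addr0; exact: W_dom (inv_xp inv).
eexists _, _, _; split; [exact: inv_x inv|exact: inv_xp inv| |by []].
set a := st_al st in al0 hmu *; set al := accel_alpha st L.
have Lg0 : 0 < L by apply: lt_le_trans LL.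
have alpos : 0 < al by rewrite sqrtr_gt0 divr_gt0.
have gd1 : 1 <= gam_dec prm by case: prm_ok.
have gd0 := gam_dec_ge0.
have ale : al <= gam_dec prm * a.
  rewrite -(@ler_pXn2r _ 2)// ?nnegrE ?(ltW alpos)// ?mulr_ge0 ?(ltW al0)//.
  rewrite sqr_sqrtr; last by rewrite divr_ge0// ltW.
  rewrite ler_pdivrMr// exprMn.
  apply: le_trans hmu _; rewrite ler_wpM2l//.
  by rewrite mulr_ge0 ?sqr_ge0.
have den0 : 0 < a * (1 + al) by rewrite mulr_gt0// ltr_wpDl.
rewrite normrM normfV (gtr0_norm den0) ler_pdivrMr// normrM gtr0_norm//.
have [a1|/ltW a1] := leP a 1.
  rewrite ger0_norm ?subr_ge0//.
  have : al * (1 - a) <= al by rewrite ler_piMr ?(ltW alpos)//; lra.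
  have : 0 <= gam_dec prm * (a * al) by rewrite !mulr_ge0// ltW.
  by nra.
rewrite ler0_norm ?subr_le0//.
have : a * al <= gam_dec prm * (a * al) by rewrite ler_peMl// mulr_ge0// ltW.
have : 0 <= gam_dec prm * a by rewrite mulr_ge0// ltW.
by nra.
Qed.

(** The state can still reduce mu at most a times, start a new base point at most
    b times, and take at most s further steps in the current stage; q bounds from
    below the weights sqrt (mu / L). *)
Definition progress (K1 q eps : R) st (a b s : nat) :=
  [/\ st_mu st <= ms * gam_sc prm ^+ a,
      (1 + Lam / Mlow) * th_sc prm ^+ b * enorm (st_p0 st) <= eps &
      K1 * Num.sqrt (st_tau st * (1 - q) ^+ s) <= th_sc prm].

Section Step.
Variables (st : apg_state R d) (j : nat).
Hypotheses (inv : solver_inv st) (search : accel_line_search prm phi r st j).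

Local Notation M := (accel_M prm st j).
Local Notation al := (accel_alpha st M).
Local Notation w := (accel_w st M).
Local Notation x' := (accel_x prm phi r st j).
Local Notation p := (M *: (w - x')).

Let W_accel L : st_L st <= L -> W (accel_w st L).
Proof. exact: accel_w_extrapolated. Qed.

Let L_le_M : st_L st <= M.
Proof. exact/trial_ge/inv_L_gt0. Qed.

Lemma step_M : Mlow <= M <= Mup.
Proof.
have /andP[l u] := inv_L inv; rewrite (le_trans l)//=.
apply: le_trans (search_le (inv_L_gt0 inv) W_accel search) _.
by rewrite ge_max u Mup_Lam.
Qed.

Let M_gt0 : 0 < M.
Proof. by have /andP[h _] := step_M; apply: lt_le_trans h. Qed.

Let Ww : W w. Proof. exact: W_accel. Qed.

Let dec : decrease_ok phi r M w. Proof. by case: search. Qed.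

Lemma step_dom : X x'. Proof. exact: prox_dom. Qed.

Lemma step_residual : exists2 xi, subdiff r x' xi &
  enorm (grad phi x' + xi) <= (1 + Sratio phi r M w / M) * enorm p.
Proof. exact: prox_residual. Qed.

Lemma step_Sratio : 0 <= Sratio phi r M w <= Lam.
Proof. by rewrite Sratio_ge0 Sratio_le. Qed.

Lemma step_omega : omega phi r x' <= (1 + Lam / Mlow) * enorm p.
Proof.
have [xi hxi hn] := step_residual; apply: le_trans (omega_le hxi) _.
apply: le_trans hn _; rewrite ler_wpM2r ?enorm_ge0// lerD2l.
have /andP[S0 S1] := step_Sratio; have /andP[M1 _] := step_M.
by rewrite ler_pM ?invr_ge0 ?(ltW M_gt0)// lef_pV2 ?posrE.
Qed.

Let mu_gt0 := inv_mu_gt0 inv.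

Lemma alpha_gt0 : 0 < al. Proof. by rewrite sqrtr_gt0 divr_gt0. Qed.

Lemma alpha_sqr : st_mu st = M * al ^+ 2.
Proof. by rewrite sqr_sqrtr ?divr_ge0 ?(ltW mu_gt0) ?(ltW M_gt0)// mulrC divfK// gt_eqF. Qed.

(** If the weight exceeds 1, the accepted M is below mu, hence below the modulus of
    strong convexity; the accepted upper bound and the lower bound then contradict
    each other unless the step is null. *)
Lemma step_alpha : st_mu st <= ms -> al <= 1 \/ p = 0.
Proof.
move=> mums; have [a1|a1] := leP al 1; [by left|right].
have Mmu : M < st_mu st.
  by rewrite [ltRHS]alpha_sqr ltr_pMr// -[ltLHS](expr1n _ 2) ltr_pXn2r// nnegrE ltW// alpha_gt0.
have := (decrease_okP Ww M_gt0).1 dec; have := phi_lower w x'; rewrite -/x' => h1 h2.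
have : (ms - M) * enorm (x' - w) ^+ 2 <= 0 by lra.
rewrite pmulr_rle0 ?subr_gt0 ?(lt_le_trans Mmu)// => h.
have /enorm_eq0 /eqP : enorm (x' - w) = 0.
  by apply/eqP; rewrite -sqrf_eq0 eq_le h sqr_ge0.
by rewrite subr_eq0 => /eqP ->; rewrite subrr scaler0.
Qed.

Lemma step_potential : st_mu st <= ms -> al <= 1 ->
  F x' - F xs + st_mu st / 2 * enorm (st_x st + al^-1 *: (x' - st_x st) - xs) ^+ 2
  <= st_tau st * (1 - al) * (base_bound st ^+ 2 / st_mu st).
Proof.
move=> mums a1; have [t0 _ pot] := inv_pot inv mums.
have weaken z : X z -> F x' + dot (M *: (w - x')) (z - x') - M / 2 * enorm (x' - w) ^+ 2
    + st_mu st / 2 * enorm (z - w) ^+ 2 <= F z.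
  move=> Xz; apply: le_trans (prox_descent Ww M_gt0 dec Xz); rewrite lerD2l.
  by rewrite ler_wpM2r ?sqr_ge0// ler_wpM2r.
have wE : (1 + al) *: w = st_x st + al *: momentum st.
  have := inv_al inv; have := alpha_gt0; rewrite /accel_w /momentum.
  move: (st_al st) al => a c c0 a0; apply/colP => i; rewrite !mxE; field.
  by rewrite !gt_eqF// ltr_wpDl// ltW.
have a01 : 0 < al <= 1 by rewrite alpha_gt0.
apply: le_trans (potential_decrease a01 (ltW mu_gt0) alpha_sqr wE (weaken _ (inv_x inv)) (weaken _ xs_dom)) _.
rewrite [leRHS](_ : _ = (1 - al) * (st_tau st * (base_bound st ^+ 2 / st_mu st))); last by ring.
by rewrite ler_wpM2l// subr_ge0.
Qed.

Lemma base_bound_ge0 : 0 <= base_bound st.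
Proof.
have /andP[S0 _] := inv_S0 inv; have /andP[M0 _] := inv_M0 inv.
by rewrite mulr_ge0 ?enorm_ge0// addr_ge0// divr_ge0// (le_trans (ltW Mlow_gt0)).
Qed.

(** The potential controls the distance to xs of the points x, v and x', hence
    that of w, which is a mean of x and v. The gradient mapping M (w - x') is
    therefore bounded by twice M times this radius. *)
Lemma step_p_bound : st_mu st <= ms ->
  enorm p <= 2 * Num.sqrt (2 * st_tau st) * (M / st_mu st) * base_bound st.
Proof.
move=> mums; have [t0 _ pot] := inv_pot inv mums.
set rho := Num.sqrt (2 * st_tau st) * base_bound st / st_mu st.
have B0 := base_bound_ge0.
have rho0 : 0 <= rho by apply: divr_ge0 (ltW mu_gt0); rewrite mulr_ge0 ?sqrtr_ge0.
have rhoE : st_mu st / 2 * rho ^+ 2 = st_tau st * (base_bound st ^+ 2 / st_mu st).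
  have mun0 : st_mu st != 0 by rewrite gt_eqF.
  have E : Num.sqrt (2 * st_tau st) ^+ 2 = 2 * st_tau st by rewrite sqr_sqrtr// mulr_ge0.
  have -> : rho ^+ 2 = (2 * st_tau st) * base_bound st ^+ 2 / st_mu st ^+ 2.
    by rewrite -E /rho; field.
  by field.
have close z : st_mu st / 2 * enorm (z - xs) ^+ 2 <= st_mu st / 2 * rho ^+ 2 ->
    enorm (z - xs) <= rho.
  rewrite ler_pM2l ?divr_gt0// => h.
  by rewrite -(@ler_pXn2r _ 2)// nnegrE enorm_ge0.
have far z : X z -> st_mu st / 2 * enorm (z - xs) ^+ 2 <= F z - F xs.
  move=> Xz; have := quadratic_growth Xz.
  have : st_mu st / 2 * enorm (z - xs) ^+ 2 <= ms / 2 * enorm (z - xs) ^+ 2.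
    by rewrite ler_wpM2r ?sqr_ge0// ler_wpM2r.
  lra.
have [a1|->] := step_alpha mums; last first.
  rewrite enorm0; apply: mulr_ge0 B0.
  apply: mulr_ge0; first by rewrite mulr_ge0 ?sqrtr_ge0.
  exact: divr_ge0 (ltW M_gt0) (ltW mu_gt0).
have P0 z : 0 <= st_mu st / 2 * enorm (z - xs) ^+ 2.
  by rewrite mulr_ge0 ?sqr_ge0 ?divr_ge0 ?(ltW mu_gt0).
have cx : enorm (st_x st - xs) <= rho.
  apply: close; rewrite rhoE; apply: le_trans pot; rewrite /potential.
  by have := far _ (inv_x inv); have := P0 (momentum st); lra.
have cv : enorm (momentum st - xs) <= rho.
  apply: close; rewrite rhoE; apply: le_trans pot; rewrite /potential.
  by have := far _ (inv_x inv); have := P0 (st_x st); lra.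
have cn : enorm (x' - xs) <= rho.
  apply: close; rewrite rhoE.
  have := step_potential mums a1; have := far _ step_dom.
  have : st_tau st * (1 - al) * (base_bound st ^+ 2 / st_mu st) <= st_tau st * (base_bound st ^+ 2 / st_mu st).
    rewrite ler_wpM2r ?divr_ge0 ?sqr_ge0 ?(ltW mu_gt0)// ler_piMr//.
    by have := alpha_gt0; lra.
  have := P0 (st_x st + al^-1 *: (x' - st_x st)); lra.
have cw : enorm (w - xs) <= rho.
  have a0 := alpha_gt0; have a1p : 0 < 1 + al by rewrite ltr_wpDl// ltW.
  rewrite -(ler_pM2l a1p) -[X in X * enorm _](ger0_norm (ltW a1p)) -enormZ.
  have -> : (1 + al) *: (w - xs) = (st_x st - xs) + al *: (momentum st - xs).
    have := inv_al inv; rewrite /accel_w /momentum; move: (st_al st) al a0 {a1 a1p} => a c c0 aa0.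
    apply/colP => i; rewrite !mxE; field.
    by rewrite !gt_eqF// ltr_wpDl// ltW.
  apply: le_trans (ler_enormD _ _) _; rewrite enormZ gtr0_norm// mulrDl mul1r.
  by rewrite lerD// ler_pM2l.
rewrite enormZ gtr0_norm//.
have : enorm (w - x') <= 2 * rho.
  by have := ler_enorm_dist xs w x'; rewrite (enorm_distC xs); lra.
move=> h; apply: le_trans (ler_wpM2l (ltW M_gt0) h) _.
by rewrite le_eqVlt; apply/orP; left; apply/eqP; rewrite /rho; field; exact: lt0r_neq0.
Qed.

Let cond1 := enorm p <= th_sc prm * enorm (st_p0 st).
Let cond2 := 2 * Num.sqrt (2 * st_tau st) * (M / st_mu st)
            * (1 + st_S0 st / st_M0 st) <= th_sc prm.

(** When mu is at most ms, the test on tau forces the gradient mapping to be small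
    by [step_p_bound], so the test on p has already succeeded. Hence mu is reduced
    only while it is too large. *)
Lemma reduction_mu : ~~ cond1 -> cond2 -> ms < st_mu st.
Proof.
move=> /negP n1 c2; rewrite ltNge; apply/negP => mums; apply: n1; rewrite /cond1.
apply: le_trans (step_p_bound mums) _; rewrite /base_bound mulrA.
by rewrite ler_wpM2r ?enorm_ge0.
Qed.

(** A reduction of mu restarts the stage at its own base point, where
    [initial_potential] holds again once mu is small enough. In the last branch the
    gradient mapping is nonzero, which by [step_alpha] keeps the weight at most 1. *)
Lemma step_inv : solver_inv (apg_next prm phi r st j).
Proof.
have /andP[M1 M2] := step_M; have /andP[m1 m2] := inv_mu inv.
have [gi gd gs /andP[th0 th1]] := prm_ok.
rewrite /apg_next -/cond1 -/cond2; case: ifPn => c1.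
  apply: stage_start_inv => //; [exact: step_dom|exact: step_M|exact: inv_mu|exact: step_Sratio|].
  exact: step_residual.
case: ifPn => c2.
  have mums := reduction_mu c1 c2.
  have gs0 : 0 < gam_sc prm by rewrite (lt_trans ltr01).
  have mu' : mulow <= st_mu st / gam_sc prm <= L_min prm.
    apply/andP; split.
      by apply: le_trans mulow_le _; rewrite ler_pM2r ?invr_gt0// ltW.
    by apply: le_trans m2; rewrite ler_pdivrMr// ler_peMr ?(ltW mu_gt0)// ltW.
  have [xi hxi hn] := inv_base inv.
  have x0X := inv_x0 inv.
  split=> //=; first exact: inv_L0 inv.
  - exact: inv_L0 inv.
  - exact: inv_M0 inv.
  - by left.
  - exact: inv_S0 inv.
  - by exists xi.
  - move=> mu'ms; split=> //.
    rewrite /potential /momentum /= mul1r invr1 scale1r subrr addr0.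
    apply: initial_potential hn => //; apply/andP; split=> //.
    by rewrite divr_gt0.
have al0 := alpha_gt0.
split=> //=.
- exact: step_dom.
- exact: inv_x inv.
- exact: inv_x0 inv.
- rewrite le_max Mlow_le/= ge_max Mup_ge/=; apply: le_trans M2.
  by rewrite ler_pdivrMr ?(lt_le_trans ltr01)// ler_peMr// ltW.
- exact: inv_L0 inv.
- exact: inv_M0 inv.
- exact: inv_mu inv.
- right; rewrite [leLHS]alpha_sqr [leRHS]mulrAC ler_wpM2r ?sqr_ge0//.
  apply: (@le_trans _ _ (gam_dec prm ^+ 2 * (M / gam_dec prm))); last first.
    by rewrite ler_wpM2l ?sqr_ge0// le_max lexx orbT.
  rewrite [leRHS](_ : _ = gam_dec prm * M); first by rewrite ler_peMl// ltW.
  by field; rewrite gt_eqF// (lt_le_trans ltr01).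
- exact: inv_S0 inv.
- exact: inv_base inv.
- move=> mums; have [t0 _ _] := inv_pot inv mums.
  have [a1|p0] := step_alpha mums; last first.
    by move: c1; rewrite /cond1 p0 enorm0 mulr_ge0 ?enorm_ge0// ltW.
  split=> //; first by rewrite mulr_ge0// subr_ge0.
  exact: step_potential.
Qed.

Variables (K1 q eps : R).
Hypotheses (q01 : 0 <= q <= 1) (q_le : q ^+ 2 * Mup <= mulow)
  (K1_ge : 2 * Num.sqrt 2 * (Mup / mulow) * (1 + Lam / Mlow) <= K1).

(** The quantity (a + b) * T.+1 + s decreases: a new base point uses up one b, a
    reduction of mu one a, and both reset s to T; any other step uses up one s. None
    of the counters can be empty when needed: with b = 0 the stopping test would
    have succeeded, with a = 0 mu is below ms and is not reduced, and with s = 0 tau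
    is so small that the test on tau succeeds. *)
Lemma step_progress (a b s T : nat) : K1 * Num.sqrt ((1 - q) ^+ T) <= th_sc prm ->
  eps < omega phi r x' -> progress K1 q eps st a b s ->
  exists a' b' s' : nat, progress K1 q eps (apg_next prm phi r st j) a' b' s' /\
    ((a' + b') * T.+1 + s' < (a + b) * T.+1 + s)%N.
Proof.
move=> hT om [ha hb hs]; have /andP[M1 M2] := step_M; have /andP[m1 m2] := inv_mu inv.
have [gi gd gs /andP[th0 th1]] := prm_ok.
have LM0 : 0 <= 1 + Lam / Mlow by rewrite addr_ge0// divr_ge0// ltW.
have K10 : 0 <= K1.
  apply: le_trans K1_ge; rewrite !mulr_ge0 ?sqrtr_ge0 ?invr_ge0 ?(ltW mulow_gt0)//.
  exact: le_trans (ltW M_gt0) M2.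
rewrite /apg_next -/cond1 -/cond2; case: ifPn => c1.
  case: b hb => [|b] hb.
    exfalso; move: om; rewrite ltNge => /negP; apply.
    apply: le_trans step_omega _; apply: le_trans hb; rewrite expr0 mulr1 ler_wpM2l//.
    by apply: le_trans c1 _; rewrite ler_piMl ?enorm_ge0// ltW.
  exists a, b, T; split; last by rewrite addnS lex_total leq_addr.
  split=> //=; last by rewrite mul1r.
  apply: le_trans hb.
  rewrite [leRHS](_ : _ = (1 + Lam / Mlow) * th_sc prm ^+ b * (th_sc prm * enorm (st_p0 st))); last by rewrite exprSr; ring.
  by rewrite ler_wpM2l// mulr_ge0// exprn_ge0// ltW.
case: ifPn => c2.
  have mums := reduction_mu c1 c2.
  case: a ha => [|a] ha; first by move: mums; rewrite ltNge -[ms]mulr1 ha.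
  exists a, b, T; split; last by rewrite addSn lex_total leq_addr.
  split=> //=; last by rewrite mul1r.
  by rewrite ler_pdivrMr ?(lt_trans ltr01)// -mulrA -exprSr.
have tau0 : 0 < st_tau st.
  rewrite ltNge; apply/negP => tau0; move/negP: c2; apply; rewrite /cond2.
  by rewrite ler0_sqrtr ?mulr_ge0_le0// mulr0 !mul0r ltW.
have /andP[S0 S1] := inv_S0 inv; have /andP[N1 N2] := inv_M0 inv.
have tauK : 2 * Num.sqrt (2 * st_tau st) * (M / st_mu st) * (1 + st_S0 st / st_M0 st)
   <= K1 * Num.sqrt (st_tau st).
  rewrite sqrtrM// [X in X <= _](_ : _ = 2 * Num.sqrt 2 * (M / st_mu st) * (1 + st_S0 st / st_M0 st) * Num.sqrt (st_tau st)); last by ring.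
  rewrite ler_wpM2r ?sqrtr_ge0//; apply: le_trans K1_ge.
  have i1 : M / st_mu st <= Mup / mulow.
    by rewrite ler_pM ?invr_ge0 ?(ltW M_gt0) ?(ltW mu_gt0)// lef_pV2 ?posrE.
  have i2 : st_S0 st / st_M0 st <= Lam / Mlow.
    have N0 : 0 < st_M0 st by apply: lt_le_trans N1.
    by rewrite ler_pM ?invr_ge0 ?(ltW N0)// lef_pV2 ?posrE.
  rewrite ler_pM//.
  - apply: mulr_ge0; first by rewrite mulr_ge0 ?sqrtr_ge0.
    exact: divr_ge0 (ltW M_gt0) (ltW mu_gt0).
  - by rewrite addr_ge0// divr_ge0// (le_trans (ltW Mlow_gt0)).
  - by rewrite ler_wpM2l// mulr_ge0 ?sqrtr_ge0.
  - by rewrite lerD2l.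
case: s hs => [|s] hs.
  by exfalso; move/negP: c2; apply; rewrite /cond2; apply: le_trans tauK _; move: hs; rewrite expr0 mulr1.
exists a, b, s; split; last by rewrite addnS.
split=> //=; apply: le_trans hs; rewrite ler_wpM2l// ler_wsqrtr//.
rewrite exprS mulrA ler_wpM2r ?exprn_ge0 ?subr_ge0//; first by case/andP: q01.
rewrite ler_pM2l// lerD2l lerN2.
have q0 : 0 <= q by case/andP: q01.
rewrite -(@ler_pXn2r _ 2)// ?nnegrE ?(ltW alpha_gt0)//.
rewrite sqr_sqrtr ?divr_ge0 ?(ltW M_gt0) ?(ltW mu_gt0)// ler_pdivlMr//.
apply: le_trans m1; apply: le_trans q_le; by rewrite ler_wpM2l ?sqr_ge0.
Qed.

End Step.

Section Loop.
Variables (K1 q eps D : R) (T J A B : nat).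
Hypotheses (q01 : 0 <= q <= 1) (q_le : q ^+ 2 * Mup <= mulow)
  (K1_ge : 2 * Num.sqrt 2 * (Mup / mulow) * (1 + Lam / Mlow) <= K1)
  (T_large : K1 * Num.sqrt ((1 - q) ^+ T) <= th_sc prm)
  (J_large : forall L j, Mlow <= L -> L * gam_inc prm ^+ j <= Mup -> (j.+1 <= J)%N)
  (A_large : L_min prm <= ms * gam_sc prm ^+ A)
  (B_large : (1 + Lam / Mlow) * th_sc prm ^+ B * (Mup * D) <= eps)
  (dom_D : forall x y, X x -> X y -> enorm (x - y) <= D).

Lemma loop_terminates N st a b s : solver_inv st -> progress K1 q eps st a b s ->
  ((a + b) * T.+1 + s <= N)%N ->
  exists x L mu c, apg_loop prm phi r eps st x L mu c.
Proof.
elim: N st a b s => [|N IH] st a b s inv prog hN.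
all: have [j search] := search_exists (inv_L_gt0 inv) (fun L => @accel_w_extrapolated st L inv).
all: have [om|om] := leP (omega phi r (accel_x prm phi r st j)) eps;
  first by do 4 eexists; apply: apg_stop search om.
all: have [a' [b' [s' [prog' lt]]]] := step_progress inv search q01 q_le K1_ge T_large om prog.
  by have := leq_trans lt hN.
have hN' : ((a' + b') * T.+1 + s' <= N)%N by rewrite -ltnS (leq_trans lt).
have [x [L [mu [c loop]]]] := IH _ _ _ _ (step_inv inv search) prog' hN'.
by do 4 eexists; apply: apg_continue search om loop.
Qed.

(** The counter falls with every pass, and a pass costs at most J proximal steps. *)
Lemma loop_bound st x L mu c : apg_loop prm phi r eps st x L mu c ->
  forall a b s, solver_inv st -> progress K1 q eps st a b s ->
  [/\ X x, omega phi r x <= eps, Mlow <= L <= Mup, mulow <= mu <= L_min prm &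
      (c <= J * ((a + b) * T.+1 + s).+1)%N].
Proof.
elim=> {st x L mu c} [st j search om|st j x L mu c search om loop IH] a b s inv prog.
all: have MM := step_M inv search; have /andP[_ M2] := MM.
all: have /andP[L1 _] := inv_L inv; have jJ := J_large L1 M2.
  split=> //; [exact: step_dom inv search|exact: inv_mu (step_inv inv search)|].
  by rewrite (leq_trans jJ)// leq_pmulr.
have [a' [b' [s' [prog' lt]]]] := step_progress inv search q01 q_le K1_ge T_large om prog.
have [Xx hom hL hmu hc] := IH _ _ _ (step_inv inv search) prog'.
split=> //; rewrite mulnS leq_add//; apply: leq_trans hc _.
by rewrite leq_mul2l lt orbT.
Qed.

Section Call.
Variables (xini : 'cV[R]_d) (Lini mu0 : R).
Hypotheses (xini_dom : X xini) (Lini_bounds : Mlow <= Lini <= Mup)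
  (mu0_bounds : mulow <= mu0 <= L_min prm).

Let Lini_gt0 : 0 < Lini.
Proof. by case/andP: Lini_bounds => h _; apply: lt_le_trans h. Qed.

Let W_ini (L : R) : Lini <= L -> W xini. Proof. by move=> _; exact: W_dom. Qed.

Lemma line_search_bounds j : line_search prm phi r xini Lini j ->
  Mlow <= trial prm Lini j <= Mup.
Proof.
move=> search; have /andP[l u] := Lini_bounds.
rewrite (le_trans l) ?trial_ge//=.
apply: le_trans (search_le Lini_gt0 W_ini search) _.
by rewrite ge_max u Mup_Lam.
Qed.

Lemma init_inv j : line_search prm phi r xini Lini j ->
  solver_inv (apg_init phi r xini (trial prm Lini j) mu0).
Proof.
move=> search; have MM := line_search_bounds search.
have M0 : 0 < trial prm Lini j by case/andP: MM => h _; apply: lt_le_trans h.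
have Wx := W_dom xini_dom.
apply: stage_start_inv => //; first exact: prox_dom.
  by rewrite Sratio_ge0 Sratio_le.
exact: prox_residual.
Qed.

Lemma init_progress j : line_search prm phi r xini Lini j ->
  progress K1 q eps (apg_init phi r xini (trial prm Lini j) mu0) A B T.
Proof.
move=> search; have /andP[M1 M2] := line_search_bounds search.
have M0 : 0 < trial prm Lini j by apply: lt_le_trans M1.
have [gi gd gs /andP[th0 th1]] := prm_ok.
split; rewrite /= ?mul1r//; first by case/andP: mu0_bounds => _ h; apply: le_trans A_large.
apply: le_trans B_large; rewrite ler_wpM2l//.
  by rewrite mulr_ge0 ?exprn_ge0 ?(ltW th0)// addr_ge0// divr_ge0// ltW.
rewrite enormZ gtr0_norm// ler_pM ?enorm_ge0 ?(ltW M0)//.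
by apply: dom_D => //; apply: prox_dom => //; exact: W_dom.
Qed.

Lemma adap_apg_exists : exists x L mu c, adap_apg prm phi r xini Lini mu0 eps x L mu c.
Proof.
have [j search] := search_exists Lini_gt0 W_ini.
have [x [L [mu [c loop]]]] := loop_terminates (init_inv search) (init_progress search) (leqnn _).
by exists x, L, mu, (j.+1 + c)%N, j, c.
Qed.

Lemma adap_apg_bound x L mu c : adap_apg prm phi r xini Lini mu0 eps x L mu c ->
  [/\ X x, omega phi r x <= eps, Mlow <= L <= Mup, mulow <= mu <= L_min prm &
      (c <= J * ((A + B).+1 * T.+1).+1)%N].
Proof.
move=> [j [c' [search loop ->]]].
have [Xx hom hL hmu hc] := loop_bound loop (init_inv search) (init_progress search).
have /andP[_ M2] := line_search_bounds search; have /andP[L1 _] := Lini_bounds.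
split=> //; rewrite mulnS leq_add//; first exact: J_large M2.
by apply: leq_trans hc _; rewrite lex_total.
Qed.

End Call.
End Loop.

End AdaptiveSolver.

(** * Curvature of the penalized objective *)

Section BoundsCalculus.
Context {R : realType} {d : nat}.
Implicit Types (x y z v w : 'cV[R]_d) (h : 'cV[R]_d -> R) (q : 'cV[R]_d -> 'cV[R]_d)
  (mu L a : R) (W X : set 'cV[R]_d).

Definition upper_quad_on W X L h q := forall w z, W w -> X z ->
  h z <= h w + dot (q w) (z - w) + L / 2 * enorm (z - w) ^+ 2.

Definition lipschitz_on_pairs W X L q := forall w z, W w -> X z ->
  enorm (q z - q w) <= L * enorm (z - w).

Lemma upper_quad_on_le W X L L' h q : L <= L' -> upper_quad_on W X L h q ->
  upper_quad_on W X L' h q.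
Proof.
move=> le H w z Ww Xz; apply: le_trans (H w z Ww Xz) _; rewrite lerD2l.
by rewrite ler_wpM2r ?sqr_ge0// ler_wpM2r.
Qed.

Lemma lipschitz_on_pairs_le W X L L' q : L <= L' -> lipschitz_on_pairs W X L q ->
  lipschitz_on_pairs W X L' q.
Proof.
move=> le H w z Ww Xz; apply: le_trans (H w z Ww Xz) _.
by rewrite ler_wpM2r// enorm_ge0.
Qed.

Lemma quad_gradD h1 h2 x (q1 q2 : 'cV[R]_d) : quad_grad h1 x q1 -> quad_grad h2 x q2 ->
  quad_grad (fun z => h1 z + h2 z) x (q1 + q2).
Proof.
move=> [C1 H1] [C2 H2]; exists (C1 + C2) => v v1.
have := H1 v v1; have := H2 v v1; rewrite dotDl !ler_norml => /andP[a b] /andP[c e].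
by apply/andP; split; lra.
Qed.

Lemma quad_gradZ a h x (q : 'cV[R]_d) : quad_grad h x q ->
  quad_grad (fun z => a * h z) x (a *: q).
Proof.
move=> [C H]; exists (`|a| * C) => v v1.
rewrite dotZl -!mulrBr normrM -mulrA ler_wpM2l//; exact: H.
Qed.

Lemma lower_quadD mu1 mu2 h1 h2 q1 q2 : lower_quad mu1 h1 q1 -> lower_quad mu2 h2 q2 ->
  lower_quad (mu1 + mu2) (fun z => h1 z + h2 z) (fun z => q1 z + q2 z).
Proof. by move=> H1 H2 x z; have := H1 x z; have := H2 x z; rewrite dotDl; lra. Qed.

Lemma lower_quadZ mu a h q : 0 <= a -> lower_quad mu h q ->
  lower_quad (a * mu) (fun z => a * h z) (fun z => a *: q z).
Proof. by move=> a0 H x z; have := ler_wpM2l a0 (H x z); rewrite dotZl; lra. Qed.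

Lemma upper_quad_onD W X L1 L2 h1 h2 q1 q2 :
  upper_quad_on W X L1 h1 q1 -> upper_quad_on W X L2 h2 q2 ->
  upper_quad_on W X (L1 + L2) (fun z => h1 z + h2 z) (fun z => q1 z + q2 z).
Proof.
by move=> H1 H2 w z Ww Xz; have := H1 w z Ww Xz; have := H2 w z Ww Xz; rewrite dotDl; lra.
Qed.

Lemma upper_quad_onZ W X L a h q : 0 <= a -> upper_quad_on W X L h q ->
  upper_quad_on W X (a * L) (fun z => a * h z) (fun z => a *: q z).
Proof.
by move=> a0 H w z Ww Xz; have := ler_wpM2l a0 (H w z Ww Xz); rewrite dotZl; lra.
Qed.

Lemma lipschitz_on_pairsD W X L1 L2 q1 q2 :
  lipschitz_on_pairs W X L1 q1 -> lipschitz_on_pairs W X L2 q2 ->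
  lipschitz_on_pairs W X (L1 + L2) (fun z => q1 z + q2 z).
Proof.
move=> H1 H2 w z Ww Xz; rewrite opprD addrACA mulrDl.
by apply: le_trans (ler_enormD _ _) _; rewrite lerD ?H1 ?H2.
Qed.

Lemma lipschitz_on_pairsZ W X L a q : 0 <= a -> lipschitz_on_pairs W X L q ->
  lipschitz_on_pairs W X (a * L) (fun z => a *: q z).
Proof.
move=> a0 H w z Ww Xz; rewrite -scalerBr enormZ ger0_norm// -mulrA.
by rewrite ler_wpM2l// H.
Qed.

Lemma quad_grad_sum m (h : 'I_m -> 'cV[R]_d -> R) x (q : 'I_m -> 'cV[R]_d) :
  (forall i, quad_grad (h i) x (q i)) ->
  quad_grad (fun z => \sum_i h i z) x (\sum_i q i).
Proof.
move=> /choice[C H]; exists (\sum_i C i) => v v1.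
rewrite dot_suml -!sumrB mulr_suml; apply: le_trans (ler_norm_sum _ _ _) _.
by apply: ler_sum => i _; exact: H.
Qed.

Lemma lower_quad_sum m (h : 'I_m -> 'cV[R]_d -> R) (q : 'I_m -> 'cV[R]_d -> 'cV[R]_d) :
  (forall i, lower_quad 0 (h i) (q i)) ->
  lower_quad 0 (fun z => \sum_i h i z) (fun z => \sum_i q i z).
Proof.
move=> H x z; rewrite dot_suml mul0r mul0r addr0 -big_split; apply: ler_sum => i _.
by have := H i x z; rewrite mul0r mul0r addr0.
Qed.

Lemma upper_quad_on_sum m W X L (h : 'I_m -> 'cV[R]_d -> R) (q : 'I_m -> 'cV[R]_d -> 'cV[R]_d) :
  (forall i, upper_quad_on W X L (h i) (q i)) ->
  upper_quad_on W X (m%:R * L) (fun z => \sum_i h i z) (fun z => \sum_i q i z).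
Proof.
move=> H w z Ww Xz; rewrite dot_suml.
have -> : m%:R * L / 2 * enorm (z - w) ^+ 2 = \sum_(i < m) L / 2 * enorm (z - w) ^+ 2.
  by rewrite sumr_const card_ord -[RHS]mulr_natl; ring.
by rewrite -!big_split; apply: ler_sum => i _; exact: H.
Qed.

Lemma lipschitz_on_pairs_sum m W X L (q : 'I_m -> 'cV[R]_d -> 'cV[R]_d) :
  (forall i, lipschitz_on_pairs W X L (q i)) ->
  lipschitz_on_pairs W X (m%:R * L) (fun z => \sum_i q i z).
Proof.
move=> H w z Ww Xz; rewrite -sumrB; apply: le_trans (ler_enorm_sum _ _ _) _.
have -> : m%:R * L * enorm (z - w) = \sum_(i < m) L * enorm (z - w).
  by rewrite sumr_const card_ord -[RHS]mulr_natl; ring.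
by apply: ler_sum => i _; exact: H.
Qed.

Section HalfSquareDistance.
Variable a : 'cV[R]_d.
Local Notation h := (fun z : 'cV[R]_d => 2^-1 * enorm (z - a) ^+ 2).
Local Notation q := (fun z : 'cV[R]_d => z - a).

Lemma half_sqr_dist_expand x z : h z = h x + dot (q x) (z - x) + 1 / 2 * enorm (z - x) ^+ 2.
Proof.
have -> : z - a = (x - a) + (z - x) by rewrite [RHS]addrC subrKA.
by rewrite enorm_sqrD; field.
Qed.

Lemma half_sqr_dist_lower : lower_quad 1 h q.
Proof. by move=> x z; rewrite -half_sqr_dist_expand. Qed.

Lemma half_sqr_dist_upper : upper_quad 1 h q.
Proof. by move=> x z; rewrite -half_sqr_dist_expand. Qed.

End HalfSquareDistance.

Section HalfSquareAffine.
Variables (n : nat) (B : 'M[R]_(n, d)) (b : 'cV[R]_n).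
Local Notation h := (fun z : 'cV[R]_d => 2^-1 * enorm (B *m z - b) ^+ 2).
Local Notation q := (fun z : 'cV[R]_d => B^T *m (B *m z - b)).

Lemma half_sqr_affine_expand x z :
  h z = h x + dot (q x) (z - x) + 2^-1 * enorm (B *m (z - x)) ^+ 2.
Proof.
rewrite dot_trmx mulmxBr.
have -> : B *m z - b = (B *m x - b) + (B *m z - B *m x) by rewrite [RHS]addrC subrKA.
by rewrite enorm_sqrD; field.
Qed.

Lemma half_sqr_affine_lower : lower_quad 0 h q.
Proof.
move=> x z; rewrite (half_sqr_affine_expand x z) mul0r mul0r addr0 lerDl.
by rewrite mulr_ge0// sqr_ge0.
Qed.

Lemma half_sqr_affine_upper :
  exists2 L, 0 <= L & upper_quad L h q /\ forall x z, enorm (q z - q x) <= L * enorm (z - x).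
Proof.
have [c c0 hc] := enorm_mulmx B; have [c' c'0 hc'] := enorm_mulmx B^T.
exists (c ^+ 2 + c' * c); first by rewrite addr_ge0 ?sqr_ge0 ?mulr_ge0.
split=> [x z|x z].
  rewrite [leLHS](half_sqr_affine_expand x z) lerD2l.
  have : enorm (B *m (z - x)) ^+ 2 <= c ^+ 2 * enorm (z - x) ^+ 2.
    by rewrite -exprMn ler_pXn2r// ?nnegrE ?mulr_ge0 ?enorm_ge0.
  have : 0 <= c' * c * enorm (z - x) ^+ 2 by rewrite mulr_ge0 ?sqr_ge0// mulr_ge0.
  by lra.
have -> : B^T *m (B *m z - b) - B^T *m (B *m x - b) = B^T *m (B *m (z - x)).
  by rewrite -mulmxBr opprB addrA subrK -mulmxBr.
apply: le_trans (hc' _) _; rewrite mulrDl.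
have := ler_wpM2l c'0 (hc (z - x)); rewrite mulrA => h1.
have : 0 <= c ^+ 2 * enorm (z - x) by rewrite mulr_ge0 ?sqr_ge0 ?enorm_ge0.
by lra.
Qed.

End HalfSquareAffine.

Section HalfSquarePositivePart.
Variables (f : 'cV[R]_d -> R) (q : 'cV[R]_d -> 'cV[R]_d) (L : R).
Hypotheses (L0 : 0 <= L) (f_lower : lower_quad 0 f q) (f_upper : upper_quad L f q).
Local Notation pp x := (Num.max 0 (f x)).

(** Half the squared positive part is convex with derivative the positive part,
    which is 1-Lipschitz. *)
Lemma pos_part_sqr (u v : R) :
  [/\ 2^-1 * Num.max 0 u ^+ 2 + Num.max 0 u * (v - u) <= 2^-1 * Num.max 0 v ^+ 2 &
      2^-1 * Num.max 0 v ^+ 2 <= 2^-1 * Num.max 0 u ^+ 2 + Num.max 0 u * (v - u)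
        + 2^-1 * (v - u) ^+ 2].
Proof.
have u2 := sqr_ge0 u; have v2 := sqr_ge0 v; have w2 := sqr_ge0 (v - u).
case: (leP 0 u) => hu; case: (leP 0 v) => hv; rewrite ?expr0n /= ?mulr0 ?mul0r ?add0r; split; try lra.
- have : 0 <= u * (- v) by rewrite mulr_ge0// oppr_ge0 ltW.
  lra.
- have : 0 <= - u * v by rewrite mulr_ge0// oppr_ge0 ltW.
  lra.
Qed.

Lemma convex_smooth_variation x z :
  `|f z - f x| <= (enorm (q x) + L * enorm (z - x)) * enorm (z - x).
Proof.
have := f_lower x z; have := f_upper x z; rewrite mul0r mul0r addr0.
have := Cauchy_Schwarz_abs (q x) (z - x); rewrite !ler_norml => /andP[c1 c2] h1 h2.
have n2 : 0 <= L * enorm (z - x) ^+ 2 by rewrite mulr_ge0 ?sqr_ge0.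
by apply/andP; split; lra.
Qed.

Lemma half_sqr_pos_lower :
  lower_quad 0 (fun z => 2^-1 * pp z ^+ 2) (fun z => pp z *: q z).
Proof.
move=> x z; rewrite mul0r mul0r addr0 dotZl.
have [h1 _] := pos_part_sqr (f x) (f z); apply: le_trans h1; rewrite lerD2l.
rewrite ler_wpM2l ?le_max ?lexx//.
by have := f_lower x z; rewrite mul0r mul0r addr0; lra.
Qed.

(** The curvature of half of [f]_+^2 is [f]_+ times the curvature of f, plus the
    squared slope of f; both are bounded only where f and its gradient are, and the
    bound E on the distance propagates them along the segment. *)
Lemma half_sqr_pos_upper (b E : R) x z : pp x <= b -> enorm (q x) <= b -> enorm (z - x) <= E ->
  2^-1 * pp z ^+ 2 <= 2^-1 * pp x ^+ 2 + dot (pp x *: q x) (z - x)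
    + (b * L + (b + L * E) ^+ 2) / 2 * enorm (z - x) ^+ 2.
Proof.
move=> hb hq hE; have [_ h1] := pos_part_sqr (f x) (f z); apply: le_trans h1 _.
rewrite dotZl -!addrA lerD2l.
have p0 : 0 <= pp x by rewrite le_max lexx.
have n0 := enorm_ge0 (z - x).
have n2 := sqr_ge0 (enorm (z - x)).
have := ler_wpM2l p0 (_ : f z - f x <= dot (q x) (z - x) + L / 2 * enorm (z - x) ^+ 2).
have := f_upper x z => up /(_ _) h2.
have {}h2 : pp x * (f z - f x) <= pp x * (dot (q x) (z - x) + L / 2 * enorm (z - x) ^+ 2).
  by apply: h2; lra.
have h3 : pp x * (L / 2 * enorm (z - x) ^+ 2) <= b * (L / 2 * enorm (z - x) ^+ 2).
  by rewrite ler_wpM2r// mulr_ge0// divr_ge0.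
have h4 : (f z - f x) ^+ 2 <= ((b + L * E) * enorm (z - x)) ^+ 2.
  rewrite -(real_normK (num_real (f z - f x))).
  have bE : 0 <= b + L * E.
    by rewrite addr_ge0 ?(le_trans p0 hb)// mulr_ge0// (le_trans n0).
  rewrite ler_pXn2r// ?nnegrE ?mulr_ge0//.
  apply: le_trans (convex_smooth_variation x z) _; rewrite ler_wpM2r//.
  by rewrite lerD// ler_wpM2l.
by move: h2 h3 h4; rewrite exprMn; lra.
Qed.

Lemma half_sqr_pos_quad_grad x :
  quad_grad (fun z => 2^-1 * pp z ^+ 2) x (pp x *: q x).
Proof.
set b := Num.max (pp x) (enorm (q x)).
have b1 : pp x <= b by rewrite /b le_max lexx.
have b2 : enorm (q x) <= b by rewrite /b le_max lexx orbT.
have b0 : 0 <= b by rewrite (le_trans _ b2)// enorm_ge0.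
exists ((b * L + (b + L * 1) ^+ 2) / 2) => v v1.
have v1' : enorm (x + v - x) <= 1 by rewrite addrAC subrr add0r.
have := half_sqr_pos_lower x (x + v); rewrite mul0r mul0r addr0.
have := half_sqr_pos_upper b1 b2 v1'.
have -> : x + v - x = v by rewrite addrAC subrr add0r.
move=> h1 h2.
set c := ((b * L + (b + L * 1) ^+ 2) / 2) in h1 *.
have c0 : 0 <= c by rewrite /c divr_ge0// addr_ge0 ?sqr_ge0// mulr_ge0.
rewrite ler_norml; apply/andP; split; last by lra.
have : 0 <= c * enorm v ^+ 2 by rewrite mulr_ge0 ?sqr_ge0.
by lra.
Qed.

Lemma half_sqr_pos_lipschitz (Lq b E : R) x z :
  (enorm (q z - q x) <= Lq * enorm (z - x)) ->
  0 <= Lq -> pp x <= b -> enorm (q x) <= b -> enorm (q z) <= b -> enorm (z - x) <= E ->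
  enorm (pp z *: q z - pp x *: q x) <= ((b + L * E) * b + b * Lq) * enorm (z - x).
Proof.
move=> hL Lq0 hb hqx hqz hE.
have p0 : 0 <= pp x by rewrite le_max lexx.
have n0 := enorm_ge0 (z - x).
have -> : pp z *: q z - pp x *: q x = (pp z - pp x) *: q z + pp x *: (q z - q x).
  by rewrite scalerBl scalerBr subrKA.
apply: le_trans (ler_enormD _ _) _; rewrite !enormZ (ger0_norm p0) mulrDl.
have h1 : `|pp z - pp x| <= (b + L * E) * enorm (z - x).
  apply: (@le_trans _ _ `|f z - f x|).
    by rewrite ler_norml; case: (leP 0 (f x)) => hx; case: (leP 0 (f z)) => hz;
      have := ler_norm (f z - f x); have := ler_norm (- (f z - f x)); rewrite normrN => *; apply/andP; split; lra.
  apply: le_trans (convex_smooth_variation x z) _; rewrite ler_wpM2r//.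
  by rewrite lerD// ler_wpM2l.
have h2 : `|pp z - pp x| * enorm (q z) <= (b + L * E) * enorm (z - x) * b.
  by rewrite ler_pM// enorm_ge0.
have h3 : pp x * enorm (q z - q x) <= b * (Lq * enorm (z - x)).
  by rewrite ler_pM// enorm_ge0.
by lra.
Qed.

End HalfSquarePositivePart.

End BoundsCalculus.

Record assumptions (R : realType) (d n m : nat) (P : problem R d n m)
    (Lf0 : R) (Lf : 'I_m -> R) (G M Bf0 : R) (Bf : 'I_m -> R) (rho0 : R)
    (xfeas : 'cV[R]_d) : Prop := Assumptions {
  as_well_posed : well_posed P;
  as_general : general_assumptions P Lf0 Lf G M;
  as_data : data_bounds P Bf0 Bf;
  as_convex : convex_constraint_assumptions P rho0 xfeas }.

Section Penalty.
Context {R : realType} {d n m : nat} (P : problem R d n m).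
Variables (Lf0 : R) (Lf : 'I_m -> R) (G M Bf0 : R) (Bf : 'I_m -> R) (rho0 : R)
  (xfeas : 'cV[R]_d).
Hypothesis S : assumptions P Lf0 Lf G M Bf0 Bf rho0 xfeas.
Implicit Types (x z w xk : 'cV[R]_d) (i : 'I_m).
Local Notation X := (dom_g P).

(** The objective [ippp_phi] as a function of its centre and of the two weights
    only, so that the weight beta can be varied freely. *)
Definition penalty (gam beta : R) xk x : R :=
  f0 P x + gam / 2 * enorm (x - xk) ^+ 2
  + beta / 2 * (enorm (cons_eq P x) ^+ 2 + enorm (cons_plus P x) ^+ 2).

Definition penalty_grad (gam beta : R) xk x : 'cV[R]_d :=
  lagr_grad P x (beta *: cons_plus P x) (beta *: cons_eq P x) + gam *: (x - xk).

Definition Lc : R := \sum_i `|Lf i|.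

Lemma Lc_ge0 : 0 <= Lc. Proof. exact: sumr_ge0. Qed.

Lemma rho0_ge0 : 0 <= rho0. Proof. by case: S => _ _ _ [[]]. Qed.

Lemma f0_lower : lower_quad (- rho0) (f0 P) (grad (f0 P)).
Proof.
case: S => -[[df0 _] _ _ _] _ _ [[_ wc] _ _]; exact: weakly_convex_lower_quad.
Qed.

Lemma f0_upper : upper_quad `|Lf0| (f0 P) (grad (f0 P)).
Proof.
case: S => _ [[[_ sm] _] _ _] _ _; apply: upper_quad_le (ler_norm Lf0) _ => x z; exact: sm.
Qed.

Lemma fc_lower i : lower_quad 0 (fc P i) (grad (fc P i)).
Proof.
case: S => -[_ df _ _] _ _ [_ cf _]; apply: convex_lower_quad (cf i); exact: (df i).1.
Qed.

Lemma fc_upper i : upper_quad Lc (fc P i) (grad (fc P i)).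
Proof.
case: S => _ [[_ sm] _ _] _ _; apply: (@upper_quad_le _ _ (Lf i)); last by move=> x z; exact: (sm i).2.
by apply: le_trans (ler_norm _) _; rewrite /Lc (bigD1 i)//= lerDl; exact: sumr_ge0.
Qed.

Lemma f0_lip x z : enorm (grad (f0 P) x - grad (f0 P) z) <= (`|Lf0| + 1 + 2 * rho0) * enorm (x - z).
Proof. by apply: (weak_lipschitz _ rho0_ge0 f0_lower f0_upper). Qed.

Lemma fc_lip i x z : enorm (grad (fc P i) x - grad (fc P i) z) <= (Lc + 1) * enorm (x - z).
Proof.
have := @weak_lipschitz _ _ Lc 0 (fc P i) (grad (fc P i)) Lc_ge0 (lexx _).
rewrite oppr0 mulr0 addr0; apply; [exact: fc_lower|exact: fc_upper].
Qed.

Lemma g_Noo x : g P x != -oo%E. Proof. by case: S => -[_ _ [[]]]. Qed.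
Lemma g_lsc : lower_semicontinuous (g P). Proof. by case: S => -[_ _ []]. Qed.
Lemma g_convex : econvex (g P). Proof. by case: S => -[_ _ []]. Qed.
Lemma dom_compact : compact X. Proof. by case: S => _ []. Qed.

Lemma g_bound x : X x -> (`|g P x| <= G%:E)%E.
Proof. by case: S => _ [_ _ h] _ _ /h[]. Qed.

Lemma g_subdiff_ex x : X x -> subdiff (g P) x !=set0.
Proof. by case: S => _ [_ _ h] _ _ /h[]. Qed.

Lemma xfeas_dom : X xfeas.
Proof. by case: S => _ _ _ [_ _ [h _ _]]; exact: interior_subset h. Qed.

Lemma diameter_ge x y : X x -> X y -> enorm (x - y) <= diameter X.
Proof.
move=> Xx Xy; have [D D0 hD] := edom_bounded dom_compact.
apply: ub_le_sup; last by exists (x, y).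
by exists D => _ [[u v] [Xu Xv] <-]; exact: hD.
Qed.

Lemma diameter_ge0 : 0 <= diameter X.
Proof. by apply: le_trans (diameter_ge xfeas_dom xfeas_dom); exact: enorm_ge0. Qed.

Lemma f0_bound x : X x -> `|f0 P x| <= Bf0 /\ enorm (grad (f0 P) x) <= Bf0.
Proof. by case: S => _ _ h _ /h[]; rewrite ge_max => /andP[]. Qed.

Lemma fc_bound i x : X x -> `|fc P i x| <= Bf i /\ enorm (grad (fc P i) x) <= Bf i.
Proof. by case: S => _ _ h _ /h[_ /(_ i)]; rewrite ge_max => /andP[]. Qed.

Lemma jac_trmx x (lam : 'cV[R]_m) :
  (jac (fc P) x)^T *m lam = \sum_i lam i 0 *: grad (fc P i) x.
Proof.
apply/colP => k; rewrite !mxE summxE; apply: eq_bigr => i _.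
by rewrite !mxE mulrC.
Qed.

Local Notation pp i x := (Num.max 0 (fc P i x)).

Lemma penaltyE gam beta xk : penalty gam beta xk = (fun x => f0 P x
  + (gam * (2^-1 * enorm (x - xk) ^+ 2)
  + beta * (2^-1 * enorm (A P *m x - b P) ^+ 2 + \sum_i 2^-1 * pp i x ^+ 2))).
Proof.
apply/funext => x; rewrite /penalty -mulr_sumr.
have -> : \sum_i pp i x ^+ 2 = enorm (cons_plus P x) ^+ 2.
  by rewrite enorm_sqr; apply: eq_bigr => i _; rewrite mxE -expr2.
by rewrite /cons_eq; field.
Qed.

Lemma penalty_gradE gam beta xk : penalty_grad gam beta xk = (fun x => grad (f0 P) x
  + (gam *: (x - xk)
  + beta *: ((A P)^T *m (A P *m x - b P) + \sum_i pp i x *: grad (fc P i) x))).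
Proof.
apply/funext => x; rewrite /penalty_grad /lagr_grad jac_trmx -scalemxAr scalerDr.
have -> : \sum_i (beta *: cons_plus P x) i 0 *: grad (fc P i) x =
    beta *: \sum_i pp i x *: grad (fc P i) x.
  by rewrite scaler_sumr; apply: eq_bigr => i _; rewrite !mxE scalerA.
by rewrite /cons_eq; apply/colP => k; rewrite !mxE; ring.
Qed.

Lemma grad_penalty gam beta xk : grad (penalty gam beta xk) = penalty_grad gam beta xk.
Proof.
apply/funext => x; apply: quad_grad_grad; rewrite penaltyE penalty_gradE.
apply: quad_gradD; first exact: quad_grad_bounds f0_lower f0_upper.
apply: quad_gradD; apply: quad_gradZ.
  exact: quad_grad_bounds (half_sqr_dist_lower xk) (half_sqr_dist_upper xk).
apply: quad_gradD.
  have [C _ [hC _]] := half_sqr_affine_upper (A P) (b P).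
  exact: quad_grad_bounds (half_sqr_affine_lower _ _) hC.
apply: quad_grad_sum => i; apply: (half_sqr_pos_quad_grad Lc_ge0); [exact: fc_lower|exact: fc_upper].
Qed.

Lemma penalty_lower gam beta xk : 0 <= gam -> 0 <= beta ->
  lower_quad (gam - rho0) (penalty gam beta xk) (penalty_grad gam beta xk).
Proof.
move=> g0 b0; rewrite penaltyE penalty_gradE.
have -> : gam - rho0 = - rho0 + (gam * 1 + beta * (0 + 0)) by ring.
apply: lower_quadD; first exact: f0_lower.
apply: lower_quadD; apply: lower_quadZ => //; first exact: half_sqr_dist_lower.
apply: lower_quadD; first exact: half_sqr_affine_lower.
by apply: lower_quad_sum => i; apply: half_sqr_pos_lower; exact: fc_lower.
Qed.

(** The constraints are bounded together with their gradients on the domain; as the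
    gradients are Lipschitz, both stay bounded at a bounded distance from it. *)
Lemma extrapolation_bounds (c : R) : 0 <= c ->
  exists bE : R * R, [/\ 0 <= bE.1, 0 <= bE.2,
    (forall w, extrapolations X c w -> forall i,
       `|fc P i w| <= bE.1 /\ enorm (grad (fc P i) w) <= bE.1) &
    (forall w z, extrapolations X c w -> X z -> enorm (z - w) <= bE.2)].
Proof.
move=> c0; pose D := diameter X; have D0 : 0 <= D := diameter_ge0.
pose B : R := \sum_i `|Bf i|.
have B0 : 0 <= B by exact: sumr_ge0.
have L0 := Lc_ge0.
have cD : 0 <= c * D by rewrite mulr_ge0.
pose b1 := B + (Lc + 1) * (c * D); pose b2 := B + (B + Lc * (c * D)) * (c * D).
have b10 : 0 <= b1 by rewrite addr_ge0// mulr_ge0// addr_ge0.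
have b20 : 0 <= b2 by rewrite addr_ge0// mulr_ge0// addr_ge0// mulr_ge0.
exists (b1 + b2, D + c * D); split=> /=; [exact: addr_ge0|by rewrite addr_ge0| |].
  move=> w [x [y [s [Xx Xy sc ->]]]] i; set w' := x + _.
  have wx : enorm (w' - x) <= c * D.
    rewrite /w' addrAC subrr add0r enormZ ler_pM ?enorm_ge0//; exact: diameter_ge.
  have [hf hg] := fc_bound i Xx.
  have BB : Bf i <= B.
    by apply: le_trans (ler_norm _) _; rewrite /B (bigD1 i)//= lerDl; exact: sumr_ge0.
  have h1 : enorm (grad (fc P i) w') <= b1.
    have := ler_enormD (grad (fc P i) w' - grad (fc P i) x) (grad (fc P i) x).
    rewrite subrK => h; apply: le_trans h _; rewrite addrC lerD ?(le_trans hg)//.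
    apply: le_trans (fc_lip _ _ _) _; rewrite ler_wpM2l// addr_ge0//.
  have h2 : `|fc P i w'| <= b2.
    have := ler_normD (fc P i w' - fc P i x) (fc P i x); rewrite subrK => h.
    apply: le_trans h _; rewrite addrC lerD ?(le_trans hf)//.
    apply: le_trans (convex_smooth_variation L0 (fc_lower i) (fc_upper i) x w') _.
    rewrite ler_pM ?enorm_ge0//; first by rewrite addr_ge0 ?mulr_ge0 ?enorm_ge0.
    by rewrite lerD ?(le_trans hg)// ler_wpM2l.
  by split; [apply: le_trans h2 _|apply: le_trans h1 _]; rewrite ?lerDl ?lerDr.
move=> w z [x [y [s [Xx Xy sc ->]]]] Xz.
apply: le_trans (ler_enorm_dist x _ _) _; rewrite lerD//; first exact: diameter_ge.
rewrite opprD addrA subrr sub0r enormN enormZ ler_pM ?enorm_ge0//; exact: diameter_ge.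
Qed.

(** The curvature grows linearly in beta and does not depend on the centre. The
    weight beta = beta_ k of order sqrt k is what makes later calls dearer. *)
Lemma penalty_smooth_on (c gam : R) : 0 <= c -> 0 <= gam ->
  exists2 Lam, 0 <= Lam & forall beta xk, 0 <= beta ->
    upper_quad_on (extrapolations X c) X (Lam * (1 + beta))
      (penalty gam beta xk) (penalty_grad gam beta xk) /\
    lipschitz_on_pairs (extrapolations X c) X (Lam * (1 + beta)) (penalty_grad gam beta xk).
Proof.
move=> c0 g0; have [[b1 E] /= [b0 E0 hb hE]] := extrapolation_bounds c0.
have [LA LA0 [hA1 hA2]] := half_sqr_affine_upper (A P) (b P).
have L0 := Lc_ge0; have r0 := rho0_ge0.
pose C1 : R := b1 * Lc + (b1 + Lc * E) ^+ 2.
pose C2 : R := (b1 + Lc * E) * b1 + b1 * (Lc + 1).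
have C10 : 0 <= C1 by rewrite addr_ge0 ?sqr_ge0 ?mulr_ge0.
have C20 : 0 <= C2 by rewrite addr_ge0 ?mulr_ge0 ?addr_ge0 ?mulr_ge0.
have Xw z : X z -> extrapolations X c z by exact: extrapolations_refl.
pose L1 : R := `|Lf0| + 1 + 2 * rho0.
have ppb i w : extrapolations X c w -> pp i w <= b1.
  by move=> /hb/(_ i)[h _]; rewrite ge_max b0 (le_trans (ler_norm _)).
have m0 : 0 <= m%:R :> R by [].
have mC1 : 0 <= m%:R * C1 by rewrite mulr_ge0.
have mC2 : 0 <= m%:R * C2 by rewrite mulr_ge0.
pose Lam : R := L1 + gam + LA + m%:R * C1 + m%:R * C2.
have L10 : 0 <= L1 by rewrite /L1 !addr_ge0 ?mulr_ge0.
have Lam0 : 0 <= Lam by do 4 (apply: addr_ge0 => //).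
exists Lam => // beta xk be0.
have p1 : 0 <= beta * (L1 + gam + m%:R * C2) by apply: mulr_ge0 => //; do 2 (apply: addr_ge0 => //).
have p2 : 0 <= beta * (L1 + gam + m%:R * C1) by apply: mulr_ge0 => //; do 2 (apply: addr_ge0 => //).
rewrite penaltyE penalty_gradE; split.
  apply: (@upper_quad_on_le _ _ _ _ (`|Lf0| + (gam * 1 + beta * (LA + m%:R * C1)))).
    rewrite /Lam; move: p1; rewrite /L1; lra.
  apply: upper_quad_onD; first by move=> w z _ _; exact: f0_upper.
  apply: upper_quad_onD; apply: upper_quad_onZ => //.
    by move=> w z _ _; exact: half_sqr_dist_upper.
  apply: upper_quad_onD; first by move=> w z _ _; exact: hA1.
  apply: upper_quad_on_sum => i w z Ww Xz.
  apply: (half_sqr_pos_upper L0 (fc_lower i) (fc_upper i)); first exact: ppb.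
    by have [] := hb _ Ww i.
  exact: hE.
apply: (@lipschitz_on_pairs_le _ _ _ _ (L1 + (gam * 1 + beta * (LA + m%:R * C2)))).
  rewrite /Lam; lra.
apply: lipschitz_on_pairsD; first by move=> w z _ _; exact: f0_lip.
apply: lipschitz_on_pairsD; apply: lipschitz_on_pairsZ => //.
  by move=> w z _ _; rewrite mul1r opprB addrA subrK.
apply: lipschitz_on_pairsD; first by move=> w z _ _; exact: hA2.
apply: lipschitz_on_pairs_sum => i w z Ww Xz.
have [_ gw] := hb _ Ww i; have [_ gz] := hb _ (Xw _ Xz) i.
apply: (half_sqr_pos_lipschitz L0 (fc_lower i) (fc_upper i)) => //; first exact: fc_lip.
- by rewrite addr_ge0.
- exact: ppb.
- exact: hE.
Qed.

End Penalty.

Arguments g_Noo {R d n m P Lf0 Lf G M Bf0 Bf rho0 xfeas} S x.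
Arguments g_bound {R d n m P Lf0 Lf G M Bf0 Bf rho0 xfeas} S [x] _.

(** * Bounds on the multipliers of the penalized problems *)

Section RayleighQuotient.
Context {R : realType}.

Lemma continuous_sum (T : topologicalType) (I : Type) (s : seq I) (f : I -> T -> R) :
  (forall i, continuous (f i)) -> continuous (fun x => \sum_(i <- s) f i x).
Proof.
move=> cf; elim: s => [|i s IH] x.
  under eq_fun do rewrite big_nil; exact: cvg_cst.
under eq_fun do rewrite big_cons.
by apply: continuousD; [exact: cf|exact: IH].
Qed.

Lemma continuous_sqr_mulmx (n d : nat) (B : 'M[R]_(d, n)) :
  continuous (fun u : 'rV[R]_n => enorm (B *m u^T) ^+ 2).
Proof.
have E : (fun u : 'rV[R]_n => enorm (B *m u^T) ^+ 2) =
    (fun u => \sum_(j < d) (\sum_(i < n) B j i * u 0 i) * (\sum_(i < n) B j i * u 0 i)).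
  apply/funext => u; rewrite enorm_sqr; apply: eq_bigr => j _; rewrite mxE.
  by under eq_bigr do rewrite mxE.
rewrite E; apply: continuous_sum => j x.
have c : continuous (fun u : 'rV[R]_n => \sum_(i < n) B j i * u 0 i).
  apply: continuous_sum => i y.
  apply: (@continuousM _ _ (fun=> B j i) (fun u : 'rV[R]_n => u 0 i)); first exact: cst_continuous.
  exact: coord_continuous.
by apply: continuousM; exact: c.
Qed.

Lemma unit_sphere_compact (n : nat) : compact [set u : 'rV[R]_n | enorm u^T ^+ 2 = 1].
Proof.
apply: bounded_closed_compact.
  exists 1; split=> // c c1 u /= u1; apply: le_trans (ltW c1).
  have -> : `|u| = `|u^T|.
    rewrite /Num.Def.normr /= !mx_normrE; apply/eqP; rewrite eq_le; apply/andP; split.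
      apply/bigmax_leP; split=> [|[i j] _ /=].
        by apply/bigmax_geP; left.
      by apply/bigmax_geP; right; exists (j, i); rewrite //= mxE.
    apply/bigmax_leP; split=> [|[i j] _ /=].
      by apply/bigmax_geP; left.
    by apply/bigmax_geP; right; exists (j, i); rewrite //= mxE.
  apply: le_trans (mx_norm_le_enorm _) _.
  by rewrite -(@ler_pXn2r _ 2)// ?nnegrE ?enorm_ge0// u1 expr1n.
have -> : [set u : 'rV[R]_n | enorm u^T ^+ 2 = 1] =
    (fun u : 'rV[R]_n => enorm (1%:M *m u^T) ^+ 2) @^-1` [set 1].
  by apply/seteqP; split=> u /=; rewrite mul1mx.
by apply: (continuous_closedP _).1; [exact: continuous_sqr_mulmx|exact: closed_eq].
Qed.

Section GramMatrix.
Variables (n d : nat) (A : 'M[R]_(n.+1, d)).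
Local Notation S := (A *m A^T).
Local Notation q v := (enorm (A^T *m v) ^+ 2).

Lemma eigenvalue_gram a : eigenvalue S a ->
  exists2 v : 'cV[R]_n.+1, 0 < enorm v ^+ 2 & q v = a * enorm v ^+ 2.
Proof.
move=> /eigenvalueP[u hu u0]; exists u^T.
  rewrite exprn_gt0// lt_neqAle enorm_ge0 andbT eq_sym; apply: contra u0 => /eqP /enorm_eq0.
  by move=> /(congr1 trmx); rewrite trmxK trmx0 => ->.
have hc : A *m A^T *m u^T = a *: u^T.
  by have := congr1 trmx hu; rewrite !trmx_mul trmxK linearZ.
by rewrite !enorm_sqr dot_trmx mulmxA hc dotZr.
Qed.

Lemma gram_expand (u v : 'cV[R]_n.+1) (t : R) :
  q (u + t *: v) = q u + 2 * t * dot v (S *m u) + t ^+ 2 * q v.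
Proof.
rewrite mulmxDr -scalemxAr enorm_sqrD enormZ exprMn real_normK ?num_real//.
by rewrite dotZr -[in dot _ (_ *m u)]mulmxA -dot_trmx [dot (A^T *m v) _]dotC; ring.
Qed.

(** The minimum of the Rayleigh quotient on the unit sphere is an eigenvalue: if
    w = S u - rho u were nonzero at the minimizer u, moving from u by a small negative
    multiple of w would push the quotient below its minimum. *)
Lemma rayleigh_min : exists2 rho, eigenvalue S rho &
  forall v : 'cV[R]_n.+1, rho * enorm v ^+ 2 <= q v.
Proof.
pose f (u : 'rV[R]_n.+1) := enorm (A^T *m u^T) ^+ 2.
have [] := @EVT_min_rV R n.+1 f [set u | enorm u^T ^+ 2 = 1] _ (@unit_sphere_compact n.+1).
- exists (delta_mx 0 0) => /=; rewrite enorm_sqr /dot (bigD1 0)//= !mxE !eqxx mulr1 big1 ?addr0//.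
  by move=> i i0; rewrite !mxE (negbTE i0) mulr0.
- exact/continuous_subspaceT/continuous_sqr_mulmx.
move=> u0; rewrite inE /= => u01 umin.
pose u := u0^T; pose rho := q u.
have hr (v : 'cV[R]_n.+1) : rho * enorm v ^+ 2 <= q v.
  have [/enorm_eq0 ->|v0] := eqVneq (enorm v) 0.
    by rewrite mulmx0 !enorm0 expr0n /= mulr0.
  have vp : 0 < enorm v by rewrite lt_neqAle eq_sym v0 enorm_ge0.
  have := umin ((enorm v)^-1 *: v)^T; rewrite inE /= /f trmxK.
  rewrite enormZ exprMn real_normK ?num_real// exprVn mulVf ?expf_neq0// => /(_ erefl).
  rewrite -scalemxAr enormZ exprMn real_normK ?num_real// exprVn.
  by rewrite ler_pdivlMl ?exprn_gt0// mulrC.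
exists rho => //.
pose w := S *m u - rho *: u.
have G0 : rho * enorm u ^+ 2 = q u by rewrite u01 mulr1.
suff w0 : w = 0.
  apply/eigenvalueP; exists u0.
    have /(congr1 trmx) : S *m u = rho *: u by apply/eqP; rewrite -subr_eq0 -/w w0.
    by rewrite !trmx_mul !trmxK linearZ /= trmxK.
  by apply/eqP => e; move/eqP: u01; rewrite e trmx0 enorm0 expr0n eq_sym oner_eq0.
(* The excess of the quadratic form over its lower bound vanishes at u, so its
   first-order term in the direction w, twice the squared norm of w, must vanish. *)
have key t : 0 <= 2 * t * enorm w ^+ 2 + t ^+ 2 * (q w - rho * enorm w ^+ 2).
  have Su : S *m u = w + rho *: u by rewrite /w subrK.
  have := hr (u + t *: w); rewrite gram_expand Su dotDr dotZr -G0.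
  rewrite enorm_sqrD enormZ exprMn real_normK ?num_real// dotZr (dotC u w) -(enorm_sqr w); lra.
have c0 : 0 <= q w - rho * enorm w ^+ 2 by rewrite subr_ge0.
set c := q w - _ in key c0.
apply: enorm_eq0; apply/eqP; rewrite -sqrf_eq0; apply/eqP.
set e := enorm w ^+ 2 in key *.
have e0 : 0 <= e by exact: sqr_ge0.
have := key (- (e / (c + 1))).
have c1 : 0 < c + 1 by rewrite ltr_wpDl.
have -> : 2 * - (e / (c + 1)) * e + (- (e / (c + 1))) ^+ 2 * c =
  - (e ^+ 2 * (c + 2)) / (c + 1) ^+ 2 by field; rewrite gt_eqF.
rewrite pmulr_lge0 ?invr_gt0 ?exprn_gt0// oppr_ge0 pmulr_lle0 ?ltr_wpDl// => h.
by apply/eqP; rewrite -sqrf_eq0 eq_le h sqr_ge0.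
Qed.

(** By [rayleigh_min] the infimum of the eigenvalues is attained and bounds the
    quadratic form below; full row rank makes it nonzero. *)
Lemma gram_eigenvalue_bounds : row_free A ->
  [/\ 0 < lambda_min S, lambda_min S <= lambda_max S &
      forall v : 'cV[R]_n.+1, lambda_min S * enorm v ^+ 2 <= q v].
Proof.
move=> rfA; have [rho erho hrho] := rayleigh_min.
have lb a : eigenvalue S a -> rho <= a.
  by move=> /eigenvalue_gram[v v0 e]; have := hrho v; rewrite e ler_pM2r.
have hlb : has_lbound [set a | eigenvalue S a] by exists rho => a /lb.
have hub : has_ubound [set a | eigenvalue S a].
  have [c c0 hc] := enorm_mulmx A^T; exists (c ^+ 2) => a /eigenvalue_gram[v v0 e].
  rewrite -(ler_pM2r v0) -e -exprMn ler_pXn2r// ?nnegrE ?enorm_ge0//.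
  by rewrite mulr_ge0// enorm_ge0.
have minE : lambda_min S = rho.
  apply/eqP; rewrite eq_le; apply/andP; split; first exact: ge_inf.
  by apply: lb_le_inf; [exists rho|move=> a /lb].
rewrite minE; split=> //; last by apply: ub_le_sup.
have [v v0 e] := eigenvalue_gram erho.
have : 0 <= rho * enorm v ^+ 2 by rewrite -e sqr_ge0.
rewrite pmulr_lge0// le_eqVlt => /orP[/eqP r0|//]; exfalso.
move: e; rewrite -r0 mul0r => /eqP; rewrite sqrf_eq0 => /eqP /enorm_eq0 /(congr1 trmx).
rewrite trmx_mul trmxK trmx0 => /eqP; rewrite mulmx_free_eq0// => /eqP /(congr1 trmx).
by rewrite trmxK trmx0 => v00; move: v0; rewrite v00 enorm0 expr0n ltxx.
Qed.

End GramMatrix.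

(** The sharp constant is 1 / sqrt lambda_min; the factor sqrt (lambda_max /
    lambda_min) >= 1 is that of M_y. Without rows both eigenvalue bounds are 0 by
    convention, and so is y. *)
Lemma adjoint_lower_bound (n d : nat) (A : 'M[R]_(n, d)) (y : 'cV[R]_n) : row_free A ->
  enorm y <= Num.sqrt (lambda_max (A *m A^T)) / lambda_min (A *m A^T) * enorm (A^T *m y).
Proof.
case: n A y => [|n] A y rfA.
  have -> : enorm y = 0 by rewrite /enorm /dot big_ord0 sqrtr0.
  have set0E : [set a | eigenvalue (A *m A^T) a] = set0.
    by apply/seteqP; split=> // a /eigenvalueP[v _]; rewrite [v]thinmx0 eqxx.
  by rewrite /lambda_max /lambda_min set0E sup0 inf0 sqrtr0 !mul0r.
have [l0 l1 hl] := gram_eigenvalue_bounds rfA.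
set lmin := lambda_min _ in l0 l1 hl *; set lmax := lambda_max _ in l1 *.
have h : Num.sqrt lmin * enorm y <= enorm (A^T *m y).
  rewrite -(@ler_pXn2r _ 2)// ?nnegrE ?mulr_ge0 ?sqrtr_ge0 ?enorm_ge0//.
  by rewrite exprMn sqr_sqrtr ?(ltW l0).
have s0 : 0 < Num.sqrt lmin by rewrite sqrtr_gt0.
rewrite mulrAC ler_pdivlMr// -[X in enorm y * X](sqr_sqrtr (ltW l0)) expr2 mulrA mulrC.
rewrite [enorm y * _]mulrC; apply: ler_pM => //; rewrite ?sqrtr_ge0 ?mulr_ge0 ?enorm_ge0 ?sqrtr_ge0//.
by rewrite ler_wsqrtr.
Qed.

End RayleighQuotient.

Section NormalCone.
Context {R : realType} {d : nat}.
Implicit Types (x y z u nu c : 'cV[R]_d) (X : set 'cV[R]_d).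

Lemma interior_enormP X x : X° x <-> exists2 e, 0 < e & forall y, enorm (y - x) < e -> X y.
Proof. exact: nbhs_enormP. Qed.

(** The last parameter, in the sense of a supremum, at which the segment is in X. *)
Lemma boundary_crossing X c u : X c -> ~ X u ->
  exists2 s, 0 <= s <= 1 & boundary X (c + s *: (u - c)).
Proof.
move=> Xc Xu.
pose T := [set s : R | 0 <= s <= 1 /\ X (c + s *: (u - c))].
have T0 : T 0 by split; rewrite ?lexx ?ler01// scale0r addr0.
have ubT : has_ubound T by exists 1 => s [/andP[]].
have hsT : has_sup T by split; [exists 0|].
have s0 : 0 <= sup T by apply: ub_le_sup.
have s1 : sup T <= 1 by apply: ge_sup; [exists 0|move=> s [/andP[]]].
have nuc : 0 < enorm (u - c).
  rewrite lt_neqAle enorm_ge0 andbT eq_sym; apply/eqP => /enorm_eq0 /eqP.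
  by rewrite subr_eq0 => /eqP uc; apply: Xu; rewrite uc.
exists (sup T); first by rewrite s0.
have segB (s t : R) : c + s *: (u - c) - (c + t *: (u - c)) = (s - t) *: (u - c).
  by rewrite opprD addrACA subrr add0r scalerBl.
split.
  move=> U /nbhs_enormP[e e0 eU].
  have de : 0 < e / enorm (u - c) by rewrite divr_gt0.
  have [s [s01 Xs] hs] := sup_adherent de hsT.
  exists (c + s *: (u - c)); split=> //; apply: eU.
  rewrite segB enormZ -ltr_pdivlMr//.
  have ss : s <= sup T by apply: ub_le_sup.
  rewrite ler0_norm ?subr_le0// opprB; lra.
move=> /interior_enormP[e e0 eX].
have s1' : sup T < 1.
  rewrite lt_neqAle s1 andbT; apply/eqP => e1; apply: Xu; apply: eX.
  by rewrite e1 scale1r [c + _]addrC subrK subrr enorm0.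
(* A parameter beyond the supremum whose point is still in the ball inside X. *)
pose t := Num.min 1 (sup T + e / enorm (u - c) / 2).
have de : 0 < e / enorm (u - c) / 2 by rewrite !divr_gt0.
have tT : T t.
  split; first by rewrite ge_min lexx le_min ler01 addr_ge0// ltW.
  apply: eX; rewrite segB enormZ -ltr_pdivlMr// ger0_norm.
    have : t <= sup T + e / enorm (u - c) / 2 by rewrite ge_min lexx orbT.
    by lra.
  by rewrite subr_ge0 le_min s1 lerDl ltW.
have : t <= sup T by apply: ub_le_sup.
by rewrite leNgt lt_min s1' ltrDl de.
Qed.

Lemma dist_boundary_gt0 X c : X° c -> boundary X !=set0 -> 0 < dist c (boundary X).
Proof.
move=> /interior_enormP[e e0 eX] bX.
apply: lt_le_trans e0 _; apply: lb_le_inf.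
  by have [y by_] := bX; exists (enorm (c - y)), y.
move=> _ [y [_ ny] <-]; rewrite leNgt enorm_distC; apply/negP => lt; apply: ny.
apply/interior_enormP; exists (e - enorm (y - c)); first by rewrite subr_gt0.
move=> z zy; apply: eX; apply: le_lt_trans (ler_enorm_dist y _ _) _; lra.
Qed.

(** A segment that leaves X crosses its boundary, no nearer than the distance. *)
Lemma ball_dist_boundary X c u : X° c -> enorm (u - c) < dist c (boundary X) -> X u.
Proof.
move=> Xc lt; apply: contrapT => Xu.
have [s /andP[s0 s1] bs] := boundary_crossing (interior_subset Xc) Xu.
move: lt; rewrite ltNge => /negP; apply.
apply: le_trans (_ : enorm (c - (c + s *: (u - c))) <= _).
  apply: ge_inf; last by exists (c + s *: (u - c)).
  by exists 0 => _ [y _ <-]; exact: enorm_ge0.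
rewrite opprD addrA subrr sub0r enormN enormZ ger0_norm//.
by rewrite ler_piMl ?enorm_ge0.
Qed.

(** The ball around c of radius the distance to the boundary lies in X. Testing the
    normal vector against c plus a multiple of nu inside this ball costs radius times
    the norm of nu, which is at most <nu, z - c>. A compact X has a boundary in the
    direction of nu, so this distance is a true one and not the infimum of an
    empty set. *)
Lemma normal_cone_bound X c z nu Q : compact X -> X° c -> normal_cone X z nu ->
  0 <= Q -> dot nu (z - c) <= Q -> enorm nu <= Q / dist c (boundary X).
Proof.
move=> cX Xc nz Q0 hQ; set del := dist _ _.
have [n0|n0] := eqVneq (enorm nu) 0.
  rewrite n0 divr_ge0//; have [bX|/nonemptyPn bX] := pselect (boundary X !=set0).
    by rewrite ltW// dist_boundary_gt0.
  by rewrite /del /dist bX image_set0 inf0.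
have np : 0 < enorm nu by rewrite lt_neqAle eq_sym n0 enorm_ge0.
have bX : boundary X !=set0.
  have [B [Br hB]] := compact_bounded cX.
  pose u := c + ((d%:R * (`|B| + 1) + enorm c + 1) / enorm nu) *: nu.
  have nXu : ~ X u.
    move=> Xu; have : `|u| <= `|B| + 1.
      by apply: hB => //; apply: le_lt_trans (ler_norm _) _; rewrite ltrDl.
    have := enorm_le_mx_norm u.
    have := ler_enormB u c; have -> : u - c = ((d%:R * (`|B| + 1) + enorm c + 1) / enorm nu) *: nu.
      by rewrite /u addrAC subrr add0r.
    rewrite enormZ ger0_norm; last first.
      by rewrite divr_ge0 ?enorm_ge0// !addr_ge0 ?mulr_ge0 ?enorm_ge0.
    rewrite divfK// => h1 h2 h3.
    have : d%:R * `|u| <= d%:R * (`|B| + 1) by rewrite ler_wpM2l.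
    by lra.
  have [s _ bs] := boundary_crossing (interior_subset Xc) nXu.
  by eexists; exact: bs.
have d0 : 0 < del by exact: dist_boundary_gt0.
have small t : 0 <= t < del -> t * enorm nu <= Q.
  move=> /andP[t0 td].
  have Xu : X (c + (t / enorm nu) *: nu).
    apply: (ball_dist_boundary Xc); rewrite addrAC subrr add0r enormZ ger0_norm ?divr_ge0 ?enorm_ge0//.
    by rewrite divfK.
  have := nz _ Xu; have -> : c + (t / enorm nu) *: nu - z = (t / enorm nu) *: nu - (z - c).
    by rewrite opprB addrA [c + _]addrC.
  rewrite dotBr dotZr -enorm_sqr => h.
  have <- : t / enorm nu * enorm nu ^+ 2 = t * enorm nu by field.
  by lra.
rewrite ler_pdivlMr// leNgt; apply/negP => lt.
have lt2 : Q / enorm nu < del by rewrite ltr_pdivrMr// mulrC.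
have q0 : 0 <= Q / enorm nu by rewrite divr_ge0// ltW.
have /small : 0 <= (Q / enorm nu + del) / 2 < del by lra.
rewrite -ler_pdivlMr//; lra.
Qed.

End NormalCone.

Lemma ord_or_empty k : inhabited 'I_k \/ ('I_k -> False).
Proof.
by have [->|k0] := posnP k; [right; case|left; exact: inhabits (Ordinal k0)].
Qed.

Section Multipliers.
Context {R : realType} {d n m : nat} (P : problem R d n m).
Variables (Lf0 : R) (Lf : 'I_m -> R) (G M Bf0 : R) (Bf : 'I_m -> R) (rho0 : R)
  (xfeas : 'cV[R]_d).
Hypothesis S : assumptions P Lf0 Lf G M Bf0 Bf rho0 xfeas.
Variables (gam : R) (xk : 'cV[R]_d).
Hypotheses (gam_ge : rho0 <= gam) (xk_dom : dom_g P xk).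
Implicit Types (x z w : 'cV[R]_d) (i : 'I_m).
Local Notation X := (dom_g P).
Local Notation D := (diameter X).
Local Notation slack := (min_slack P xfeas).
Local Notation Q := (Qconst P Bf0 M gam).
Local Notation q0 := (Bf0 + gam * D + M).
Local Notation Mlam := (Mlam P Bf0 M xfeas gam).
Local Notation My := (My P Bf0 Bf M xfeas gam).
Local Notation V := (Num.sqrt (My ^+ 2 + Mlam ^+ 2)).

Lemma gam_ge0 : 0 <= gam. Proof. exact: le_trans (rho0_ge0 S) gam_ge. Qed.

Lemma Bf0_ge0 : 0 <= Bf0.
Proof. by apply: le_trans (f0_bound S (xfeas_dom S)).2; exact: enorm_ge0. Qed.

Lemma Bf_ge0 i : 0 <= Bf i.
Proof. by apply: le_trans (fc_bound S i (xfeas_dom S)).2; exact: enorm_ge0. Qed.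

Lemma M_ge0 : 0 <= M.
Proof.
case: S => _ [_ _ h] _ _; have [_ [xi hxi] /(_ xi hxi) [_ _ [v hv _]]] := h _ (xfeas_dom S).
by apply: le_trans hv; exact: enorm_ge0.
Qed.

Lemma q0_ge0 : 0 <= q0.
Proof. by rewrite !addr_ge0 ?Bf0_ge0 ?M_ge0// mulr_ge0 ?gam_ge0 ?(diameter_ge0 S). Qed.

Lemma Q_ge0 : 0 <= Q.
Proof. by rewrite mulr_ge0 ?q0_ge0 ?(diameter_ge0 S). Qed.

Lemma fc_feas_lt0 i : fc P i xfeas < 0.
Proof. by case: S => _ _ _ [_ _ [_ _]]. Qed.

Lemma slack_le i : slack <= `|fc P i xfeas|.
Proof. by apply: ge_inf; [exists 0 => _ [j _ <-]|exists i]. Qed.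

Lemma slack_gt0 i : 0 < slack.
Proof.
pose k := [arg min_(j < i) `|fc P j xfeas|]%O.
have hk j : `|fc P k xfeas| <= `|fc P j xfeas|.
  by rewrite /k; case: arg_minP => //= k' _; apply.
apply: (@lt_le_trans _ _ `|fc P k xfeas|); first by rewrite normr_gt0 lt_eqF// fc_feas_lt0.
by apply: lb_le_inf => [|_ [j _ <-]]; [exists `|fc P i xfeas|, i|exact: hk].
Qed.

Lemma slack_ge0 : 0 <= slack.
Proof.
have [[i]|h] := ord_or_empty m; first by rewrite ltW// (slack_gt0 i).
rewrite /min_slack; set T := (X in inf X).
by have -> : T = set0; [apply/seteqP; split=> // t [i]; case: (h i)|rewrite inf0].
Qed.

Lemma Bf_le_sup i : Bf i <= sup (range Bf).
Proof.
apply: ub_le_sup; last by exists i.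
exists (\sum_j `|Bf j|) => _ [j _ <-]; apply: le_trans (ler_norm _) _.
by rewrite (bigD1 j)//= lerDl; exact: sumr_ge0.
Qed.

Lemma supBf_ge0 : 0 <= sup (range Bf).
Proof.
have [[i]|h] := ord_or_empty m; first exact: le_trans (Bf_ge0 i) (Bf_le_sup i).
set T := (X in sup X).
by have -> : T = set0; [apply/seteqP; split=> // t [i]; case: (h i)|rewrite sup0].
Qed.

Lemma Mlam_ge0 : 0 <= Mlam. Proof. by rewrite divr_ge0 ?Q_ge0 ?slack_ge0. Qed.

Lemma lambda_min_ge0 : 0 <= lambda_min (A P *m (A P)^T).
Proof.
have [E|] := pselect ([set a | eigenvalue (A P *m (A P)^T) a] !=set0); last first.
  by move=> /nonemptyPn h; rewrite /lambda_min h inf0.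
apply: lb_le_inf => // a /eigenvalueP[u hu u0].
have hc : A P *m (A P)^T *m u^T = a *: u^T.
  by have := congr1 trmx hu; rewrite !trmx_mul trmxK linearZ.
have : 0 <= a * enorm u^T ^+ 2.
  by rewrite enorm_sqr -dotZr -hc -mulmxA -dot_trmx dot_ge0.
rewrite pmulr_lge0// exprn_gt0// lt_neqAle enorm_ge0 andbT eq_sym.
by apply: contra u0 => /eqP /enorm_eq0 /(congr1 trmx); rewrite trmxK trmx0 => ->.
Qed.

Lemma dist_bd_ge0 : 0 <= dist xfeas (boundary X).
Proof.
have [bX|/nonemptyPn bX] := pselect (boundary X !=set0).
  by apply: lb_le_inf => [|_ [y _ <-]]; [case: bX => y ?; exists (enorm (xfeas - y)), y|exact: enorm_ge0].
by rewrite /dist bX image_set0 inf0.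
Qed.

Lemma My_ge0 : 0 <= My.
Proof.
rewrite /Defs.My; apply: mulr_ge0.
  apply: divr_ge0 lambda_min_ge0; exact: mulr_ge0 Q_ge0 (sqrtr_ge0 _).
by rewrite !addr_ge0 ?invr_ge0 ?(diameter_ge0 S) ?dist_bd_ge0// divr_ge0 ?supBf_ge0 ?slack_ge0.
Qed.

Lemma infeas_sqr x : infeas P x ^+ 2 = enorm (cons_eq P x) ^+ 2 + enorm (cons_plus P x) ^+ 2.
Proof. by rewrite sqr_sqrtr// addr_ge0 ?sqr_ge0. Qed.

Lemma infeas_ge0 x : 0 <= infeas P x. Proof. exact: sqrtr_ge0. Qed.

Lemma enorm_le_sum (v : 'cV[R]_m) : (forall i, 0 <= v i 0) -> enorm v <= \sum_i v i 0.
Proof.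
move=> v0; rewrite -(@ler_pXn2r _ 2)// ?nnegrE ?enorm_ge0// ?sumr_ge0// enorm_sqr expr2 mulr_suml.
apply: ler_sum => i _; rewrite ler_wpM2l// (bigD1 i)//= lerDl; exact: sumr_ge0.
Qed.

Section ExactPenalty.
Variables (B : R) (z : 'cV[R]_d).
Hypotheses (B_ge0 : 0 <= B) (z_dom : X z)
  (z_min : forall w, X w -> penalty P gam B xk z + fine (g P z) <= penalty P gam B xk w + fine (g P w)).

Local Notation lam := (B *: cons_plus P z).
Local Notation y := (B *: cons_eq P z).

Lemma lam_ge0 i : 0 <= lam i 0.
Proof. by rewrite !mxE mulr_ge0// le_max lexx. Qed.

(** Smoothness of the penalized objective on the domain is enough here; 1 is an
    arbitrary extrapolation radius. *)
Lemma penalty_argmin_subdiff : subdiff (g P) z (- penalty_grad P gam B xk z).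
Proof.
have [Lam Lam0 hLam] := penalty_smooth_on S ler01 gam_ge0.
have [up _] := hLam B xk B_ge0.
apply: (argmin_subdiff (g_Noo S) (g_convex S) z_dom z_min (C := Lam * (1 + B))).
by move=> w Xw; apply: up => //; exact: extrapolations_refl.
Qed.

(** Splits the optimality condition of z into a bounded part, the two multiplier
    terms, and a normal vector of the domain. *)
Lemma multiplier_decomposition : exists a nu : 'cV[R]_d,
  [/\ enorm a <= q0, normal_cone X z nu &
      a + (jac (fc P) z)^T *m lam + (A P)^T *m y + nu = 0].
Proof.
have := penalty_argmin_subdiff; case: S => _ [_ _ h] _ _.
have [_ _ sub] := h _ z_dom => /sub [nu hnu [eta heta E]].
exists (grad (f0 P) z + gam *: (z - xk) + eta), nu; split=> //.
  apply: le_trans (ler_enormD _ _) _; rewrite lerD//.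
  apply: le_trans (ler_enormD _ _) _; rewrite lerD//; first exact: (f0_bound S z_dom).2.
  rewrite enormZ ger0_norm ?gam_ge0// ler_wpM2l ?gam_ge0//; exact: (diameter_ge S).
have : nu + eta + penalty_grad P gam B xk z = 0 by rewrite E addNr.
rewrite /penalty_grad /lagr_grad => <-.
by apply/colP => k; rewrite !mxE; ring.
Qed.

(** Convexity of the constraints, weighted by the nonnegative multipliers. *)
Lemma lam_slope x : \sum_i lam i 0 * (fc P i z - fc P i x) <= dot ((jac (fc P) z)^T *m lam) (z - x).
Proof.
rewrite jac_trmx dot_suml; apply: ler_sum => i _; rewrite dotZl ler_wpM2l ?lam_ge0//.
have := fc_lower S i z x; rewrite mul0r mul0r addr0 -(opprB z x) dotNr; lra.
Qed.

(** Take the inner product of the optimality condition with z - xfeas. The terms of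
    the equality constraints, of the inequality constraints and of the normal vector
    are all nonnegative, and together they are at most Q; the Slater point makes the
    inequality term at least slack times the sum of the multipliers. *)
Lemma multiplier_bounds_aux : exists2 nu, normal_cone X z nu &
  [/\ slack * (\sum_i lam i 0) <= Q, dot nu (z - xfeas) <= Q &
      enorm ((A P)^T *m y) <= q0 + sup (range Bf) * (\sum_i lam i 0) + enorm nu].
Proof.
have [a [nu [ha hnu E]]] := multiplier_decomposition; exists nu => //.
have Axf : A P *m xfeas = b P by case: S => _ _ _ [_ _ []].
have E2 : dot a (z - xfeas) + dot ((jac (fc P) z)^T *m lam) (z - xfeas)
    + B * enorm (cons_eq P z) ^+ 2 + dot nu (z - xfeas) = 0.
  have := congr1 (fun v => dot v (z - xfeas)) E; rewrite !dotDl dot0l [dot ((A P)^T *m _) _]dot_trmx mulmxBr Axf -/(cons_eq P z).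
  by rewrite dotZl -enorm_sqr.
have h1 : slack * (\sum_i lam i 0) <= dot ((jac (fc P) z)^T *m lam) (z - xfeas).
  apply: le_trans (lam_slope xfeas); rewrite mulr_sumr; apply: ler_sum => i _.
  have s1 := slack_le i; have f1 := fc_feas_lt0 i; have l0 := lam_ge0 i.
  move: s1; rewrite ltr0_norm// => s1.
  have : 0 <= lam i 0 * fc P i z.
    rewrite !mxE; case: (leP 0 (fc P i z)) => hz; last by rewrite mulr0 mul0r.
    by rewrite !mulr_ge0.
  by have := ler_wpM2l l0 s1; lra.
have h2 : 0 <= B * enorm (cons_eq P z) ^+ 2 by rewrite mulr_ge0 ?sqr_ge0.
have h3 : 0 <= dot nu (z - xfeas).
  by have := hnu _ (xfeas_dom S); rewrite -(opprB z) dotNr; lra.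
have h4 : - Q <= dot a (z - xfeas).
  have := Cauchy_Schwarz_abs a (z - xfeas); rewrite ler_norml => /andP[h _].
  apply: le_trans h; rewrite lerN2 /Qconst mulrC.
  by rewrite ler_pM ?enorm_ge0//; exact: (diameter_ge S z_dom (xfeas_dom S)).
have h5 : 0 <= slack * (\sum_i lam i 0).
  by rewrite mulr_ge0 ?slack_ge0// sumr_ge0// => i _; exact: lam_ge0.
split; [lra|lra|].
have -> : (A P)^T *m y = - (a + (jac (fc P) z)^T *m lam + nu).
  by apply/eqP; rewrite -subr_eq0 opprK -[X in _ == X]E; apply/eqP/colP => k; rewrite !mxE; ring.
rewrite enormN; apply: le_trans (ler_enormD _ _) _; rewrite lerD2r.
apply: le_trans (ler_enormD _ _) _; rewrite lerD// jac_trmx.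
apply: le_trans (ler_enorm_sum _ _ _) _; rewrite mulr_sumr; apply: ler_sum => i _.
rewrite enormZ ger0_norm ?lam_ge0// mulrC ler_wpM2r ?lam_ge0//.
exact: le_trans (fc_bound S i z_dom).2 (Bf_le_sup i).
Qed.

Lemma lam_sum_bound : \sum_i lam i 0 <= Mlam.
Proof.
have [nu _ [h _ _]] := multiplier_bounds_aux.
have [[i]|h0] := ord_or_empty m; first by rewrite ler_pdivlMr ?(slack_gt0 i)// mulrC.
by rewrite big1 ?Mlam_ge0// => i; have := h0 i.
Qed.

Lemma lam_bound : enorm lam <= Mlam.
Proof. by apply: le_trans lam_sum_bound; apply: enorm_le_sum => i; exact: lam_ge0. Qed.

(** A^T y is bounded through the optimality condition, since all its other terms
    are; full row rank turns this into a bound on y. If there are equality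
    constraints then d > 0, so the domain has nonempty interior in a space of
    positive dimension and D > 0, which makes the term 1 / D of M_y meaningful. *)
Lemma y_bound : enorm y <= My.
Proof.
have rf : row_free (A P) by case: S => -[].
have [nu hnu [_ h1 h2]] := multiplier_bounds_aux.
have xi : X° xfeas by case: S => _ _ _ [_ _ []].
have h3 := normal_cone_bound (dom_compact S) xi hnu Q_ge0 h1.
have [n0|n0] := posnP n.
  suff -> : enorm y = 0 by exact: My_ge0.
  have noI : 'I_n -> False by move=> [k]; rewrite n0.
  by rewrite /enorm /dot big1 ?sqrtr0// => i; have := noI i.
have d0 : (0 < d)%N.
  by rewrite (leq_trans n0)//; move: rf; rewrite /row_free => /eqP <-; exact: rank_leq_col.
have D0 : 0 < D.
  have /interior_enormP[e e0 eX] := xi.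
  pose u : 'cV[R]_d := delta_mx (Ordinal d0) 0.
  have u1 : enorm u = 1.
    rewrite /enorm /dot (bigD1 (Ordinal d0))//= !mxE !eqxx mulr1 big1 ?addr0 ?sqrtr1// => j ij.
    by rewrite !mxE (negbTE ij) mulr0.
  have Xu : X (xfeas + (e / 2) *: u).
    by apply: eX; rewrite addrAC subrr add0r enormZ u1 mulr1 ger0_norm; lra.
  have := diameter_ge S Xu (xfeas_dom S).
  rewrite addrAC subrr add0r enormZ u1 mulr1 ger0_norm; last by lra.
  by apply: lt_le_trans; rewrite divr_gt0.
apply: le_trans (adjoint_lower_bound y rf) _.
rewrite /Defs.My.
set s := Num.sqrt _; set l := lambda_min _.
have -> : Q * s / l * (D^-1 + (dist xfeas (boundary X))^-1 + sup (range Bf) / slack)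
  = s / l * (Q / D + Q / dist xfeas (boundary X) + sup (range Bf) * Mlam).
  by rewrite /Defs.Mlam; ring.
rewrite ler_wpM2l ?divr_ge0 ?sqrtr_ge0 ?lambda_min_ge0//.
have -> : Q / D = q0 by rewrite /Qconst mulrC mulKf// gt_eqF.
have h4 := ler_wpM2l supBf_ge0 lam_sum_bound; lra.
Qed.

(** B times the infeasibility is the norm of the two multipliers together. *)
Lemma multiplier_infeas : B * infeas P z <= V.
Proof.
rewrite -(@ler_pXn2r _ 2)// ?nnegrE ?mulr_ge0 ?infeas_ge0 ?sqrtr_ge0//.
rewrite sqr_sqrtr ?addr_ge0 ?sqr_ge0// exprMn infeas_sqr mulrDr.
have E (k : nat) (v : 'cV[R]_k) : B ^+ 2 * enorm v ^+ 2 = enorm (B *: v) ^+ 2.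
  by rewrite enormZ ger0_norm// exprMn.
rewrite !E lerD// ler_pXn2r// ?nnegrE ?enorm_ge0 ?My_ge0 ?Mlam_ge0//; [exact: y_bound|exact: lam_bound].
Qed.

Local Notation Phi w := (f0 P w + gam / 2 * enorm (w - xk) ^+ 2 + fine (g P w)).

(** Weak duality with the multipliers of the penalized problem: gamma >= rho0 makes
    the Lagrangian convex, so z minimizes it, and the multipliers are bounded. *)
Lemma penalty_duality x : X x -> Phi z <= Phi x + V * infeas P x.
Proof.
move=> Xx.
have /(subdiff_fineP (g_Noo S) _ z_dom) /(_ x Xx) := penalty_argmin_subdiff.
have := f0_lower S z x; have := half_sqr_dist_lower xk z x.
have gr0 : 0 <= gam - rho0 by rewrite subr_ge0.
have := mulr_ge0 gr0 (sqr_ge0 (enorm (x - z))).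
have pgE : dot (penalty_grad P gam B xk z) (x - z) = dot (grad (f0 P) z) (x - z)
    + dot ((jac (fc P) z)^T *m lam) (x - z) + dot ((A P)^T *m y) (x - z)
    + gam * dot (z - xk) (x - z).
  by rewrite /penalty_grad /lagr_grad 3!dotDl dotZl.
rewrite dotNl pgE => n2 hd hf hg.
have h1 := lam_slope x.
have h2 : - dot ((A P)^T *m y) (x - z) = - dot y (cons_eq P x) + B * enorm (cons_eq P z) ^+ 2.
  rewrite dot_trmx mulmxBr.
  have -> : A P *m x - A P *m z = cons_eq P x - cons_eq P z by rewrite /cons_eq opprB addrA subrK.
  by rewrite dotBr [dot y (cons_eq P z)]dotZl -enorm_sqr; ring.
have h3 : \sum_i lam i 0 * (fc P i z - fc P i x) >= - dot lam (cons_plus P x).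
  rewrite /dot -sumrN; apply: ler_sum => i _.
  have l0 := lam_ge0 i.
  have a1 : 0 <= lam i 0 * fc P i z.
    rewrite !mxE; case: (leP 0 (fc P i z)) => hz; last by rewrite mulr0 mul0r.
    by rewrite !mulr_ge0.
  have a2 : lam i 0 * fc P i x <= lam i 0 * cons_plus P x i 0.
    by rewrite ler_wpM2l// mxE le_max lexx orbT.
  by lra.
have h4 : dot y (cons_eq P x) <= My * enorm (cons_eq P x).
  by apply: le_trans (Cauchy_Schwarz _ _) _; rewrite ler_wpM2r ?enorm_ge0//; exact: y_bound.
have h5 : dot lam (cons_plus P x) <= Mlam * enorm (cons_plus P x).
  by apply: le_trans (Cauchy_Schwarz _ _) _; rewrite ler_wpM2r ?enorm_ge0//; exact: lam_bound.
have h6 : My * enorm (cons_eq P x) + Mlam * enorm (cons_plus P x) <= V * infeas P x.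
  rewrite -sqrtrM ?addr_ge0 ?sqr_ge0//.
  have e1 := enorm_ge0 (cons_eq P x); have e2 := enorm_ge0 (cons_plus P x).
  have lhs0 : 0 <= My * enorm (cons_eq P x) + Mlam * enorm (cons_plus P x).
    by rewrite addr_ge0// mulr_ge0 ?My_ge0 ?Mlam_ge0.
  rewrite -[leLHS]ger0_norm// -sqrtr_sqr ler_wsqrtr//.
  have := sqr_ge0 (My * enorm (cons_plus P x) - Mlam * enorm (cons_eq P x)); lra.
have h7 : 0 <= B * enorm (cons_eq P z) ^+ 2 by rewrite mulr_ge0 ?sqr_ge0.
have h8 : dot ((jac (fc P) z)^T *m lam) (z - x) = - dot ((jac (fc P) z)^T *m lam) (x - z).
  by rewrite -(opprB x z) dotNr.
have h9 := ler_wpM2l gam_ge0 hd.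
by lra.
Qed.

End ExactPenalty.

(** Compare x with the minimizer z for a weight B. By [penalty_duality] the objective
    of z exceeds that of x by at most V * F(x), and the infeasibility of z is at most
    V / B. Its contribution beta / 2 * F(z)^2 is smaller than any eta > 0 for large B. *)
Lemma approx_infeas (beta e : R) x : 0 <= beta -> X x ->
  (forall w, X w -> penalty P gam beta xk x + fine (g P x) <= penalty P gam beta xk w + fine (g P w) + e) ->
  beta / 2 * infeas P x ^+ 2 <= V * infeas P x + e.
Proof.
move=> b0 Xx hx; apply/ler_addgt0Pr => eta eta0.
(* Large enough for beta / 2 * (V / B) ^+ 2 <= eta. *)
pose B := Num.max 1 (beta * V ^+ 2 / (2 * eta)).
have B1 : 1 <= B by rewrite le_max lexx.
have B0 : 0 < B by rewrite (lt_le_trans ltr01).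
have BV : beta * V ^+ 2 <= 2 * eta * B.
  by rewrite [leRHS]mulrC -ler_pdivrMr ?mulr_gt0// le_max lexx orbT.
have [z Xz zmin] := argmin_exists (g_Noo S) (g_lsc S)
  (dom_compact S) (g_bound S) (xfeas_dom S)
  (penalty_lower S xk gam_ge0 (ltW B0)).
have h1 := penalty_duality (ltW B0) Xz zmin Xx.
have h2 := multiplier_infeas (ltW B0) Xz zmin.
have := hx _ Xz; rewrite /penalty -!infeas_sqr => h3.
have h4 : beta / 2 * infeas P z ^+ 2 <= eta.
  have i0 := infeas_ge0 z.
  have : B ^+ 2 * infeas P z ^+ 2 <= V ^+ 2.
    by rewrite -exprMn ler_pXn2r// ?nnegrE ?sqrtr_ge0// mulr_ge0// ltW.
  move=> /(ler_wpM2l b0) h.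
  have : beta * (B * infeas P z ^+ 2) <= beta * (B ^+ 2 * infeas P z ^+ 2).
    by rewrite ler_wpM2l// ler_wpM2r ?sqr_ge0// expr2 ler_peMr// ltW.
  move=> /le_trans/(_ h)/le_trans/(_ BV).
  rewrite mulrCA mulrC [leRHS]mulrC [leLHS]mulrC ler_pM2l// => hh.
  lra.
lra.
Qed.

End Multipliers.

(** * Convergence of the outer loop *)

Section Schedules.
Context {R : realType}.
Implicit Types (k : nat).

Definition sched_beta (beta : R) k : R := beta * Num.sqrt k.+1%:R.

Definition sched_eps (beta : R) k : R := (sched_beta beta k * k.+1%:R)^-1.

Local Notation rt k := (Num.sqrt (k%:R : R)).

Lemma rt_sqr k : rt k ^+ 2 = k%:R. Proof. by rewrite sqr_sqrtr. Qed.

Lemma rt_gt0 k : 0 < rt k.+1. Proof. by rewrite sqrtr_gt0 ltr0Sn. Qed.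

Lemma rt_step k : rt k.+1 ^+ 2 = rt k ^+ 2 + 1.
Proof. by rewrite !rt_sqr -natr1. Qed.

Lemma rt_le k : rt k <= rt k.+1.
Proof. by rewrite ler_wsqrtr// ler_nat. Qed.

Lemma inv_rt_le k : (rt k.+1)^-1 <= 2 * (rt k.+1 - rt k).
Proof.
have b0 := rt_gt0 k; have ab := rt_le k; have E := rt_step k.
rewrite -[leLHS]mul1r ler_pdivrMr//; nra.
Qed.

(** The terms k^(-3/2) are dominated by differences of k^(-1/2), so that sums over k
    need no integral comparison. *)
Lemma eps_telescope k :
  (rt k.+2 * k.+2%:R)^-1 <= 2 * ((rt k.+1)^-1 - (rt k.+2)^-1).
Proof.
have a0 := rt_gt0 k; have b0 := rt_gt0 k.+1; have ab := rt_le k.+1; have E := rt_step k.+1.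
set a := rt k.+1 in a0 ab E *; set b := rt k.+2 in b0 ab E *.
have <- : b ^+ 2 = k.+2%:R := rt_sqr _; clearbody a b.
have -> : 2 * (a^-1 - b^-1) = 2 / (a * b * (a + b)).
  have h : (b - a) * (a + b) = 1.
    have -> : (b - a) * (a + b) = b ^+ 2 - a ^+ 2 by ring.
    by rewrite E addrAC subrr add0r.
  have s0 : 0 < a + b by rewrite addr_gt0.
  have -> : 2 / (a * b * (a + b)) = 2 * ((b - a) * (a + b)) / (a * b * (a + b)) by rewrite h mulr1.
  by field; rewrite !gt_eqF.
rewrite ler_pdivlMr ?mulr_gt0 ?addr_gt0// mulrC ler_pdivrMr ?mulr_gt0 ?exprn_gt0//.
have : a * b * (a + b) <= b * b * (b + b) by rewrite !ler_pM ?mulr_ge0 ?addr_ge0 ?lerD ?(ltW a0) ?(ltW b0).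
by nra.
Qed.

(** The increments of sqrt k divided by k are again dominated by differences of
    k^(-1/2); the factor 3 / 2 absorbs sqrt (k+2) / sqrt (k+1) <= sqrt 2. *)
Lemma beta_telescope k :
  (rt k.+2 - rt k.+1) / k.+1%:R <= 3 / 2 * ((rt k.+1)^-1 - (rt k.+2)^-1).
Proof.
have a0 := rt_gt0 k; have b0 := rt_gt0 k.+1; have ab := rt_le k.+1; have E := rt_step k.+1.
have a1 : 1 <= rt k.+1 ^+ 2 by rewrite rt_sqr ler1n.
set a := rt k.+1 in a0 ab E a1 *; set b := rt k.+2 in b0 ab E *.
have <- : a ^+ 2 = k.+1%:R := rt_sqr _; clearbody a b.
have -> : 3 / 2 * (a^-1 - b^-1) = (3 / 2 * a) * (b - a) / (a ^+ 2 * b).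
  by field; rewrite !gt_eqF.
have ba : b <= 3 / 2 * a.
  rewrite -(@ler_pXn2r _ 2)// ?nnegrE ?(ltW b0) ?mulr_ge0 ?(ltW a0)// exprMn; lra.
rewrite ler_pdivrMr ?exprn_gt0// -[leRHS]mulrA.
have -> : (a ^+ 2 * b)^-1 * a ^+ 2 = b^-1 by field; rewrite !gt_eqF.
rewrite ler_pdivlMr// mulrC ler_wpM2r// subr_ge0//.
Qed.

Lemma sum_inv_rt K : \sum_(k < K) (rt k.+1)^-1 <= 2 * rt K.
Proof.
elim: K => [|K IH]; first by rewrite big_ord0 mulr_ge0 ?sqrtr_ge0.
by rewrite big_ord_recr /=; have := inv_rt_le K; lra.
Qed.

Lemma sum_eps_le (beta : R) K : 0 < beta ->
  \sum_(k < K.+1) sched_eps beta k <= beta^-1 * (3 - 2 / rt K.+1).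
Proof.
move=> b0; have E k : sched_eps beta k = beta^-1 * (rt k.+1 * k.+1%:R)^-1.
  by rewrite /sched_eps /sched_beta -mulrA invfM.
elim: K => [|K IH].
  rewrite big_ord1 E /= ler_wpM2l ?invr_ge0 ?(ltW b0)//.
  by rewrite sqrtr1 mulr1 invr1; lra.
rewrite big_ord_recr /= E.
have bi0 : 0 <= beta^-1 by rewrite invr_ge0 ltW.
apply: le_trans (lerD IH (ler_wpM2l bi0 (eps_telescope K))) _.
by rewrite le_eqVlt; apply/orP; left; apply/eqP; ring.
Qed.

End Schedules.

Section OuterLoop.
Context {R : realType} {d n m : nat} (P : problem R d n m).
Variables (Lf0 : R) (Lf : 'I_m -> R) (G M Bf0 : R) (Bf : 'I_m -> R) (rho0 : R)
  (xfeas : 'cV[R]_d).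
Hypothesis S : assumptions P Lf0 Lf G M Bf0 Bf rho0 xfeas.
Variables (gam beta : R).
Hypotheses (gam_gt : rho0 < gam) (beta_gt0 : 0 < beta).
Variable tr : ippp_trace R d.
Implicit Types (x z w : 'cV[R]_d) (i : 'I_m) (k : nat).
Local Notation X := (dom_g P).
Local Notation D := (diameter X).
Local Notation Mlam := (Mlam P Bf0 M xfeas gam).
Local Notation My := (My P Bf0 Bf M xfeas gam).
Local Notation V := (Num.sqrt (My ^+ 2 + Mlam ^+ 2)).
Local Notation V2 := (D + My ^+ 2 + Mlam ^+ 2).
Local Notation x_ k := (xbar tr k).
Local Notation beta_ k := (sched_beta beta k).
Local Notation eps_ k := (sched_eps beta k).
Local Notation C1 := (calC1 P Bf0 Bf G M xfeas (x_ 0%N) gam beta).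

Hypotheses (tr_dom : forall k, X (x_ k))
  (tr_omega : forall k, omega (penalty P gam (beta_ k) (x_ k)) (g P) (x_ k.+1) <= eps_ k).

Let gam_ge : rho0 <= gam. Proof. exact: ltW. Qed.
Let g0 : 0 < gam. Proof. exact: le_lt_trans (rho0_ge0 S) gam_gt. Qed.
Let D0 : 0 <= D. Proof. exact: diameter_ge0 S. Qed.

Lemma sched_beta_gt0 k : 0 < beta_ k.
Proof. by rewrite mulr_gt0// rt_gt0. Qed.

Lemma sched_eps_gt0 k : 0 < eps_ k.
Proof. by rewrite invr_gt0 mulr_gt0 ?sched_beta_gt0. Qed.

Lemma beta_eps k : beta_ k * eps_ k = k.+1%:R^-1.
Proof. by rewrite /sched_eps invfM mulrA mulfV ?gt_eqF ?sched_beta_gt0// mul1r. Qed.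

(** The infimum defining omega need not be attained, hence the slack del. *)
Lemma omega_attain (h : 'cV[R]_d -> R) x e del : X x -> omega h (g P) x <= e -> 0 < del ->
  exists2 xi, subdiff (g P) x xi & enorm (grad h x + xi) < e + del.
Proof.
move=> Xx om del0.
have hinf : has_inf [set enorm (grad h x + xi) | xi in subdiff (g P) x].
  split; first by have [xi hxi] := g_subdiff_ex S Xx; exists (enorm (grad h x + xi)), xi.
  by exists 0 => _ [v _ <-]; exact: enorm_ge0.
have [_ [xi hxi <-] lt] := inf_adherent del0 hinf.
by exists xi => //; apply: lt_le_trans lt _; rewrite lerD2r.
Qed.

(** The penalized objective is convex as gamma >= rho0, so a subgradient of norm
    eps_ k at x_(k+1) costs at most eps_ k times the diameter. *)
Lemma approx_minimal k w : X w ->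
  penalty P gam (beta_ k) (x_ k) (x_ k.+1) + fine (g P (x_ k.+1)) <=
  penalty P gam (beta_ k) (x_ k) w + fine (g P w) + eps_ k * D.
Proof.
move=> Xw; apply/ler_addgt0Pr => e e0.
have D1 : 0 < D + 1 by rewrite ltr_wpDl.
have [xi hxi hn] := omega_attain (tr_dom k.+1) (tr_omega k) (divr_gt0 e0 D1).
have /(subdiff_fineP (g_Noo S) _ (tr_dom k.+1)) /(_ w Xw) hg := hxi.
have b0 := sched_beta_gt0 k.
have low := lower_quad_le (_ : 0 <= gam - rho0) (penalty_lower S (x_ k) (ltW g0) (ltW b0)).
have := low _ (x_ k.+1) w; rewrite subr_ge0 => /(_ gam_ge).
rewrite mul0r mul0r addr0 -(grad_penalty S) => hl.
have cs := Cauchy_Schwarz_abs (grad (penalty P gam (beta_ k) (x_ k)) (x_ k.+1) + xi) (w - x_ k.+1).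
move: cs; rewrite ler_norml dotDl => /andP[cs _].
have wx : enorm (w - x_ k.+1) <= D by apply: (diameter_ge S).
have h1 : enorm (grad (penalty P gam (beta_ k) (x_ k)) (x_ k.+1) + xi) * enorm (w - x_ k.+1)
    <= (eps_ k + e / (D + 1)) * D.
  by rewrite ler_pM ?enorm_ge0// ltW.
have h2 : e / (D + 1) * D <= e.
  by rewrite mulrAC ler_pdivrMr// ler_wpM2l ?(ltW e0)// lerDl.
lra.
Qed.

Lemma V2_ge0 : 0 <= V2. Proof. by rewrite !addr_ge0 ?sqr_ge0. Qed.

(** With u = beta_ k * F(x_(k+1)), [approx_infeas] reads u^2 / 2 <= V u + D / (k+1),
    because beta_ k * eps_ k = 1 / (k+1). *)
Lemma infeas_decay k : (beta_ k * infeas P (x_ k.+1)) ^+ 2 <= 4 * V2.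
Proof.
have b0 := sched_beta_gt0 k.
have := approx_infeas S gam_ge (tr_dom k) (ltW b0) (tr_dom k.+1) (@approx_minimal k).
move=> /(ler_wpM2l (ltW b0)).
set F := infeas _ _.
have -> : beta_ k * (beta_ k / 2 * F ^+ 2) = (beta_ k * F) ^+ 2 / 2 by ring.
have -> : beta_ k * (V * F + eps_ k * D) = V * (beta_ k * F) + k.+1%:R^-1 * D.
  by rewrite -beta_eps; ring.
have VV : V ^+ 2 = My ^+ 2 + Mlam ^+ 2 by rewrite sqr_sqrtr// addr_ge0 ?sqr_ge0.
have : k.+1%:R^-1 * D <= D by rewrite ler_piMl// invf_le1// ler1n.
move: (k.+1%:R^-1) (beta_ k * F) => c u.
by have := sqr_ge0 (u - 2 * V); move: VV; rewrite sqrrB; lra.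
Qed.

Lemma infeas_le k : infeas P (x_ k.+1) <= 2 * Num.sqrt V2 / beta_ k.
Proof.
have b0 := sched_beta_gt0 k.
rewrite ler_pdivlMr// mulrC -(@ler_pXn2r _ 2)// ?nnegrE ?mulr_ge0 ?sqrtr_ge0 ?infeas_ge0 ?(ltW beta_gt0)//.
apply: le_trans (infeas_decay k) _; rewrite [leRHS]exprMn sqr_sqrtr ?V2_ge0//; lra.
Qed.

Local Notation obj k := (f0 P (x_ k) + fine (g P (x_ k))).
Local Notation step k := (enorm (x_ k.+1 - x_ k)).

Lemma descent k : obj k.+1 + gam / 2 * step k ^+ 2 + beta_ k / 2 * infeas P (x_ k.+1) ^+ 2
  <= obj k + beta_ k / 2 * infeas P (x_ k) ^+ 2 + eps_ k * D.
Proof.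
have := approx_minimal k (tr_dom k); rewrite /penalty subrr enorm0 expr0n -!infeas_sqr /=; lra.
Qed.

Local Notation rt k := (Num.sqrt (k%:R : R)).

(** Sum of [descent]. The penalty terms do not telescope, because the weight grows
    between two iterations; the excess (beta_(k+1) - beta_k) / 2 * F^2 is of order
    k^(-3/2) by [infeas_decay] and is summed through [beta_telescope]. *)
Lemma descent_sum K :
  gam / 2 * (\sum_(k < K.+1) step k ^+ 2) + obj K.+1 + beta_ K / 2 * infeas P (x_ K.+1) ^+ 2
  <= obj 0%N + beta / 2 * infeas P (x_ 0%N) ^+ 2
     + D / beta * (3 - 2 / rt K.+1) + 3 * V2 / beta * (1 - (rt K.+1)^-1).
Proof.
elim: K => [|K IH].
  rewrite big_ord1 /=; have := descent 0.
  rewrite /sched_eps /sched_beta sqrtr1 !mulr1 invr1; lra.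
rewrite big_ord_recr /=; have := descent K.+1.
have b0 := sched_beta_gt0 K.
have bi0 : 0 <= beta^-1 by rewrite invr_ge0 ltW.
have Fb : infeas P (x_ K.+1) ^+ 2 <= 4 * V2 / (beta ^+ 2 * K.+1%:R).
  have -> : beta ^+ 2 * K.+1%:R = beta_ K ^+ 2 by rewrite exprMn rt_sqr.
  by rewrite ler_pdivlMr ?exprn_gt0// mulrC -exprMn infeas_decay.
have bd : beta_ K.+1 - beta_ K = beta * (rt K.+2 - rt K.+1) by rewrite /sched_beta mulrBr.
have h1 : (beta_ K.+1 - beta_ K) / 2 * infeas P (x_ K.+1) ^+ 2 <=
    3 * V2 / beta * ((rt K.+1)^-1 - (rt K.+2)^-1).
  apply: (@le_trans _ _ ((beta_ K.+1 - beta_ K) / 2 * (4 * V2 / (beta ^+ 2 * K.+1%:R)))).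
    rewrite ler_wpM2l// divr_ge0// bd mulr_ge0 ?(ltW beta_gt0)// subr_ge0; exact: rt_le.
  rewrite bd.
  have -> : beta * (rt K.+2 - rt K.+1) / 2 * (4 * V2 / (beta ^+ 2 * K.+1%:R)) =
     2 * V2 / beta * ((rt K.+2 - rt K.+1) / K.+1%:R) by field; rewrite !gt_eqF.
  have c0 : 0 <= 2 * V2 / beta by rewrite !mulr_ge0 ?V2_ge0.
  have := ler_wpM2l c0 (beta_telescope K).
  rewrite [leRHS](_ : _ = 3 * V2 / beta * ((rt K.+1)^-1 - (rt K.+2)^-1)) //.
  by field; rewrite !gt_eqF ?rt_gt0.
have h2 : eps_ K.+1 * D <= D / beta * (2 * ((rt K.+1)^-1 - (rt K.+2)^-1)).
  have -> : eps_ K.+1 * D = D / beta * (rt K.+2 * K.+2%:R)^-1.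
    by rewrite /sched_eps /sched_beta -mulrA invfM; ring.
  by rewrite ler_wpM2l ?mulr_ge0//; exact: eps_telescope.
lra.
Qed.

Lemma fine_g_bound k : `|fine (g P (x_ k))| <= G.
Proof.
have := g_bound S (tr_dom k); rewrite -(edom_fineK (g_Noo S) (tr_dom k)).
by rewrite /= lee_fin.
Qed.

(** The objective is bounded on the domain, so [descent_sum] bounds the squared
    steps. *)
Lemma step_sum_sqr K : \sum_(k < K.+1) step k ^+ 2 <= 2 * C1 / gam.
Proof.
have := descent_sum K; have r0 := rt_gt0 (R := R) K.
have := fine_g_bound 0; have := fine_g_bound K.+1; rewrite !ler_norml => /andP[a1 a2] /andP[a3 a4].
have [] := f0_bound S (tr_dom 0); have [] := f0_bound S (tr_dom K.+1).
rewrite !ler_norml => /andP[b1 b2] _ /andP[b3 b4] _.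
have e1 : 0 <= beta_ K / 2 * infeas P (x_ K.+1) ^+ 2.
  by rewrite mulr_ge0 ?sqr_ge0// divr_ge0// ltW// sched_beta_gt0.
have ri0 : 0 <= (rt K.+1)^-1 by rewrite invr_ge0 ltW.
have bi0 : 0 <= beta^-1 by rewrite invr_ge0 ltW.
have e2 : 0 <= D / beta * (2 * (rt K.+1)^-1) by rewrite mulr_ge0 ?mulr_ge0.
have e3 : 0 <= 3 * V2 / beta * (rt K.+1)^-1.
  by apply: mulr_ge0 ri0; apply: mulr_ge0 bi0; rewrite mulr_ge0 ?V2_ge0.
rewrite infeas_sqr in e1; rewrite ler_pdivlMr// !infeas_sqr => h.
rewrite /calC1 -/(cons_eq P (x_ 0%N)); lra.
Qed.

(** Cauchy-Schwarz against the all-one vector. *)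
Lemma step_sum K : gam * (\sum_(k < K.+1) step k) <= rt K.+1 * Num.sqrt (2 * gam * C1).
Proof.
pose u : 'cV[R]_K.+1 := \col_k step k; pose one : 'cV[R]_K.+1 := const_mx 1.
have cs := Cauchy_Schwarz one u.
have E1 : dot one u = \sum_(k < K.+1) step k by apply: eq_bigr => k _; rewrite !mxE mul1r.
have E2 : enorm one = rt K.+1.
  rewrite /enorm /dot; under eq_bigr do rewrite !mxE mulr1.
  by rewrite sumr_const card_ord.
have E3 : enorm u <= Num.sqrt (2 * C1 / gam).
  rewrite /enorm ler_wsqrtr//; apply: le_trans (step_sum_sqr K).
  by apply: ler_sum => k _; rewrite !mxE -expr2.
have E4 : gam * Num.sqrt (2 * C1 / gam) = Num.sqrt (2 * gam * C1).
  rewrite -{1}(ger0_norm (ltW g0)) -sqrtr_sqr -sqrtrM ?sqr_ge0//; congr Num.sqrt.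
  by field; rewrite gt_eqF.
rewrite -E4 -E1 mulrCA ler_wpM2l ?(ltW g0)//; apply: le_trans cs _.
by rewrite E2 ler_wpM2l ?sqrtr_ge0.
Qed.

Local Notation betak := (fun k : nat => beta * Num.sqrt k.+1%:R).

Lemma lagr_grad_penalty k : grad (penalty P gam (beta_ k) (x_ k)) (x_ k.+1) =
  lagr_grad P (x_ k.+1) (lambar P betak tr k.+1) (ybar P betak tr k.+1) + gam *: (x_ k.+1 - x_ k).
Proof. by rewrite (grad_penalty S). Qed.

(** The gradient of the penalized objective differs from that of the Lagrangian by
    the proximal term gamma (x_(k+1) - x_k). *)
Lemma Sres_le k : Sres P betak tr k.+1 <= eps_ k + gam * step k.
Proof.
apply/ler_addgt0Pr => e e0.
have [xi hxi hn] := omega_attain (tr_dom k.+1) (tr_omega k) e0.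
apply: le_trans (_ : enorm (lagr_grad P (x_ k.+1) (lambar P betak tr k.+1) (ybar P betak tr k.+1) - - xi) <= _).
  apply: ge_inf; first by exists 0 => _ [v _ <-]; exact: enorm_ge0.
  by exists (- xi) => //; exists xi.
move: hn; rewrite lagr_grad_penalty opprK; set L := lagr_grad _ _ _ _ => hn.
have -> : L + xi = (L + gam *: (x_ k.+1 - x_ k) + xi) - gam *: (x_ k.+1 - x_ k).
  by apply/colP => j; rewrite !mxE; ring.
apply: le_trans (ler_enormB _ _) _; rewrite enormZ gtr0_norm//; lra.
Qed.

Lemma Cres_le k : Cres P betak tr k.+1 <= 4 * V2 / beta_ k.
Proof.
have b0 := sched_beta_gt0 k.
have -> : Cres P betak tr k.+1 = beta_ k * enorm (cons_plus P (x_ k.+1)) ^+ 2.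
  rewrite /Cres /compl enorm_sqr mulr_sumr; apply: eq_bigr => i _.
  rewrite !mxE /= -/(sched_beta beta k).
  case: (leP 0 (fc P i (x_ k.+1))) => hf; last by rewrite !(mulr0, mul0r) normr0.
  rewrite ger0_norm; first by rewrite mulrA.
  by rewrite !mulr_ge0// ltW.
rewrite ler_pdivlMr// mulrAC -expr2; apply: le_trans (infeas_decay k).
by rewrite [leRHS]exprMn ler_wpM2l ?sqr_ge0// infeas_sqr lerDr sqr_ge0.
Qed.

Lemma residual_le k : residual P betak tr k.+1 <=
  eps_ k + gam * step k + (2 * Num.sqrt V2 + 4 * V2) / beta_ k.
Proof.
have b0 := sched_beta_gt0 k.
have s1 := Sres_le k; have s2 := infeas_le k; have s3 := Cres_le k.
have e0 := sched_eps_gt0 k.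
have t1 : 0 <= gam * step k by rewrite mulr_ge0 ?enorm_ge0// ltW.
have t2 : 0 <= 2 * Num.sqrt V2 / beta_ k by rewrite divr_ge0 ?mulr_ge0 ?sqrtr_ge0// ltW.
have t3 : 0 <= 4 * V2 / beta_ k by rewrite divr_ge0 ?mulr_ge0 ?V2_ge0// ltW.
rewrite /residual /Fres !ge_max mulrDl; apply/and3P; split; lra.
Qed.

(** The inequality is strict because the sum of the accuracies stays below
    3 / beta. Strictness is used in [best_stationary]. *)
Lemma residual_sum K : \sum_(k < K.+1) residual P betak tr k.+1 <
  3 / beta + rt K.+1 * (Num.sqrt (2 * gam * C1) + 4 * Num.sqrt V2 / beta + 8 * V2 / beta).
Proof.
have le : \sum_(k < K.+1) residual P betak tr k.+1 <=
    \sum_(k < K.+1) (eps_ k + gam * step k + (2 * Num.sqrt V2 + 4 * V2) / beta_ k).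
  by apply: ler_sum => k _; exact: residual_le.
apply: le_lt_trans le _.
rewrite !big_split /= -mulr_sumr.
have s1 := sum_eps_le K beta_gt0; have s2 := step_sum K; have s3 := sum_inv_rt (R := R) K.+1.
have c0 : 0 <= (2 * Num.sqrt V2 + 4 * V2) / beta.
  by rewrite divr_ge0 ?(ltW beta_gt0)// addr_ge0// mulr_ge0 ?sqrtr_ge0 ?V2_ge0.
have -> : \sum_(k < K.+1) (2 * Num.sqrt V2 + 4 * V2) / beta_ k =
    (2 * Num.sqrt V2 + 4 * V2) / beta * \sum_(k < K.+1) (rt k.+1)^-1.
  by rewrite mulr_sumr; apply: eq_bigr => k _; rewrite /sched_beta invfM mulrA.
have := ler_wpM2l c0 s3.
have lt : 0 < beta^-1 * (2 / rt K.+1) by rewrite mulr_gt0 ?invr_gt0// divr_gt0// rt_gt0.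
lra.
Qed.

Hypothesis tr_sel : forall k, (1 <= Rsel tr k.+1 <= k.+1)%N /\
  forall l, (1 <= l <= k.+1)%N ->
    residual P betak tr (Rsel tr k.+1) <= residual P betak tr l.

Local Notation Kb eps := (Kbound P Bf0 Bf G M xfeas (x_ 0%N) gam beta eps).

(** The best residual is at most the average. Each of the two terms in the maximum
    defining K makes one half of the bound at most K eps / 2. *)
Lemma best_residual_lt K eps : 0 < eps -> Kb eps <= K.+1%:R ->
  residual P betak tr (Rsel tr K.+1) < eps.
Proof.
move=> e0; rewrite /Kbound ge_max => /andP[k1 k2].
have := residual_sum K; set E := Num.sqrt _ + _ + _ in k2 * => hs.
have E0 : 0 <= E.
  by rewrite /E !addr_ge0 ?sqrtr_ge0// divr_ge0 ?mulr_ge0 ?sqrtr_ge0 ?V2_ge0// ltW.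
have K0 : 0 < K.+1%:R :> R by [].
have h1 : 3 / beta <= K.+1%:R * eps / 2.
  move: k1; rewrite ler_pdivrMr ?mulr_gt0// => k1.
  rewrite ler_pdivrMr//; lra.
have h2 : rt K.+1 * E <= K.+1%:R * eps / 2.
  have r0 := rt_gt0 (R := R) K; set r := rt K.+1 in r0 *.
  have KE : K.+1%:R = r ^+ 2 by rewrite rt_sqr.
  rewrite KE in k2 *; clearbody r.
  have : (2 / eps * E) ^+ 2 <= r ^+ 2 by apply: le_trans k2; rewrite !exprMn exprVn; lra.
  rewrite ler_pXn2r// ?nnegrE ?(ltW r0) ?mulr_ge0 ?invr_ge0 ?(ltW e0)//.
  rewrite mulrAC ler_pdivrMr// => h.
  have := ler_wpM2l (ltW r0) h; lra.
have h3 : K.+1%:R * residual P betak tr (Rsel tr K.+1) <= \sum_(k < K.+1) residual P betak tr k.+1.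
  rewrite -[X in X%:R * _](card_ord K.+1) mulr_natl -sumr_const; apply: ler_sum => k _.
  by have [_ h] := tr_sel K; apply: h; rewrite /= ltnS -ltnS.
rewrite -(ltr_pM2l K0); lra.
Qed.

(** The distance S is an infimum over subgradients; being strictly below eps, it
    yields an actual subgradient. *)
Lemma best_stationary K eps : 0 < eps -> Kb eps <= K.+1%:R ->
  stationary P eps (x_ (Rsel tr K.+1)).
Proof.
move=> e0 hK; have := best_residual_lt e0 hK.
have [/andP[r1 _] _] := tr_sel K; case: (Rsel tr K.+1) r1 => // r _.
rewrite /residual !gt_max => /and3P[hS hF hC].
have hinf : has_inf [set enorm (lagr_grad P (x_ r.+1) (lambar P betak tr r.+1) (ybar P betak tr r.+1) - v) |
    v in [set - xi | xi in subdiff (g P) (x_ r.+1)]].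
  split; last by exists 0 => _ [v _ <-]; exact: enorm_ge0.
  by have [xi hxi] := g_subdiff_ex S (tr_dom r.+1); eexists; exists (- xi) => //; exists xi.
have del0 : 0 < eps - Sres P betak tr r.+1 by rewrite subr_gt0.
have [_ [_ [xi hxi <-] <-]] := inf_adherent del0 hinf.
rewrite -/(dist _ _) -/(Sres P betak tr r.+1) opprK [Sres _ _ _ _ + _]addrC subrK => hn.
exists xi, (lambar P betak tr r.+1), (ybar P betak tr r.+1); split=> //.
- split=> i; rewrite !mxE /=; first by rewrite !mulr_ge0 ?(ltW beta_gt0) ?sqrtr_ge0// le_max lexx.
  by move=> fi; rewrite max_l ?mulr0// ltW.
- exact: ltW.
- exact: ltW.
- exact: ltW.
Qed.

End OuterLoop.

(** * Total complexity *)

Section IterationCounts.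
Context {R : realType}.
Implicit Types (k : nat) (C c th q : R).

(** Shifted so that lg >= 1: constants are absorbed into multiples of lg. *)
Definition lg k : R := 1 + ln k.+1%:R.

Definition rt4 k : R := Num.sqrt (Num.sqrt k.+1%:R).

Lemma ln_ge0_nat k : 0 <= ln k.+1%:R :> R.
Proof. by apply: ln_ge0; rewrite ler1n. Qed.

Lemma lg_ge1 k : 1 <= lg k. Proof. by rewrite /lg lerDl ln_ge0_nat. Qed.

Lemma rt_ge1 k : 1 <= Num.sqrt k.+1%:R :> R.
Proof. by rewrite -[leLHS]sqrtr1 ler_wsqrtr// ler1n. Qed.

Lemma rt4_ge1 k : 1 <= rt4 k.
Proof. by rewrite -[leLHS]sqrtr1 ler_wsqrtr// rt_ge1. Qed.

Lemma nat_above (x : R) : 0 <= x -> exists n : nat, x <= n%:R <= x + 1.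
Proof.
move=> x0; exists (Num.truncn x).+1; have /andP[a b] := truncn_itv x0.
by rewrite (ltW b)/= -natr1 lerD2r.
Qed.

Lemma expR_pow th n : 0 < th -> th ^+ n = expR (n%:R * ln th).
Proof. by move=> t0; rewrite expRM_natl lnK. Qed.

(** B is ln ((C + 1) (k+1)^p) / ln th^-1, rounded up. *)
Lemma geometric_index th C p : 0 < th < 1 -> 0 <= C ->
  exists2 c, 0 <= c & forall k, exists B : nat,
    C * k.+1%:R ^+ p * th ^+ B <= 1 /\ B%:R <= c * lg k.
Proof.
move=> /andP[t0 t1] C0.
pose a := - ln th; have a0 : 0 < a by rewrite oppr_gt0 ln_lt0// t0.
have lC : 0 <= ln (C + 1) by rewrite ln_ge0// lerDr.
exists ((ln (C + 1) + p%:R) / a + 1).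
  by rewrite addr_ge0// divr_ge0 ?(ltW a0)// addr_ge0.
move=> k; have l0 := ln_ge0_nat k.
pose Y := ln (C + 1) + p%:R * ln k.+1%:R.
have Y0 : 0 <= Y by rewrite addr_ge0// mulr_ge0.
have [B /andP[B1 B2]] := nat_above (divr_ge0 Y0 (ltW a0)).
exists B; split.
  have E : (C + 1) * k.+1%:R ^+ p = expR Y.
    by rewrite expRD expRM_natl !lnK ?posrE ?ltr_wpDl.
  apply: (@le_trans _ _ (expR Y * th ^+ B)).
    by rewrite -E ler_wpM2r ?exprn_ge0 ?(ltW t0)// ler_wpM2r ?exprn_ge0// lerDl.
  rewrite expR_pow// -expRD -[leRHS]expR0 ler_expR.
  move: B1; rewrite ler_pdivrMr// /a; lra.
apply: le_trans B2 _; rewrite [leRHS]mulrDl [1 * _]mul1r lerD ?lg_ge1//.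
rewrite [leRHS]mulrAC ler_pM2r ?invr_gt0// [leRHS]mulrDl lerD//.
  by rewrite ler_peMr// lg_ge1.
by rewrite ler_wpM2l// /lg lerDr.
Qed.

(** As 1 - q <= expR (- q), the number of contractions needed is 1 / q times a
    logarithm, and 1 / q is at most of order (k+1)^(1/4); this is the source of the exponent 1 / 4. *)
Lemma contraction_index C c0 : 0 <= C -> 0 < c0 ->
  exists2 c, 0 <= c & forall k q, 0 <= q <= 1 -> c0 <= q * rt4 k -> exists T : nat,
    C * k.+1%:R * Num.sqrt ((1 - q) ^+ T) <= 1 /\ T%:R <= c * (lg k * rt4 k).
Proof.
move=> C0 c00.
have lC : 0 <= ln (C + 1) by rewrite ln_ge0// lerDr.
exists (2 * ((ln (C + 1) + 1) / c0 + 1)).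
  by rewrite mulr_ge0// addr_ge0// divr_ge0 ?(ltW c00)// addr_ge0.
move=> k q /andP[q0' q1] cq; have l0 := ln_ge0_nat k.
have r1 := rt4_ge1 k; have l1 := lg_ge1 k.
have q0 : 0 < q.
  rewrite lt_neqAle q0' andbT; apply/eqP => e; move: cq; rewrite -e mul0r.
  by rewrite leNgt c00.
pose Y := ln (C + 1) + ln k.+1%:R.
have Y0 : 0 <= Y by rewrite addr_ge0.
have [T /andP[T1 T2]] := nat_above (divr_ge0 Y0 q0').
have q10 : 0 <= 1 - q by rewrite subr_ge0.
(* Twice as many factors, because of the square root. *)
exists (T * 2)%N; split.
  have E : (C + 1) * k.+1%:R = expR Y by rewrite expRD !lnK ?posrE ?ltr_wpDl.
  rewrite exprM sqrtr_sqr ger0_norm ?exprn_ge0//.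
  apply: (@le_trans _ _ (expR Y * expR (T%:R * - q))).
    rewrite -E expRM_natl ler_pM ?mulr_ge0 ?exprn_ge0//.
      by rewrite ler_wpM2r// lerDl.
    by rewrite lerXn2r ?nnegrE ?expR_ge0//; exact: expR_ge1Dx.
  rewrite -expRD -[leRHS]expR0 ler_expR.
  move: T1; rewrite ler_pdivrMr//; lra.
rewrite natrM mulrC -mulrA ler_wpM2l//; apply: le_trans T2 _.
have lr : 1 <= lg k * rt4 k by rewrite -[leLHS]mulr1 ler_pM.
rewrite [leRHS]mulrDl [1 * _]mul1r lerD// [leRHS]mulrAC ler_pdivlMr//.
have -> : Y / q * c0 = Y * (c0 / q) by ring.
apply: (@le_trans _ _ (Y * rt4 k)).
  by rewrite ler_wpM2l// ler_pdivrMr// mulrC.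
rewrite mulrA ler_wpM2r ?(le_trans ler01)//.
rewrite mulrDl mul1r lerD//; first by rewrite ler_peMr.
by rewrite /lg lerDr.
Qed.

Lemma rt_le_nat k : Num.sqrt k.+1%:R <= k.+1%:R :> R.
Proof.
have r1 := rt_ge1 k; rewrite -[leRHS](@sqr_sqrtr _ k.+1%:R)// expr2 ler_peMl// sqrtr_ge0.
Qed.

End IterationCounts.

Section InnerCalls.
Context {R : realType} {d n m : nat} (P : problem R d n m).
Variables (Lf0 : R) (Lf : 'I_m -> R) (G M Bf0 : R) (Bf : 'I_m -> R) (rho0 : R)
  (xfeas : 'cV[R]_d).
Hypothesis S : assumptions P Lf0 Lf G M Bf0 Bf rho0 xfeas.
Variables (prm : apg_params R) (Mini muini gam beta : R).
Hypotheses (prm_ok : apg_params_ok prm) (Mini_gt0 : 0 < Mini) (muini_gt0 : 0 < muini)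
  (muini_le : muini <= L_min prm) (gam_gt : rho0 < gam) (beta_gt0 : 0 < beta).
Local Notation X := (dom_g P).
Local Notation D := (diameter X).
Local Notation rt k := (Num.sqrt (k.+1%:R : R)).
Local Notation beta_ k := (sched_beta beta k).
Local Notation eps_ k := (sched_eps beta k).

(** The estimates L and mu are handed from one call to the next, so their bounds
    have to hold along the whole run. The upper bound on L grows with sqrt k,
    together with the curvature of the penalized objective. *)
Definition call_inv (Mlow Mup mulow : R) k (x : 'cV[R]_d) (L mu : R) :=
  [/\ X x, Mlow <= L <= Mup * rt k & mulow <= mu <= L_min prm].

Definition call k (x : 'cV[R]_d) (L mu : R) :=
  adap_apg prm (penalty P gam (beta_ k) x) (g P) x L mu (eps_ k).

(** Every quantity that the bound of [adap_apg_bound] needs is estimated in k: Lam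
    and Mup grow like sqrt k and q decays like k^(-1/4); the search length J and the
    number A + B of restarts grow logarithmically, and the stage length T as
    k^(1/4) times a logarithm. The cost J * (A + B + 1) * (T + 1) is then of order
    k^(1/4) times the cube of a logarithm. *)
Lemma inner_calls : exists Mlow Mup mulow C : R,
  [/\ Mlow <= Mini <= Mup, mulow <= muini, 0 <= Mup, 0 <= C &
  forall k x L mu, call_inv Mlow Mup mulow k x L mu ->
    (exists x' L' mu' c, call k x L mu x' L' mu' c) /\
    (forall x' L' mu' c, call k x L mu x' L' mu' c ->
       [/\ call_inv Mlow Mup mulow k x' L' mu',
           omega (penalty P gam (beta_ k) x) (g P) x' <= eps_ k &
           c%:R <= C * (lg k ^+ 3 * rt4 k)])].
Proof.
have [gi gd gs th01] := prm_ok; have /andP[th0 th1] := th01.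
have g0 : 0 < gam by apply: le_lt_trans (rho0_ge0 S) gam_gt.
pose ms := gam - rho0; have ms0 : 0 < ms by rewrite subr_gt0.
have [Lam0 Lam00 hLam] := penalty_smooth_on S (gam_dec_ge0 prm_ok) (ltW g0).
have Lmin0 : 0 < L_min prm by apply: lt_le_trans muini_le.
have D0 : 0 <= D := diameter_ge0 S.
pose Mlow := Num.min Mini (L_min prm).
pose mulow := Num.min muini (ms / gam_sc prm).
have gs0 : 0 < gam_sc prm by apply: lt_trans gs.
have gi0 : 0 < gam_inc prm by apply: lt_trans gi.
have Mlow0 : 0 < Mlow by rewrite lt_min Mini_gt0 Lmin0.
have mulow0 : 0 < mulow by rewrite lt_min muini_gt0 divr_gt0.
pose Lam1 := Lam0 * (1 + beta).
have Lam10 : 0 <= Lam1 by rewrite mulr_ge0// addr_ge0// ltW.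
pose Mup := Num.max Mini (Num.max (L_min prm) (gam_inc prm * Lam1)).
have Mup1 : Mini <= Mup by rewrite le_max lexx.
have Mup2 : L_min prm <= Mup by rewrite !le_max lexx orbT.
have Mup3 : gam_inc prm * Lam1 <= Mup by rewrite !le_max lexx !orbT.
have Mup0 : 0 < Mup by apply: lt_le_trans Mup1.
clearbody Mup.
have ML0 : 0 <= 1 + Lam1 / Mlow by rewrite addr_ge0// divr_ge0// ltW.
(* A reductions by gam_sc bring mu from L_min below the modulus ms. *)
have [A hA] : exists A, L_min prm <= ms * gam_sc prm ^+ A.
  have gsi : 0 < (gam_sc prm)^-1 < 1 by rewrite invr_gt0 gs0 invf_lt1.
  have [c _ /(_ 0%N)[A [hA _]]] := geometric_index 0 gsi (divr_ge0 (ltW Lmin0) (ltW ms0)).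
  exists A; move: hA; rewrite expr0 mulr1 exprVn ler_pdivrMr ?exprn_gt0// mul1r.
  by rewrite ler_pdivrMr// mulrC.
(* B bounds how often the gradient mapping can shrink by the factor th_sc before
   the accuracy eps_ k is reached. The exponent 3 covers the growth in k of the
   curvature, of the trial values, of beta_ and of the factor k.+1 in 1 / eps_ k. *)
pose CB := (1 + Lam1 / Mlow) * (Mup * D) * beta.
have CB0 : 0 <= CB by rewrite mulr_ge0 ?(ltW beta_gt0)// mulr_ge0// mulr_ge0// ltW.
have [cB cB0 hB] := geometric_index 3 th01 CB0.
(* J trials multiply L by gam_inc often enough to leave [Mlow, Mup * rt k]. *)
have gii : 0 < (gam_inc prm)^-1 < 1 by rewrite invr_gt0 gi0 invf_lt1.
have [cJ cJ0 hJ] := geometric_index 1 gii (divr_ge0 (ltW Mup0) (ltW Mlow0)).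
(* After T contractions of tau the test that reduces mu must succeed. *)
pose CT := 2 * Num.sqrt 2 * (Mup / mulow) * (1 + Lam1 / Mlow) / th_sc prm.
have CT0 : 0 <= CT.
  apply: divr_ge0 (ltW th0); apply: mulr_ge0 ML0; rewrite mulr_ge0 ?mulr_ge0 ?sqrtr_ge0 ?invr_ge0 ?(ltW mulow0) ?(ltW Mup0)//.
have c00 : 0 < Num.sqrt (mulow / Mup) by rewrite sqrtr_gt0 divr_gt0.
have [cT cT0 hT] := contraction_index CT0 c00.
pose C := (cJ + 1) * ((A%:R + cB + 1) * (cT + 1) + 1).
have A0 : 0 <= A%:R :> R by [].
exists Mlow, Mup, mulow, C; split.
- by rewrite Mup1 ge_min lexx.
- by rewrite ge_min lexx.
- exact: ltW.
- by rewrite /C mulr_ge0 ?addr_ge0 ?mulr_ge0 ?addr_ge0.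
move=> k x L mu [Xx hL hmu].
have r1 := rt_ge1 (R := R) k; have r0 : 0 <= rt k by exact: sqrtr_ge0.
have l1 := lg_ge1 (R := R) k; have f1 := rt4_ge1 (R := R) k.
have bk0 : 0 < beta_ k by exact: sched_beta_gt0.
pose Lam := Lam0 * (1 + beta_ k).
have Lamle : Lam <= Lam1 * rt k.
  rewrite /Lam /Lam1 -mulrA ler_wpM2l// mulrDl mul1r lerD2r//.
have Lamge : 0 <= Lam by rewrite mulr_ge0// addr_ge0// ltW.
pose Mupk := Mup * rt k.
have Mupk_ge : Mup <= Mupk by rewrite /Mupk ler_peMr// ltW.
have Mupk0 : 0 < Mupk by apply: lt_le_trans Mupk_ge.
have [J' [hJ1 hJ2]] := hJ k; have [B [hB1 hB2]] := hB k.
pose q := Num.sqrt (mulow / Mupk).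
have q0 : 0 <= q by exact: sqrtr_ge0.
have q2 : q ^+ 2 * Mupk = mulow by rewrite sqr_sqrtr ?divr_ge0 ?(ltW mulow0) ?(ltW Mupk0)// divfK// gt_eqF.
have mulowMup : mulow <= Mupk.
  by apply: le_trans Mupk_ge; apply: le_trans Mup2; apply: le_trans muini_le; rewrite ge_min lexx.
have q01 : 0 <= q <= 1.
  rewrite q0/= -[leRHS]sqrtr1 ler_wsqrtr// ler_pdivrMr// mul1r//.
have cq : Num.sqrt (mulow / Mup) <= q * rt4 k.
  rewrite /q /rt4 -sqrtrM ?divr_ge0 ?(ltW mulow0) ?(ltW Mupk0)// ler_wsqrtr// /Mupk.
  have rp : 0 < rt k by apply: lt_le_trans r1.
  by rewrite invfM mulrA mulfVK// gt_eqF.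
have [T [hT1 hT2]] := hT k q q01 cq.
have J_large L' j : Mlow <= L' -> L' * gam_inc prm ^+ j <= Mupk -> (j.+1 <= J'.+1)%N.
  move=> ML h; rewrite ltnS leqNgt; apply/negP => lt.
  have L'0 : 0 < L' by apply: lt_le_trans ML.
  move: hJ1; rewrite expr1 exprVn ler_pdivrMr ?exprn_gt0// mul1r => h1.
  have h2 : gam_inc prm ^+ J' < gam_inc prm ^+ j by rewrite ltr_eXn2l.
  have h3 : Mlow * gam_inc prm ^+ j <= Mupk.
    by apply: le_trans h; rewrite ler_wpM2r ?exprn_ge0 ?(ltW gi0).
  have h4 : Mupk <= Mlow * gam_inc prm ^+ J'.
    rewrite -ler_pdivrMl//; apply: le_trans h1; rewrite mulrC /Mupk mulrAC ler_wpM2l ?divr_ge0 ?(ltW Mup0) ?(ltW Mlow0)//.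
    exact: rt_le_nat.
  by have := lt_le_trans (le_lt_trans h4 (_ : _ < Mlow * gam_inc prm ^+ j)) h3; rewrite ltxx ltr_pM2l// => /(_ h2).
pose K1 := 2 * Num.sqrt 2 * (Mupk / mulow) * (1 + Lam / Mlow).
have LamM : 1 + Lam / Mlow <= (1 + Lam1 / Mlow) * rt k.
  by rewrite [leRHS]mulrDl [1 * _]mul1r lerD// [leRHS]mulrAC ler_wpM2r// invr_ge0 ltW.
have rk : rt k ^+ 2 = k.+1%:R by rewrite sqr_sqrtr.
have th_n0 : th_sc prm != 0 by rewrite gt_eqF.
have mul_n0 : mulow != 0 by rewrite gt_eqF.
have T_large : K1 * Num.sqrt ((1 - q) ^+ T) <= th_sc prm.
  have K1le : K1 <= CT * k.+1%:R * th_sc prm.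
    have -> : CT * k.+1%:R * th_sc prm = 2 * Num.sqrt 2 * (Mupk / mulow) * ((1 + Lam1 / Mlow) * rt k).
      rewrite /CT /Mupk; set r := rt k in rk *; rewrite -rk; field.
      by rewrite th_n0 mul_n0 gt_eqF.
    rewrite /K1 ler_wpM2l//; apply: mulr_ge0; first by rewrite mulr_ge0 ?sqrtr_ge0.
    exact: divr_ge0 (ltW Mupk0) (ltW mulow0).
  apply: le_trans (ler_wpM2r (sqrtr_ge0 _) K1le) _.
  by rewrite mulrAC; apply: ler_piMl => //; exact: ltW.
have B_large : (1 + Lam / Mlow) * th_sc prm ^+ B * (Mupk * D) <= eps_ k.
  have tB0 : 0 <= th_sc prm ^+ B by rewrite exprn_ge0 ?(ltW th0).
  rewrite /sched_eps -[leRHS]mul1r ler_pdivlMr ?mulr_gt0//.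
  apply: le_trans hB1.
  have -> : CB * k.+1%:R ^+ 3 * th_sc prm ^+ B =
    (1 + Lam1 / Mlow) * k.+1%:R * th_sc prm ^+ B * (Mup * D * beta * k.+1%:R ^+ 2).
    by rewrite /CB; ring.
  have -> : (1 + Lam / Mlow) * th_sc prm ^+ B * (Mupk * D) * (beta_ k * k.+1%:R) =
    (1 + Lam / Mlow) * th_sc prm ^+ B * (Mup * D * beta * k.+1%:R ^+ 2).
    by rewrite /sched_beta /Mupk; set r := rt k in rk *; rewrite -rk; ring.
  rewrite ler_wpM2r//.
    by rewrite mulr_ge0 ?exprn_ge0// mulr_ge0 ?(ltW beta_gt0)// mulr_ge0// ltW.
  rewrite ler_wpM2r//; apply: le_trans LamM _; rewrite ler_wpM2l//; exact: rt_le_nat.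
have [xs Xxs xsmin] := argmin_exists (g_Noo S) (g_lsc S)
  (dom_compact S) (g_bound S) (xfeas_dom S)
  (penalty_lower S x (ltW g0) (ltW bk0)).
have [up lip] := hLam _ x (ltW bk0).
have low := penalty_lower S x (ltW g0) (ltW bk0).
rewrite -(grad_penalty S) in up lip low.
have K1_ge : 2 * Num.sqrt 2 * (Mupk / mulow) * (1 + Lam / Mlow) <= K1 by [].
have Mlow_le : Mlow <= L_min prm by rewrite ge_min lexx orbT.
have Mupk_Lmin : L_min prm <= Mupk by apply: le_trans Mupk_ge.
have Mupk_Lam : gam_inc prm * Lam <= Mupk.
  apply: le_trans (ler_wpM2l (ltW gi0) Lamle) _; rewrite mulrA ler_wpM2r//.
have mulow_le : mulow <= ms / gam_sc prm by rewrite ge_min lexx orbT.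
have dom_D u v : X u -> X v -> enorm (u - v) <= D by exact: (diameter_ge S).
have q2' : q ^+ 2 * Mupk <= mulow by rewrite q2.
split.
  exact: (adap_apg_exists prm_ok (g_Noo S) (g_lsc S) (g_convex S)
    (dom_compact S) (g_bound S) Lamge low up lip
    Mlow0 Mlow_le Mupk_Lmin Mupk_Lam mulow0 mulow_le Xxs xsmin q01 q2' K1_ge T_large
    hA B_large dom_D Xx hL hmu).
move=> x' L' mu' c hcall.
have [Xx' om hL' hmu' hc] := adap_apg_bound prm_ok (g_Noo S) (g_lsc S) (g_convex S)
    (dom_compact S) (g_bound S) Lamge low up lip
    Mlow0 Mlow_le Mupk_Lmin Mupk_Lam mulow0 mulow_le Xxs xsmin q01 q2' K1_ge T_large
    J_large hA B_large dom_D Xx hL hmu hcall.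
split=> //.
have {}hc : c%:R <= (J'.+1 * ((A + B).+1 * T.+1).+1)%:R :> R by rewrite ler_nat.
have hcE : (J'.+1 * ((A + B).+1 * T.+1).+1)%:R =
    (J'%:R + 1) * ((A%:R + B%:R + 1) * (T%:R + 1) + 1) :> R.
  by rewrite -natrD !natr1 -natrM natr1 -natrM.
apply: le_trans hc _; rewrite hcE.
set l := lg k in l1 hJ2 hB2 hT2 *; set f := rt4 k in f1 hT2 *.
have l0 : 0 <= l by apply: le_trans l1.
have f0 : 0 <= f by apply: le_trans f1.
have lf : 1 <= l * f by rewrite -[leLHS]mulr1 ler_pM.
have i1 : J'%:R + 1 <= (cJ + 1) * l by rewrite mulrDl mul1r lerD.
have i2 : A%:R + B%:R + 1 <= (A%:R + cB + 1) * l.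
  rewrite !mulrDl mul1r !lerD//; by rewrite ler_peMr.
have i3 : T%:R + 1 <= (cT + 1) * (l * f) by rewrite mulrDl mul1r lerD.
have i4 : (A%:R + B%:R + 1) * (T%:R + 1) + 1 <= ((A%:R + cB + 1) * (cT + 1) + 1) * (l * (l * f)).
  rewrite [leRHS]mulrDl mul1r lerD//; last by rewrite -[leLHS]mulr1 ler_pM.
  have -> : (A%:R + cB + 1) * (cT + 1) * (l * (l * f)) = ((A%:R + cB + 1) * l) * ((cT + 1) * (l * f)) by ring.
  by rewrite ler_pM// ?addr_ge0.
apply: le_trans (ler_pM _ _ i1 i4) _; rewrite ?addr_ge0 ?mulr_ge0 ?addr_ge0//.
by rewrite le_eqVlt; apply/orP; left; apply/eqP; rewrite /C; ring.
Qed.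

Variable x0 : 'cV[R]_d.
Hypothesis x0_dom : X x0.
Local Notation gamk := (fun _ : nat => gam).
Local Notation betak := (fun k : nat => beta * Num.sqrt k.+1%:R).
Local Notation epshk := (fun k : nat => (betak k * k.+1%:R)^-1).
Local Notation run := (ippp_run P prm x0 Mini muini gamk betak epshk).

Lemma best_index tr k : exists r, (1 <= r <= k.+1)%N /\
  forall l, (1 <= l <= k.+1)%N -> residual P betak tr r <= residual P betak tr l.
Proof.
pose i0 := [arg min_(i < (ord0 : 'I_k.+1)) residual P betak tr i.+1]%O.
have h (j : 'I_k.+1) : residual P betak tr i0.+1 <= residual P betak tr j.+1.
  by rewrite /i0; case: arg_minP => //= i _; apply.
exists i0.+1; split=> [|[//|l] /= lk]; first by rewrite /= ltn_ord.
exact: (h (Ordinal lk)).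
Qed.

(** A run is built by choosing the outcome of each call, which is possible because
    the invariant is preserved by every outcome; the bounds hold for all choices. *)
Lemma runs : exists2 C : R, 0 <= C & (exists tr, run tr) /\
  forall tr, run tr -> [/\ forall k, X (xbar tr k),
    forall k, omega (penalty P gam (beta_ k) (xbar tr k)) (g P) (xbar tr k.+1) <= eps_ k &
    forall k, (nprox tr k)%:R <= C * (lg k ^+ 3 * rt4 k)].
Proof.
have [Mlow [Mup [mulow [C [/andP[Ml Mu] mul Mup0 C0 hcall]]]]] := inner_calls.
have inv0 : call_inv Mlow Mup mulow 0 x0 Mini muini.
  by split; rewrite ?Ml ?mul ?muini_le ?sqrtr1 ?mulr1.
have invS k x L mu : call_inv Mlow Mup mulow k x L mu -> call_inv Mlow Mup mulow k.+1 x L mu.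
  move=> [Xx /andP[l u] hmu]; split=> //; rewrite l (le_trans u)//.
  by rewrite ler_wpM2l// rt_le.
exists C => //; split; last first.
  move=> tr [[e1 e2 e3] hrun _].
  have inv k : call_inv Mlow Mup mulow k (xbar tr k) (Mhat tr k) (muhat tr k).
    elim: k => [|k IH]; first by rewrite e1 e2 e3.
    by apply: invS; have [_ /(_ _ _ _ _ (hrun k))[]] := hcall _ _ _ _ IH.
  by split=> k; have [_ /(_ _ _ _ _ (hrun k))[[]]] := hcall _ _ _ _ (inv k) => //; have [] := inv k.
have /choice[F hF] : forall ks : nat * ('cV[R]_d * R * R), exists s' : 'cV[R]_d * R * R * nat,
    call_inv Mlow Mup mulow ks.1 ks.2.1.1 ks.2.1.2 ks.2.2 ->
    call ks.1 ks.2.1.1 ks.2.1.2 ks.2.2 s'.1.1.1 s'.1.1.2 s'.1.2 s'.2.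
  move=> [k [[x L] mu]] /=.
  have [inv|ninv] := pselect (call_inv Mlow Mup mulow k x L mu); last by exists (0, 0, 0, 0%N).
  have [[x' [L' [mu' [c h]]]] _] := hcall _ _ _ _ inv.
  by exists (x', L', mu', c).
pose fix st k := match k with 0%N => (x0, Mini, muini) | j.+1 => (F (j, st j)).1 end.
have inv k : call_inv Mlow Mup mulow k (st k).1.1 (st k).1.2 (st k).2.
  elim: k => //= k IH; apply: invS.
  by have [_ /(_ _ _ _ _ (hF (k, st k) IH))[]] := hcall _ _ _ _ IH.
pose tr0 := IpppTrace (fun k => (st k).1.1) (fun k => (st k).1.2) (fun k => (st k).2)
  (fun k => (F (k, st k)).2) id.
have /choice[sel hsel] := best_index tr0.
exists (IpppTrace (fun k => (st k).1.1) (fun k => (st k).1.2) (fun k => (st k).2)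
  (fun k => (F (k, st k)).2) (fun k => sel k.-1)); split; [by []|move=> k|move=> k; exact (hsel k)].
exact: hF (k, st k) (inv k).
Qed.

End InnerCalls.

Section Asymptotics.
Context {R : realType}.
Implicit Types (eps a c : R).

(** Landau bounds at 0^'+ reduce to an inequality on a right neighbourhood of 0. *)
Lemma right_bigO (f h : R -> R) (k del : R) : 0 < k -> 0 < del ->
  (forall eps, 0 < eps < del -> `|f eps| <= k * `|h eps|) -> f =O_ (0^'+) h.
Proof.
move=> k0 d0 H; apply/eqO_exP; exists k => //.
exists del => //= x; rewrite /ball_ /= sub0r normrN => xd x0.
by apply: H; rewrite x0 (le_lt_trans (ler_norm x)).
Qed.

Lemma lg_le (k K : nat) : (k < K)%N -> lg k <= 1 + ln K%:R :> R.
Proof.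
case: K => // K kK; rewrite lerD2l ler_ln ?posrE// ler_nat//.
Qed.

Lemma rt4_le (k K : nat) : (k < K)%N -> rt4 k <= Num.sqrt (Num.sqrt K%:R) :> R.
Proof. by move=> kK; rewrite !ler_wsqrtr// ler_nat. Qed.

Lemma cost_sum (C : R) (cost : nat -> nat) K : 0 <= C -> (0 < K)%N ->
  (forall k, (cost k)%:R <= C * (lg k ^+ 3 * rt4 k)) ->
  (\sum_(k < K) cost k)%:R <= C * (K%:R * Num.sqrt (Num.sqrt K%:R) * (1 + ln K%:R) ^+ 3).
Proof.
move=> C0 K0 hc; rewrite natr_sum.
apply: (@le_trans _ _ (\sum_(k < K) C * ((1 + ln K%:R) ^+ 3 * Num.sqrt (Num.sqrt K%:R)))).
  apply: ler_sum => k _; apply: le_trans (hc k) _; rewrite ler_wpM2l//.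
  have l0 : 0 <= lg k :> R by apply: le_trans (lg_ge1 k).
  rewrite ler_pM ?exprn_ge0 ?sqrtr_ge0//; last exact: rt4_le.
  by rewrite lerXn2r ?nnegrE ?(le_trans l0) ?lg_le.
rewrite sumr_const card_ord -[leLHS]mulr_natl.
by rewrite le_eqVlt; apply/orP; left; apply/eqP; ring.
Qed.

(** With K of order eps^(-2), the sum of (k+1)^(1/4) over k < K is at most
    K^(5/4), that is eps^(-5/2); each of the three logarithms of K is at most a
    multiple of the logarithm of 1 / eps, as soon as the latter is at least 1. *)
Lemma soft_bigO_cost (cost : nat -> nat) (K : R -> nat) (C c : R) :
  0 <= C -> 1 <= c -> (forall k, (cost k)%:R <= C * (lg k ^+ 3 * rt4 k)) ->
  (forall eps, 0 < eps < 1 -> (0 < K eps)%N /\ (K eps)%:R <= c * eps ^- 2) ->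
  soft_bigO (fun eps => (\sum_(k < K eps) cost k)%:R) (5 / 2 : R).
Proof.
move=> C0 c1 hc hK; exists 3%N.
have c0 : 0 < c by apply: lt_le_trans c1.
have lc : 0 <= ln c by exact: ln_ge0.
pose k := C * (c * Num.sqrt (Num.sqrt c)) * (3 + ln c) ^+ 3 + 1.
have k0 : 0 <= C * (c * Num.sqrt (Num.sqrt c)) * (3 + ln c) ^+ 3.
  by rewrite mulr_ge0 ?exprn_ge0 ?addr_ge0// mulr_ge0// mulr_ge0 ?sqrtr_ge0// ltW.
apply: (@right_bigO _ _ k (expR (-1))); rewrite ?expR_gt0// /k ?ltr_wpDl//.
move=> eps /andP[e0 e1].
have e1' : eps < 1 by apply: lt_trans e1 _; rewrite -[ltRHS]expR0 ltr_expR; lra.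
have [|K0 Kle] := hK eps; first by rewrite e0.
set l := ln eps^-1.
have l1 : 1 <= l.
  rewrite /l lnV ?posrE// lerNr -[leRHS]expRK ler_ln ?posrE ?expR_gt0//; exact: ltW.
have ei0 : 0 < eps^-1 by rewrite invr_gt0.
have pw0 := powR_ge0 eps (- (5 / 2)).
rewrite ger0_norm// ger0_norm ?mulr_ge0 ?exprn_ge0 ?(le_trans ler01 l1)//.
apply: le_trans (cost_sum C0 K0 hc) _.
have lnK : 1 + ln (K eps)%:R <= (3 + ln c) * l.
  have : ln (K eps)%:R <= ln c + 2 * l.
    apply: le_trans (_ : ln (c * eps ^- 2) <= _).
      by rewrite ler_ln ?posrE ?ltr0n// mulr_gt0 ?invr_gt0 ?exprn_gt0.
    by rewrite lnM ?posrE ?invr_gt0 ?exprn_gt0// -exprVn lnXn// -[_ *+ 2]mulr_natl.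
  have : ln c <= ln c * l by rewrite ler_peMr.
  lra.
have lnK0 : 0 <= 1 + ln (K eps)%:R :> R by rewrite addr_ge0// ln_ge0// ler1n.
have E : eps `^ (- (5 / 2)) = eps ^- 2 * Num.sqrt eps^-1.
  have -> : - (5 / 2) = - 2%:R + - 2^-1 :> R by lra.
  rewrite powRD; last by apply/implyP => _; rewrite gt_eqF.
  by rewrite !powRN powR_mulrn ?(ltW e0)// powR12_sqrt ?(ltW e0)// sqrtrV// ltW.
have sK : Num.sqrt (Num.sqrt (K eps)%:R) <= Num.sqrt (Num.sqrt c) * Num.sqrt eps^-1.
  rewrite -sqrtrM ?sqrtr_ge0// ler_wsqrtr//.
  have <- : Num.sqrt (c * eps ^- 2) = Num.sqrt c * eps^-1.
    by rewrite sqrtrM ?(ltW c0)// -exprVn sqrtr_sqr ger0_norm// ltW.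
  exact: ler_wsqrtr.
have main : (K eps)%:R * Num.sqrt (Num.sqrt (K eps)%:R) * (1 + ln (K eps)%:R) ^+ 3 <=
    c * eps ^- 2 * (Num.sqrt (Num.sqrt c) * Num.sqrt eps^-1) * ((3 + ln c) * l) ^+ 3.
  rewrite ler_pM ?mulr_ge0 ?sqrtr_ge0 ?exprn_ge0//; first by rewrite ler_pM ?sqrtr_ge0.
  by rewrite lerXn2r ?nnegrE ?(le_trans lnK0).
apply: le_trans (ler_wpM2l C0 main) _; rewrite E.
rewrite [leLHS](_ : _ = C * (c * Num.sqrt (Num.sqrt c)) * (3 + ln c) ^+ 3 *
  (eps ^- 2 * Num.sqrt eps^-1 * l ^+ 3)); last by ring.
rewrite ler_wpM2r ?lerDl// mulr_ge0 ?exprn_ge0 ?(le_trans ler01 l1)//.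
by rewrite mulr_ge0 ?sqrtr_ge0 ?invr_ge0 ?exprn_ge0// ltW.
Qed.

Lemma absz_ceil_bounds (x : R) : 0 <= x ->
  x <= (absz (Num.ceil x))%:R <= x + 1.
Proof.
move=> x0; have c0 : 0 <= Num.ceil x by rewrite ceil_ge0// (lt_le_trans _ x0)// ltrN10.
have -> : (absz (Num.ceil x))%:R = (Num.ceil x)%:~R :> R by rewrite natr_absz ger0_norm.
have /andP[a b] := ceil_itv x; rewrite b/=.
by move: a; rewrite intrD rmorphN1; lra.
Qed.

End Asymptotics.

Section IterationBudget.
Context {R : realType} {d n m : nat} (P : problem R d n m).
Variables (Bf0 : R) (Bf : 'I_m -> R) (G M : R) (xfeas x0 : 'cV[R]_d) (gam beta : R).
Hypothesis beta_gt0 : 0 < beta.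
Local Notation Kb := (Kbound P Bf0 Bf G M xfeas x0 gam beta).
Local Notation K := (Kiter P Bf0 Bf G M xfeas x0 gam beta).

Lemma Kbound_gt0 eps : 0 < eps -> 0 < Kb eps.
Proof. by move=> e0; rewrite lt_max divr_gt0// mulr_gt0. Qed.

Lemma Kiter_bounds eps : 0 < eps -> Kb eps <= (K eps)%:R <= Kb eps + 1.
Proof. by move=> e0; apply: absz_ceil_bounds; apply/ltW/Kbound_gt0. Qed.

Lemma Kiter_gt0 eps : 0 < eps -> (0 < K eps)%N.
Proof.
move=> e0; have /andP[h _] := Kiter_bounds e0.
by rewrite -(ltr0n R); apply: lt_le_trans h; exact: Kbound_gt0.
Qed.

Lemma Kiter_quadratic : exists2 c : R, 1 <= c &
  forall eps, 0 < eps < 1 -> (0 < K eps)%N /\ (K eps)%:R <= c * eps ^- 2.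
Proof.
rewrite /Kiter /Kbound; set E := (X in X ^+ 2).
have b0 : 0 <= 6 / beta by rewrite divr_ge0// ltW.
have E0 : 0 <= 4 * E ^+ 2 by rewrite mulr_ge0 ?sqr_ge0.
exists (6 / beta + 4 * E ^+ 2 + 1); first by rewrite lerDr addr_ge0.
move=> eps /andP[e0 e1]; split; first exact: Kiter_gt0.
have /andP[_ h] := Kiter_bounds e0; apply: le_trans h _; rewrite /Kbound -/E.
have ei1 : 1 <= eps^-1 by rewrite invf_ge1// ltW.
have ei2 : eps^-1 <= eps ^- 2 by rewrite -exprVn expr2 ler_peMr// invr_ge0 ltW.
have ee0 : 0 <= eps ^- 2 by rewrite invr_ge0 exprn_ge0// ltW.
have t1 : 0 <= 6 / beta * eps ^- 2 by rewrite mulr_ge0.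
have t2 : 0 <= 4 * E ^+ 2 * eps ^- 2 by rewrite mulr_ge0.
have -> : (6 / beta + 4 * E ^+ 2 + 1) * eps ^- 2 =
  (6 / beta * eps ^- 2 + 4 * E ^+ 2 * eps ^- 2) + eps ^- 2 by ring.
rewrite lerD//; last by apply: le_trans ei2.
rewrite ge_max; apply/andP; split.
  have -> : 6 / (beta * eps) = 6 / beta * eps^-1 by rewrite invfM mulrA.
  by have := ler_wpM2l b0 ei2; lra.
have -> : 4 / eps ^+ 2 * E ^+ 2 = 4 * E ^+ 2 * eps ^- 2 by ring.
by lra.
Qed.

End IterationBudget.

Theorem corollary1 (R : realType) (d n m : nat) (P : problem R d n m)
    (Lf0 : R) (Lf : 'I_m -> R) (G M : R) (Bf0 : R) (Bf : 'I_m -> R)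
    (rho0 : R) (xfeas : 'cV[R]_d)
    (hP : well_posed P)
    (hgen : general_assumptions P Lf0 Lf G M)
    (hB : data_bounds P Bf0 Bf)
    (hconv : convex_constraint_assumptions P rho0 xfeas)
    (prm : apg_params R) (hprm : apg_params_ok prm)
    (x0 : 'cV[R]_d) (hx0 : dom_g P x0)
    (Mini muini : R) (hMini : 0 < Mini) (hmuini : 0 < muini)
    (hLmin : muini <= L_min prm)
    (gam beta : R) (hgam : rho0 < gam) (hbeta : 0 < beta) :
  let gamk := fun _ : nat => gam in
  let betak := fun k : nat => beta * Num.sqrt k.+1%:R in
  let epshk := fun k : nat => (betak k * k.+1%:R)^-1 in
  let run := ippp_run P prm x0 Mini muini gamk betak epshk in
  let K := Kiter P Bf0 Bf G M xfeas x0 gam beta in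
  [/\ (fun eps : R => (K eps)%:R : R) =O_ (0^'+) (fun eps : R => eps ^- 2),
      exists tr, run tr
    & forall tr, run tr ->
        (forall eps : R, 0 < eps ->
           stationary P eps (xbar tr (Rsel tr (K eps)))) /\
        soft_bigO (fun eps : R => (\sum_(k < K eps) nprox tr k)%:R) (5 / 2)].
Proof.
move=> gamk betak epshk run K.
have S : assumptions P Lf0 Lf G M Bf0 Bf rho0 xfeas by split.
have [C C0 [run_ex run_bd]] := runs S hprm hMini hmuini hLmin hgam hbeta hx0.
have [c c1 hK] := Kiter_quadratic P Bf0 Bf G M xfeas x0 gam hbeta.
have c0 : 0 < c by apply: lt_le_trans c1.
split=> // [|tr htr].
  apply: (@right_bigO _ _ _ c 1) => // eps e01; have [_ h] := hK _ e01.
  rewrite ger0_norm// ger0_norm// invr_ge0 exprn_ge0//.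
  by case/andP: e01 => /ltW.
have [hdom hom hcost] := run_bd tr htr; case: (htr) => -[hx _ _] _ hsel.
split=> [eps e0|]; last exact: soft_bigO_cost C0 c1 hcost hK.
have /andP[hKb _] := Kiter_bounds P Bf0 Bf G M xfeas x0 gam hbeta e0.
have := Kiter_gt0 P Bf0 Bf G M xfeas x0 gam hbeta e0.
rewrite -/(K eps) in hKb *; case: (K eps) hKb => // k hKb _.
apply: (best_stationary S hgam hbeta hdom hom hsel e0).
by rewrite hx.
Qed.
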